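(* Let $p,q$ be nonnegative integers, let $\kappa_1,\dots,\kappa_p,\mu_1,\dots,\mu_q$ be complex numbers none of which is in $\{0,-1,-2,\dots\}$, let $\alpha,\beta\in\mathbb{C}$ with $\Re(\alpha)>0$, let $\lambda_1,\lambda_2,\lambda_3\in\mathbb{C}$ with $\Re(\lambda_3)>\Re(\lambda_2)>0$, let $\rho\in\mathbb{C}$ with $\Re(\rho)>0$, and let $z\in\mathbb{C}$. Then the M-Gauss hypergeometric function has the integral representations $$\begin{aligned} {}^{M}F_{p,q}^{(\alpha,\beta)}(\lambda_{1},\lambda_{2};\lambda_{3};z;\rho)&=\frac{1}{B(\lambda_{2},\lambda_{3}-\lambda_{2})}\int_{0}^{1}t^{\lambda_{2}-1}(1-t)^{\lambda_{3}-\lambda_{2}-1}(1-zt)^{-\lambda_{1}}\\ &\quad\times{}_{p}^{\alpha}M^{\beta}_{q}\left(\kappa_{1},\ldots,\kappa_{p};\mu_{1},\ldots,\mu_{q};\frac{-\rho}{t(1-t)}\right)dt,\\ {}^{M}F_{p,q}^{(\alpha,\beta)}(\lambda_{1},\lambda_{2};\lambda_{3};z;\rho)&=\frac{1}{B(\lambda_{2},\lambda_{3}-\lambda_{2})}\int_{0}^{\infty}u^{\lambda_{2}-1}(1+u)^{\lambda_{1}-\lambda_{3}}\big( 1+u(1-z)\big)^{-\lambda_{1}}\\ &\quad\times{}_{p}^{\alpha}M^{\beta}_{q}\left(\kappa_{1},\ldots,\kappa_{p};\mu_{1},\ldots,\mu_{q};-2\rho-\rho\left( u+\frac{1}{u}\right)\right)du,\\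 {}^{M}F_{p,q}^{(\alpha,\beta)}(\lambda_{1},\lambda_{2};\lambda_{3};z;\rho)&=\frac{2}{B(\lambda_{2},\lambda_{3}-\lambda_{2})}\int_{0}^{\frac{\pi}{2}} \sin^{2\lambda_{2}-1}(\theta) \cos^{2\lambda_{3}-2\lambda_{2}-1}(\theta)\left( 1-z \sin^{2}(\theta)\right) ^{-\lambda_{1}}\\ &\quad\times{}_{p}^{\alpha}M^{\beta}_{q}\left(\kappa_{1},\ldots,\kappa_{p};\mu_{1},\ldots,\mu_{q};\frac{-\rho}{ \sin^{2}(\theta) \cos^{2}(\theta)}\right)d\theta. \end{aligned}$$
   Context: $(\lambda)_m=\Gamma(\lambda+m)/\Gamma(\lambda)$, $(\lambda)_0=1$ is the Pochhammer symbol and $B(x,y)=\int_0^1 t^{x-1}(1-t)^{y-1}dt$ is the classical beta function. The generalized M-series is $${}_{p}^{\alpha}M^{\beta}_{q}(\kappa_{1},\ldots,\kappa_{p};\mu_{1},\ldots,\mu_{q};z)=\sum_{m=0}^{\infty}\frac{(\kappa_{1})_{m}\cdots(\kappa_p)_{m}}{(\mu_1)_{m}\cdots(\mu_q)_{m}}\frac{z^{m}}{\Gamma(\alpha m+\beta)}.$$ With parameters $\kappa_1,\dots,\kappa_p;\mu_1,\dots,\mu_q$ suppressed from the notation, the modified beta (M-beta) and modified Gauss hypergeometric (M-Gauss hypergeometric) functions are $${}^{M}B_{p,q}^{(\alpha,\beta)}(x,y;\rho)=\int_{0}^{1}t^{x-1}(1-t)^{y-1}\,{}_{p}^{\alpha}M^{\beta}_{q}\left(\kappa_{1},\ldots,\kappa_{p};\mu_{1},\ldots,\mu_{q};\frac{-\rho}{t(1-t)}\right)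 dt,$$ $${}^{M}F_{p,q}^{(\alpha,\beta)}(\lambda_1,\lambda_2;\lambda_3;z;\rho)=\sum_{n=0}^{\infty}(\lambda_1)_{n}\frac{{}^{M}B_{p,q}^{(\alpha,\beta)}(\lambda_2+n,\lambda_3-\lambda_2;\rho)}{B(\lambda_2,\lambda_3-\lambda_2)}\frac{z^{n}}{n!}.$$ These functions are defined for those parameters and arguments for which the series and integrals converge.
   Formalization: For z = 1 the formal theorem also assumes that the first integral converges; this can fail although the series for the M-Gauss function converges (e.g. no κ, μ; α=2, β=1, ρ=1, λ₁=3, λ₂=1, λ₃=2), and then the right-hand side is undefined. *)

(* Defs.v *)
From Stdlib Require Import Reals List Factorial Lra Lia.
From Coquelicot Require Import Coquelicot.

Local Open Scope C_scope.

(** * Complex exponential, principal logarithm and principal powers *)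

Definition Cexp (z : C) : C :=
  (exp (Re z) * cos (Im z), exp (Re z) * sin (Im z))%R.

(* Principal argument, with values in (-PI, PI] for z <> 0. *)
Definition Carg (z : C) : R :=
  if Rle_dec 0 (Im z) then acos (Re z / Cmod z) else (- acos (Re z / Cmod z))%R.

Definition Clog (z : C) : C := (ln (Cmod z), Carg z).

(* Principal value of z^s; 0^0 = 1 and 0^s = 0 for s <> 0. *)
Definition Cpower (z s : C) : C :=
  if Ceq_dec z 0 then (if Ceq_dec s 0 then 1 else 0)
  else Cexp (s * Clog z).

(** * Limits and sums of complex sequences *)

(* Total operators, meaningful when the sequence (series) converges; the
   convergence of series is [ex_series]. *)
Definition CLim_seq (u : nat -> C) : C :=
  (real (Lim_seq (fun n => Re (u n))), real (Lim_seq (fun n => Im (u n)))).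

Definition CSeries (a : nat -> C) : C :=
  (Series (fun n => Re (a n)), Series (fun n => Im (a n))).

(** * Integrals of complex-valued functions of a real variable *)

(* Improper Riemann integrals; the filters [Fa] and [Fb] describe the approach
   to the two ends of the interval. *)
Definition ex_CInt (f : R -> C) (Fa Fb : (R -> Prop) -> Prop) : Prop :=
  ex_RInt_gen (V := C_R_NormedModule) f Fa Fb.

Definition CInt (f : R -> C) (Fa Fb : (R -> Prop) -> Prop) : C :=
  RInt_gen (V := C_R_CompleteNormedModule) f Fa Fb.

(** * Pochhammer symbol, Gamma and beta functions *)

Definition nonpos_int (z : C) : Prop := exists n : nat, z = - RtoC (INR n).

(* Rising factorial z (z+1) ... (z+m-1).  It equals Gamma (z+m) / Gamma z off
   the poles of Gamma (lemma [poch_Gamma] below) and, as usual, it also gives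
   a meaning to the symbol when z is a nonpositive integer. *)
Fixpoint poch (z : C) (m : nat) : C :=
  match m with
  | O => 1
  | S k => poch z k * (z + RtoC (INR k))
  end.

(* Gauss's limit: 1 / Gamma z = lim z (z+1) ... (z+n) / (n! n^z).  The limit
   exists for all z and vanishes exactly at the poles of Gamma.  As Coquelicot
   has / 0 = 0, [Gamma] is 0 at its poles, where  _ / Gamma z  is thus 0, the
   value of the entire function 1 / Gamma. *)
Definition rGamma_seq (z : C) (n : nat) : C :=
  poch z (S n) / (RtoC (INR (fact n)) * Cpower (RtoC (INR n)) z).

Definition rGamma (z : C) : C := CLim_seq (rGamma_seq z).

Definition Gamma (z : C) : C := / rGamma z.

Definition Beta (x y : C) : C :=
  CInt
    (fun t : R => Cpower (RtoC t) (x - 1) * Cpower (1 - RtoC t) (y - 1))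
    (at_right 0) (at_left 1).

(** * Generalized M-series *)

(* The numbers p and q of parameters are the lengths of [kappa] and [mu]. *)
Definition poch_prod (l : list C) (m : nat) : C :=
  fold_right (fun k acc => poch k m * acc) 1 l.

Definition Mseries_term (kappa mu : list C) (alpha beta z : C) (m : nat) : C :=
  poch_prod kappa m / poch_prod mu m
  * (Cpow z m / Gamma (alpha * RtoC (INR m) + beta)).

Definition Mseries_converges (kappa mu : list C) (alpha beta z : C) : Prop :=
  ex_series (Mseries_term kappa mu alpha beta z).

Definition Mseries (kappa mu : list C) (alpha beta z : C) : C :=
  CSeries (Mseries_term kappa mu alpha beta z).

(** * M-beta function *)

Definition Mbeta_integrand (kappa mu : list C) (alpha beta x y rho : C)
    (t : R) : C :=
  Cpower (RtoC t) (x - 1) * Cpower (1 - RtoC t) (y - 1)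
  * Mseries kappa mu alpha beta (- rho / (RtoC t * (1 - RtoC t))).

Definition Mbeta_converges (kappa mu : list C) (alpha beta x y rho : C) : Prop :=
  (forall t : R, (0 < t < 1)%R ->
     Mseries_converges kappa mu alpha beta (- rho / (RtoC t * (1 - RtoC t))))
  /\ ex_CInt
       (Mbeta_integrand kappa mu alpha beta x y rho) (at_right 0) (at_left 1).

Definition Mbeta (kappa mu : list C) (alpha beta x y rho : C) : C :=
  CInt
    (Mbeta_integrand kappa mu alpha beta x y rho) (at_right 0) (at_left 1).

(** * M-Gauss hypergeometric function *)

Definition MGauss_term (kappa mu : list C) (alpha beta l1 l2 l3 z rho : C)
    (n : nat) : C :=
  poch l1 n
  * (Mbeta kappa mu alpha beta (l2 + RtoC (INR n)) (l3 - l2) rho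
     / Beta l2 (l3 - l2))
  * (Cpow z n / RtoC (INR (fact n))).

Definition MGauss_converges (kappa mu : list C)
    (alpha beta l1 l2 l3 z rho : C) : Prop :=
  (forall n : nat,
     Mbeta_converges kappa mu alpha beta (l2 + RtoC (INR n)) (l3 - l2) rho)
  /\ ex_series (MGauss_term kappa mu alpha beta l1 l2 l3 z rho).

Definition MGauss (kappa mu : list C) (alpha beta l1 l2 l3 z rho : C) : C :=
  CSeries (MGauss_term kappa mu alpha beta l1 l2 l3 z rho).

(** * The ratio formula for the Pochhammer symbol *)

Lemma C_ext (a b : C) : Re a = Re b -> Im a = Im b -> a = b.
Proof. destruct a, b; simpl; intros; now f_equal. Qed.

Lemma Cexp_0 : Cexp 0 = 1.
Proof.
unfold Cexp; simpl; rewrite exp_0, cos_0, sin_0; apply C_ext; simpl; ring.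
Qed.

Lemma Cexp_plus (a b : C) : Cexp (a + b) = Cexp a * Cexp b.
Proof.
unfold Cexp; destruct a as [a1 a2], b as [b1 b2]; simpl.
rewrite exp_plus, cos_plus, sin_plus; apply C_ext; simpl; ring.
Qed.

Lemma Carg_pos (x : R) : (0 < x)%R -> Carg (RtoC x) = 0%R.
Proof.
intros Hx; unfold Carg; simpl.
destruct (Rle_dec 0 0) as [_|H]; [|lra].
rewrite Cmod_R, Rabs_pos_eq by lra.
replace (x / x)%R with 1%R by (field; lra).
apply acos_1.
Qed.

Lemma Cpower_pos (x : R) (s : C) :
  (0 < x)%R -> Cpower (RtoC x) s = Cexp (s * RtoC (ln x)).
Proof.
intros Hx; unfold Cpower.
destruct (Ceq_dec (RtoC x) 0) as [H|_].
  apply RtoC_inj in H; lra.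
unfold Clog; rewrite Carg_pos, Cmod_R, Rabs_pos_eq by lra; reflexivity.
Qed.

Lemma Rabs_le2 (x a : R) : (- a <= x <= a)%R -> (Rabs x <= a)%R.
Proof. intros; apply Rabs_le; lra. Qed.

Lemma exp_bound2 (x : R) : (Rabs x <= 1 -> Rabs (exp x - 1 - x) <= 2 * x * x)%R.
Proof.
intros Hx; apply Rabs_le_between in Hx.
assert (H1 := exp_ineq1_le x).
assert (H2 := exp_ineq1_le (- x / 2)).
assert (Hp := exp_pos (x / 2)).
assert (H3 : (exp (- x / 2) * exp (x / 2) = 1)%R).
  rewrite <- exp_plus; replace (- x / 2 + x / 2)%R with 0%R by field; apply exp_0.
assert (H4 : (exp x = exp (x / 2) * exp (x / 2))%R).
  rewrite <- exp_plus; f_equal; field.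
assert (H5 : ((1 - x / 2) * exp (x / 2) <= 1)%R) by nra.
assert (H6 : (exp x * ((1 - x / 2) * (1 - x / 2)) <= 1)%R) by
  (replace (exp x * ((1 - x / 2) * (1 - x / 2)))%R
     with (((1 - x / 2) * exp (x / 2)) * ((1 - x / 2) * exp (x / 2)))%R
     by (rewrite H4; ring);
   assert (0 <= (1 - x / 2) * exp (x / 2))%R by (apply Rmult_le_pos; lra); nra).
assert (H7 : (1 <= (1 + x + 2 * x * x) * ((1 - x / 2) * (1 - x / 2)))%R).
  assert (0 <= (x * x) * ((1 - x) * (5 / 2 - x)))%R by (apply Rmult_le_pos; nra).
  lra.
assert (H8 : (0 < (1 - x / 2) * (1 - x / 2))%R) by nra.
assert (exp x <= 1 + x + 2 * x * x)%R.
  apply (Rmult_le_reg_r _ _ _ H8); lra.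
apply Rabs_le2; split; nra.
Qed.

Lemma sin_le_abs (x : R) : (Rabs (sin x) <= Rabs x)%R.
Proof.
destruct (Rle_lt_dec 0 x) as [H|H].
  destruct (Rle_lt_dec x 1).
    assert (0 <= sin x)%R by (apply sin_ge_0; [lra|]; generalize PI2_1; lra).
    destruct H as [H|<-]; [|rewrite sin_0; lra].
    generalize (sin_lt_x x H); rewrite !Rabs_pos_eq; lra.
  rewrite (Rabs_pos_eq x) by lra; apply Rabs_le2; generalize (SIN_bound x); lra.
rewrite <- (Rabs_Ropp (sin x)), <- sin_neg, <- (Rabs_Ropp x).
set (y := (- x)%R); assert (0 < y)%R by (unfold y; lra).
destruct (Rle_lt_dec y 1).
  assert (0 <= sin y)%R by (apply sin_ge_0; [lra|]; generalize PI2_1; lra).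
  generalize (sin_lt_x y H0); rewrite !Rabs_pos_eq; lra.
rewrite (Rabs_pos_eq y) by lra; apply Rabs_le2; generalize (SIN_bound y); lra.
Qed.

Lemma cos_bound2 (x : R) : (Rabs (cos x - 1) <= x * x)%R.
Proof.
replace x with (2 * (x / 2))%R at 1 by field.
rewrite cos_2a_sin.
assert (H := sin_le_abs (x / 2)).
apply Rsqr_le_abs_1 in H; unfold Rsqr in H.
apply Rabs_le2; nra.
Qed.

Lemma sin_bound2 (x : R) : (Rabs x <= 1 -> Rabs (sin x - x) <= 2 * x * x)%R.
Proof.
assert (P : forall y, (0 <= y <= 1 -> Rabs (sin y - y) <= 2 * y * y)%R).
  intros y [[Hy|<-] Hy1]; [|rewrite sin_0; apply Rabs_le2; lra].
  destruct (MVT_cor2 (fun t => sin t - t)%R (fun t => cos t - 1)%R 0 y Hy)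
    as [c [Hc1 Hc2]].
    intros c _; apply is_derive_Reals; auto_derive; [trivial|ring].
  simpl in Hc1; rewrite sin_0 in Hc1.
  replace (sin y - y)%R with ((cos c - 1) * (y - 0))%R by lra.
  rewrite Rabs_mult, (Rabs_pos_eq (y - 0)) by lra.
  assert (H := cos_bound2 c).
  assert (c * c <= y)%R by nra.
  nra.
intros Hx; destruct (Rle_lt_dec 0 x).
  apply P; rewrite Rabs_pos_eq in Hx; lra.
rewrite Rabs_left in Hx by lra.
replace (sin x - x)%R with (- (sin (- x) - (- x)))%R by (rewrite sin_neg; ring).
rewrite Rabs_Ropp.
replace (2 * x * x)%R with (2 * (- x) * (- x))%R by ring.
apply P; lra.
Qed.

Lemma Cmod_le_abs (z : C) : (Cmod z <= Rabs (Re z) + Rabs (Im z))%R.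
Proof.
destruct z as [x y]; simpl.
replace (x, y) with (RtoC x + Ci * RtoC y).
  eapply Rle_trans; [apply Cmod_triangle|].
  rewrite Cmod_mult, !Cmod_R, Cmod_Ci; lra.
apply C_ext; simpl; ring.
Qed.

Lemma Re_le_Cmod (z : C) : (Rabs (Re z) <= Cmod z)%R.
Proof. eapply Rle_trans; [|apply Rmax_Cmod]; apply Rmax_l. Qed.

Lemma Im_le_Cmod (z : C) : (Rabs (Im z) <= Cmod z)%R.
Proof. eapply Rle_trans; [|apply Rmax_Cmod]; apply Rmax_r. Qed.

Lemma Cexp_bound2 (w : C) :
  (Cmod w <= 1 -> Cmod (Cexp w - 1 - w) <= 20 * (Cmod w * Cmod w))%R.
Proof.
intros Hw.
assert (Ha := Re_le_Cmod w); assert (Hb := Im_le_Cmod w).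
set (c := Cmod w) in *; assert (Hc : (0 <= c)%R) by apply Cmod_ge_0.
destruct w as [a b]; simpl in Ha, Hb.
assert (Haa : (a * a <= c * c)%R) by (apply Rabs_le_between in Ha; nra).
assert (Hbb : (b * b <= c * c)%R) by (apply Rabs_le_between in Hb; nra).
assert (He := exp_bound2 a (Rle_trans _ _ _ Ha Hw)).
assert (Hs := sin_bound2 b (Rle_trans _ _ _ Hb Hw)).
assert (Hs' := sin_le_abs b).
assert (Hco := cos_bound2 b).
assert (He1 : (exp a <= 4)%R).
  apply Rabs_le_between in He; apply Rabs_le_between in Ha; nra.
assert (He0 := exp_pos a).
assert (He2 : (Rabs (exp a - 1) <= 3 * c)%R).
  replace (exp a - 1)%R with ((exp a - 1 - a) + a)%R by ring.
  eapply Rle_trans; [apply Rabs_triang|]; nra.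
eapply Rle_trans; [apply Cmod_le_abs|].
unfold Cexp; simpl.
replace (exp a * cos b + - (1) + - a)%R
  with ((exp a - 1 - a) + exp a * (cos b - 1))%R by ring.
replace (exp a * sin b + - 0 + - b)%R
  with ((exp a - 1) * sin b + (sin b - b))%R by ring.
eapply Rle_trans; [apply Rplus_le_compat; apply Rabs_triang|].
rewrite !Rabs_mult, (Rabs_pos_eq (exp a)) by lra.
assert (exp a * Rabs (cos b - 1) <= 4 * (c * c))%R.
  apply Rmult_le_compat; try lra; apply Rabs_pos.
assert (Rabs (exp a - 1) * Rabs (sin b) <= 3 * c * c)%R.
  apply Rmult_le_compat; try lra; apply Rabs_pos.
clearbody c; assert (0 <= c * c)%R by nra.
lra.
Qed.

Definition Ccvg (u : nat -> C) : Prop :=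
  ex_finite_lim_seq (fun n => Re (u n)) /\ ex_finite_lim_seq (fun n => Im (u n)).

Lemma CLim_eq (u : nat -> C) (l : C) :
  is_lim_seq (fun n => Re (u n)) (Re l) -> is_lim_seq (fun n => Im (u n)) (Im l) ->
  CLim_seq u = l.
Proof.
intros H1 H2; unfold CLim_seq.
rewrite (is_lim_seq_unique _ _ H1), (is_lim_seq_unique _ _ H2).
destruct l; reflexivity.
Qed.

Lemma Ccvg_lim (u : nat -> C) : Ccvg u ->
  is_lim_seq (fun n => Re (u n)) (Re (CLim_seq u)) /\
  is_lim_seq (fun n => Im (u n)) (Im (CLim_seq u)).
Proof.
intros [H1 H2]; unfold CLim_seq; simpl.
apply ex_finite_lim_seq_correct in H1; apply ex_finite_lim_seq_correct in H2.
destruct H1 as [E1 F1], H2 as [E2 F2].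
split; [rewrite F1|rewrite F2]; now apply Lim_seq_correct.
Qed.

Lemma is_lim_seq_Cmult (u v : nat -> C) (a b : C) :
  is_lim_seq (fun n => Re (u n)) (Re a) -> is_lim_seq (fun n => Im (u n)) (Im a) ->
  is_lim_seq (fun n => Re (v n)) (Re b) -> is_lim_seq (fun n => Im (v n)) (Im b) ->
  is_lim_seq (fun n => Re (u n * v n)) (Re (a * b)) /\
  is_lim_seq (fun n => Im (u n * v n)) (Im (a * b)).
Proof.
intros; split; simpl.
  apply is_lim_seq_minus'; now apply is_lim_seq_mult'.
apply is_lim_seq_plus'; now apply is_lim_seq_mult'.
Qed.

Lemma real_cvg (u : nat -> R) (K : R) : (0 <= K)%R ->
  (forall n, Rabs (u (S n) - u n) <= K * / (INR n + 1) - K * / (INR n + 2))%R ->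
  ex_finite_lim_seq u.
Proof.
intros HK H.
assert (Hp : forall n, (0 <= K * / (INR n + 1))%R).
  intros n; apply Rmult_le_pos; [lra|].
  apply Rlt_le, Rinv_0_lt_compat; generalize (pos_INR n); lra.
assert (E : forall n, (K * / (INR (S n) + 1) = K * / (INR n + 2))%R).
  intros n; rewrite S_INR; f_equal; f_equal; ring.
assert (L : ex_finite_lim_seq (fun n => u n + K * / (INR n + 1))%R).
  apply (ex_finite_lim_seq_decr _ (u 0%nat - K)).
    intros n; rewrite E; generalize (H n); intros A; apply Rabs_le_between in A; lra.
  assert (G : forall n, (u 0%nat - K <= u n - K * / (INR n + 1))%R).
    induction n; [simpl; rewrite Rplus_0_l, Rinv_1; lra|].
    rewrite E; generalize (H n); intros A; apply Rabs_le_between in A; lra.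
  intros n; generalize (G n) (Hp n); lra.
destruct L as [l L]; exists (l - K * 0)%R.
assert (L0 : is_lim_seq (fun n => / (INR n + 1))%R 0).
  replace (Finite 0) with (Rbar_inv p_infty) by reflexivity.
  apply is_lim_seq_inv; [|discriminate].
  apply (is_lim_seq_ext (fun n => INR (S n))); [intros; apply S_INR|].
  apply -> (is_lim_seq_incr_1 INR); apply is_lim_seq_INR.
apply (is_lim_seq_ext (fun n => u n + K * / (INR n + 1) - K * / (INR n + 1))%R).
  intros; ring.
apply is_lim_seq_minus'; [exact L|].
now apply (is_lim_seq_scal_l _ K 0).
Qed.

Lemma prod_cvg (r q : nat -> C) (K : R) : (0 <= K)%R ->
  (forall n, r (S n) = r n * q n) ->
  (forall n, Cmod (q n - 1) <= K * / (INR n + 1) - K * / (INR n + 2))%R ->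
  Ccvg r.
Proof.
intros HK Hr Hq.
set (B := (Cmod (r 0%nat) * exp K)%R).
assert (HB : forall n, (Cmod (r n) <= Cmod (r 0%nat) * exp (K - K * / (INR n + 1)))%R).
  induction n.
    simpl; rewrite Rplus_0_l, Rinv_1, Rmult_1_r, Rminus_diag, exp_0; lra.
  rewrite Hr, Cmod_mult.
  assert (Q : (Cmod (q n) <= exp (K * / (INR n + 1) - K * / (INR n + 2)))%R).
    eapply Rle_trans; [|apply exp_ineq1_le].
    replace (q n) with (1 + (q n - 1)) by ring.
    eapply Rle_trans; [apply Cmod_triangle|].
    rewrite Cmod_1; generalize (Hq n); lra.
  replace (K - K * / (INR (S n) + 1))%R
    with ((K - K * / (INR n + 1)) + (K * / (INR n + 1) - K * / (INR n + 2)))%R.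
    rewrite exp_plus, <- Rmult_assoc.
    apply Rmult_le_compat; auto using Cmod_ge_0.
  rewrite S_INR; replace (INR n + 1 + 1)%R with (INR n + 2)%R by ring; ring.
assert (HB' : forall n, (Cmod (r n) <= B)%R).
  intros n; eapply Rle_trans; [apply HB|].
  apply Rmult_le_compat_l; [apply Cmod_ge_0|].
  assert (0 <= K * / (INR n + 1))%R.
    apply Rmult_le_pos; [lra|].
    apply Rlt_le, Rinv_0_lt_compat; generalize (pos_INR n); lra.
  destruct (Req_dec (K * / (INR n + 1)) 0) as [->|]; [rewrite Rminus_0_r; lra|].
  apply Rlt_le, exp_increasing; lra.
assert (HB0 : (0 <= B)%R) by (eapply Rle_trans; [apply Cmod_ge_0|apply (HB' 0%nat)]).
assert (D : forall n, (Cmod (r (S n) - r n)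
    <= (B * K) * / (INR n + 1) - (B * K) * / (INR n + 2))%R).
  intros n; rewrite Hr.
  replace (r n * q n - r n) with (r n * (q n - 1)) by ring.
  rewrite Cmod_mult.
  replace (B * K * / (INR n + 1) - B * K * / (INR n + 2))%R
    with (B * (K * / (INR n + 1) - K * / (INR n + 2)))%R by ring.
  apply Rmult_le_compat; auto using Cmod_ge_0.
assert (HBK : (0 <= B * K)%R) by now apply Rmult_le_pos.
split; apply (real_cvg _ (B * K)); auto; intros n.
  eapply Rle_trans; [|apply D]; apply (Re_le_Cmod (r (S n) - r n)).
eapply Rle_trans; [|apply D]; apply (Im_le_Cmod (r (S n) - r n)).
Qed.

Lemma Cexp_neq_0 (w : C) : Cexp w <> 0.
Proof.
intros H.
assert (E : Cexp w * Cexp (- w) = 1).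
  rewrite <- Cexp_plus; replace (w + - w) with (RtoC 0) by ring; apply Cexp_0.
rewrite H, Cmult_0_l in E; apply RtoC_inj in E; lra.
Qed.

Lemma RtoC_neq_0 (x : R) : x <> 0%R -> RtoC x <> 0.
Proof. intros H E; apply RtoC_inj in E; contradiction. Qed.

Lemma poch_neq_0 (z : C) (n : nat) : ~ nonpos_int z -> poch z n <> 0.
Proof.
intros Hz; induction n as [|n IH]; simpl.
  apply RtoC_neq_0; lra.
apply Cmult_neq_0; [exact IH|].
intros E; apply Hz; exists n.
replace z with (z + RtoC (INR n) - RtoC (INR n)) by ring; rewrite E; ring.
Qed.

Lemma rGamma_seq_neq_0 (z : C) (n : nat) :
  ~ nonpos_int z -> (0 < INR n)%R -> rGamma_seq z n <> 0.
Proof.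
intros Hz Hn; unfold rGamma_seq, Cdiv.
assert (D : RtoC (INR (fact n)) * Cpower (RtoC (INR n)) z <> 0).
  apply Cmult_neq_0; [apply RtoC_neq_0, INR_fact_neq_0|].
  rewrite Cpower_pos by exact Hn; apply Cexp_neq_0.
apply Cmult_neq_0; [now apply poch_neq_0|].
intros E; apply (RtoC_neq_0 1 R1_neq_R0).
rewrite <- (Cinv_r _ D), E; ring.
Qed.

Definition rGamma_ratio (z : C) (n : nat) : C :=
  (1 + z * RtoC (/ (INR n + 1)))
  * Cexp (- (z * RtoC (ln (INR n + 1) - ln (INR n)))).

Lemma rGamma_seq_S (z : C) (n : nat) : (0 < INR n)%R ->
  rGamma_seq z (S n) = rGamma_seq z n * rGamma_ratio z n.
Proof.
intros Hn; unfold rGamma_seq, rGamma_ratio.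
change (poch z (S (S n))) with (poch z (S n) * (z + RtoC (INR (S n)))).
rewrite fact_simpl, mult_INR, RtoC_mult, S_INR.
rewrite !Cpower_pos by lra.
set (x := INR n) in *.
replace (- (z * RtoC (ln (x + 1) - ln x)))
  with (z * RtoC (ln x) + - (z * RtoC (ln (x + 1))))
  by (rewrite RtoC_minus; ring).
rewrite Cexp_plus.
assert (E : Cexp (z * RtoC (ln (x + 1))) * Cexp (- (z * RtoC (ln (x + 1)))) = 1).
  rewrite <- Cexp_plus.
  match goal with |- Cexp ?a = _ => replace a with (RtoC 0) by ring end.
  apply Cexp_0.
assert (N1 := Cexp_neq_0 (z * RtoC (ln (x + 1)))).
assert (N2 := Cexp_neq_0 (z * RtoC (ln x))).
replace (Cexp (- (z * RtoC (ln (x + 1))))) with (/ Cexp (z * RtoC (ln (x + 1)))).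
2:{ rewrite <- (Cmult_1_r (/ _)), <- E; field; exact N1. }
assert (N3 : RtoC (x + 1) <> 0) by (apply RtoC_neq_0; lra).
rewrite RtoC_inv by lra.
assert (N4 : RtoC (INR (fact n)) <> 0) by apply RtoC_neq_0, INR_fact_neq_0.
field; repeat split; assumption.
Qed.

Lemma ln_diff_bound (x : R) : (0 < x)%R ->
  (/ (x + 1) <= ln (x + 1) - ln x <= / x)%R.
Proof.
intros Hx; rewrite <- ln_div by lra.
split.
  assert (H := exp_ineq1_le (- ln ((x + 1) / x))).
  rewrite exp_Ropp, exp_ln in H by (apply Rdiv_lt_0_compat; lra).
  replace (/ ((x + 1) / x))%R with (1 - / (x + 1))%R in H by (field; lra).
  lra.
assert (H := exp_ineq1_le (ln ((x + 1) / x))).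
rewrite exp_ln in H by (apply Rdiv_lt_0_compat; lra).
replace ((x + 1) / x)%R with (1 + / x)%R in H at 2 by (field; lra).
lra.
Qed.

Lemma rGamma_ratio_bound (z : C) (n : nat) : (1 <= INR n)%R -> (Cmod z <= INR n)%R ->
  (Cmod (rGamma_ratio z n - 1)
   <= (Cmod z + Cmod z * Cmod z + 20 * (Cmod z * Cmod z) * (1 + Cmod z))
      * (/ INR n * / INR n))%R.
Proof.
intros Hn1 Hn; unfold rGamma_ratio.
assert (HL := ln_diff_bound (INR n) ltac:(lra)).
set (x := INR n) in *; set (L := (ln (x + 1) - ln x)%R) in *; set (m := Cmod z) in *.
set (u := (/ (x + 1))%R) in *; set (v := (/ x)%R) in *.
assert (Hm : (0 <= m)%R) by apply Cmod_ge_0.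
assert (Hu : (0 < u)%R) by (apply Rinv_0_lt_compat; lra).
assert (Hv : (0 < v)%R) by (apply Rinv_0_lt_compat; lra).
assert (Hxv : (x * v = 1)%R) by (apply Rinv_r; lra).
assert (Huv : (v - u <= v * v)%R).
  replace (v - u)%R with (v * u)%R by (unfold u, v; field; lra).
  apply Rmult_le_compat_l; lra.
assert (Hv1 : (v <= 1)%R) by nra.
set (w := - (z * RtoC L)).
assert (Hw : (Cmod w = m * L)%R).
  unfold w; rewrite Cmod_opp, Cmod_mult, Cmod_R, Rabs_pos_eq by lra; reflexivity.
assert (Hwv : (Cmod w <= m * v)%R) by (rewrite Hw; apply Rmult_le_compat_l; lra).
assert (Hmv : (m * v <= 1)%R) by nra.
assert (Hw0 := Cmod_ge_0 w).
assert (HE := Cexp_bound2 w ltac:(lra)).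
set (E := Cexp w - 1 - w) in *.
replace ((1 + z * RtoC u) * Cexp w - 1)
  with (z * RtoC (u - L) + (z * RtoC u * w + (1 + z * RtoC u) * E)).
2:{ unfold E, w; rewrite RtoC_minus; ring. }
assert (HE' : (Cmod E <= 20 * (m * m) * (v * v))%R).
  assert (Cmod w * Cmod w <= (m * v) * (m * v))%R by (apply Rmult_le_compat; lra).
  lra.
assert (H1 : (Cmod (z * RtoC (u - L)) <= m * (v * v))%R).
  rewrite Cmod_mult, Cmod_R; apply Rmult_le_compat_l; [exact Hm|].
  apply Rabs_le2; nra.
assert (Hzu : (Cmod (z * RtoC u) <= m * v)%R).
  rewrite Cmod_mult, Cmod_R, Rabs_pos_eq by lra; apply Rmult_le_compat_l; lra.
assert (H2 : (Cmod (z * RtoC u * w) <= m * m * (v * v))%R).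
  rewrite (Cmod_mult (z * RtoC u)).
  replace (m * m * (v * v))%R with ((m * v) * (m * v))%R by ring.
  apply Rmult_le_compat; auto using Cmod_ge_0.
assert (H3 : (Cmod ((1 + z * RtoC u) * E) <= (1 + m) * (20 * (m * m) * (v * v)))%R).
  rewrite Cmod_mult; apply Rmult_le_compat; auto using Cmod_ge_0.
  eapply Rle_trans; [apply Cmod_triangle|]; rewrite Cmod_1; nra.
eapply Rle_trans; [apply Cmod_triangle|].
eapply Rle_trans; [apply Rplus_le_compat_l, Cmod_triangle|].
lra.
Qed.

Lemma Ccvg_incr_n (u : nat -> C) (N : nat) :
  Ccvg (fun n => u (n + N)%nat) -> Ccvg u.
Proof.
intros [[a Ha] [b Hb]]; split; [exists a|exists b];
  now apply (is_lim_seq_incr_n _ N).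
Qed.

Lemma rGamma_spec (z : C) : ~ nonpos_int z ->
  Ccvg (rGamma_seq z) /\ rGamma z <> 0.
Proof.
intros Hz.
set (m := Cmod z); assert (Hm : (0 <= m)%R) by apply Cmod_ge_0.
set (K := (m + m * m + 20 * (m * m) * (1 + m))%R).
assert (HK : (0 <= K)%R) by (unfold K; nra).
destruct (INR_unbounded (m + 1 + 2 * K)) as [N HN].
set (r := fun n => rGamma_seq z (n + N)).
set (q := fun n => rGamma_ratio z (n + N)).
assert (Hx : forall n, (INR n + 1 <= INR (n + N))%R).
  intros n; rewrite plus_INR; lra.
assert (Hpos : forall n, (INR N <= INR (n + N))%R).
  intros n; rewrite plus_INR; generalize (pos_INR n); lra.
assert (HN0 : (0 < INR N)%R) by lra.
assert (Hr : forall n, r (S n) = r n * q n).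
  intros n; unfold r, q; simpl; apply rGamma_seq_S; generalize (Hpos n); lra.
assert (Hr0 : forall n, r n <> 0).
  intros n; apply rGamma_seq_neq_0; [exact Hz|]; generalize (Hpos n); lra.
assert (Hq1 : forall n, (Cmod (q n - 1) <= K * (/ INR (n + N) * / INR (n + N)))%R).
  intros n; apply rGamma_ratio_bound; generalize (Hpos n); fold m; lra.
assert (Hsq : forall n, (/ INR (n + N) * / INR (n + N)
    <= 2 * / (INR n + 1) - 2 * / (INR n + 2))%R).
  intros n; assert (H0 := pos_INR n).
  assert (Hi : (/ INR (n + N) <= / (INR n + 1))%R).
    apply Rinv_le_contravar; [lra|apply Hx].
  assert (Hi0 : (0 < / INR (n + N))%R).
    apply Rinv_0_lt_compat; generalize (Hpos n); lra.
  replace (2 * / (INR n + 1) - 2 * / (INR n + 2))%R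
    with (/ (INR n + 1) * (2 * / (INR n + 2)))%R by (field; lra).
  apply Rmult_le_compat; try lra.
  eapply Rle_trans; [exact Hi|].
  apply (Rmult_le_reg_r ((INR n + 1) * (INR n + 2))%R); [nra|].
  field_simplify; lra.
assert (Hq2 : forall n, (Cmod (q n - 1)
    <= (2 * K) * / (INR n + 1) - (2 * K) * / (INR n + 2))%R).
  intros n; eapply Rle_trans; [apply Hq1|].
  replace (2 * K * / (INR n + 1) - 2 * K * / (INR n + 2))%R
    with (K * (2 * / (INR n + 1) - 2 * / (INR n + 2)))%R by ring.
  apply Rmult_le_compat_l; auto.
assert (Hhalf : forall n, (Cmod (q n - 1) <= 1 / 2)%R).
  intros n; eapply Rle_trans; [apply Hq1|].
  assert (Hp := Hpos n); set (x := INR (n + N)) in *.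
  apply (Rmult_le_reg_r (x * x)%R); [nra|].
  replace (K * (/ x * / x) * (x * x))%R with K by (field; lra).
  nra.
assert (C1 : Ccvg r) by (apply (prod_cvg r q (2 * K)); auto; lra).
assert (Hq0 : forall n, q n <> 0).
  intros n E; generalize (Hhalf n); rewrite E.
  replace (0 - 1) with (- RtoC 1) by ring; rewrite Cmod_opp, Cmod_1; lra.
assert (C2 : Ccvg (fun n => / r n)).
  apply (prod_cvg _ (fun n => / q n) (2 * (2 * K))); [lra| |].
    intros n; rewrite Hr; field; split; auto.
  intros n.
  replace (/ q n - 1) with (- (q n - 1) / q n) by (field; auto).
  unfold Cdiv; rewrite Cmod_mult, Cmod_opp, Cmod_inv by auto.
  assert (Hl : (1 / 2 <= Cmod (q n))%R).
    assert (T := Cmod_triangle (q n) (- (q n - 1))).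
    replace (q n + - (q n - 1)) with (RtoC 1) in T by ring.
    rewrite Cmod_1, Cmod_opp in T; generalize (Hhalf n); lra.
  assert (Hi : (/ Cmod (q n) <= 2)%R).
    replace 2%R with (/ (1 / 2))%R by field; apply Rinv_le_contravar; lra.
  assert (0 < / Cmod (q n))%R by (apply Rinv_0_lt_compat; lra).
  generalize (Hq2 n) (Cmod_ge_0 (q n - 1)); intros; nra.
split; [now apply (Ccvg_incr_n _ N)|].
assert (EL : rGamma z = CLim_seq r).
  assert (C0 : Ccvg (rGamma_seq z)) by now apply (Ccvg_incr_n _ N).
  destruct (Ccvg_lim _ C0) as [A1 A2].
  symmetry; apply CLim_eq.
    exact (proj1 (is_lim_seq_incr_n (fun n => Re (rGamma_seq z n)) N _) A1).
  exact (proj1 (is_lim_seq_incr_n (fun n => Im (rGamma_seq z n)) N _) A2).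
rewrite EL; intros E0.
destruct (Ccvg_lim _ C1) as [A1 A2], (Ccvg_lim _ C2) as [B1 B2].
destruct (is_lim_seq_Cmult _ _ _ _ A1 A2 B1 B2) as [P _].
rewrite E0, Cmult_0_l in P; simpl in P.
assert (P' : is_lim_seq (fun _ : nat => 1%R) 0%R).
  refine (is_lim_seq_ext _ _ _ _ P).
  intros n; change (Re (r n * / r n) = 1%R); rewrite Cinv_r by auto; reflexivity.
apply is_lim_seq_unique in P'; rewrite Lim_seq_const in P'.
injection P'; lra.
Qed.

Lemma nonpos_int_S (z : C) : nonpos_int (z + 1) -> nonpos_int z.
Proof.
intros [n Hn]; exists (S n); rewrite S_INR, RtoC_plus.
replace z with (z + 1 - 1) by ring; rewrite Hn; ring.
Qed.

Lemma poch_shift (z : C) (n : nat) : z * poch (z + 1) n = poch z (S n).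
Proof.
induction n as [|n IH]; [simpl; ring|].
change (poch (z + 1) (S n)) with (poch (z + 1) n * (z + 1 + RtoC (INR n))).
rewrite Cmult_assoc, IH.
change (poch z (S (S n))) with (poch z (S n) * (z + RtoC (INR (S n)))).
rewrite S_INR, RtoC_plus; ring.
Qed.

Lemma Gamma_S (z : C) : ~ nonpos_int z -> Gamma (z + 1) = z * Gamma z.
Proof.
intros Hz.
assert (Hz1 : ~ nonpos_int (z + 1)) by (intros H; now apply Hz, nonpos_int_S).
destruct (rGamma_spec z Hz) as [C1 N1], (rGamma_spec _ Hz1) as [C2 N2].
assert (E : z * rGamma (z + 1) = rGamma z).
  destruct (Ccvg_lim _ C1) as [A1 A2].
  destruct (Ccvg_lim _ C2) as [B1 B2].
  assert (Li : is_lim_seq (fun n => / INR n)%R 0).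
    replace (Finite 0) with (Rbar_inv p_infty) by reflexivity.
    apply is_lim_seq_inv; [apply is_lim_seq_INR|discriminate].
  assert (Lc : forall a b : R, is_lim_seq (fun n => a + b * / INR n)%R a).
    intros a b; pattern a at 2; replace a with (a + b * 0)%R by ring.
    apply is_lim_seq_plus'; [apply is_lim_seq_const|].
    now apply (is_lim_seq_scal_l _ b 0).
  set (v := fun n => 1 + (z + 1) * RtoC (/ INR n)).
  assert (V1 : is_lim_seq (fun n => Re (v n)) (Re 1)).
    apply (is_lim_seq_ext (fun n => 1 + Re (z + 1) * / INR n)%R).
      intros n; unfold v; simpl; ring.
    apply Lc.
  assert (V2 : is_lim_seq (fun n => Im (v n)) (Im 1)).
    apply (is_lim_seq_ext (fun n => 0 + Im (z + 1) * / INR n)%R).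
      intros n; unfold v; simpl; ring.
    apply Lc.
  destruct (is_lim_seq_Cmult _ _ _ _ A1 A2 V1 V2) as [P1 P2].
  destruct (is_lim_seq_Cmult (fun _ => z) _ z _
    (is_lim_seq_const _) (is_lim_seq_const _) B1 B2) as [Q1 Q2].
  assert (X : eventually (fun n => rGamma_seq z n * v n = z * rGamma_seq (z + 1) n)).
    exists 1%nat; intros n Hn.
    assert (Hn' : (0 < INR n)%R) by (apply lt_0_INR; lia).
    unfold rGamma_seq, v, Cdiv.
    rewrite (Cmult_assoc z), poch_shift.
    change (poch z (S (S n))) with (poch z (S n) * (z + RtoC (INR (S n)))).
    rewrite !Cpower_pos, S_INR, RtoC_plus, RtoC_inv by lra.
    replace ((z + 1) * RtoC (ln (INR n)))
      with (z * RtoC (ln (INR n)) + RtoC (ln (INR n))) by ring.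
    rewrite Cexp_plus.
    replace (Cexp (RtoC (ln (INR n)))) with (RtoC (INR n)).
    2:{ unfold Cexp; apply C_ext; simpl;
        rewrite ?cos_0, ?sin_0, ?exp_ln by lra; ring. }
    assert (M1 := Cexp_neq_0 (z * RtoC (ln (INR n)))).
    assert (M2 : RtoC (INR n) <> 0) by (apply RtoC_neq_0; lra).
    assert (M3 : RtoC (INR (fact n)) <> 0) by apply RtoC_neq_0, INR_fact_neq_0.
    field; repeat split; assumption.
  rewrite Cmult_1_r in P1, P2.
  assert (R1 : is_lim_seq (fun n => Re (z * rGamma_seq (z + 1) n)) (Re (CLim_seq (rGamma_seq z)))).
    refine (is_lim_seq_ext_loc _ _ _ _ P1).
    generalize X; apply filter_imp; intros n Y; now rewrite Y.
  assert (R2 : is_lim_seq (fun n => Im (z * rGamma_seq (z + 1) n)) (Im (CLim_seq (rGamma_seq z)))).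
    refine (is_lim_seq_ext_loc _ _ _ _ P2).
    generalize X; apply filter_imp; intros n Y; now rewrite Y.
  change (z * CLim_seq (rGamma_seq (z + 1)) = CLim_seq (rGamma_seq z)).
  apply is_lim_seq_unique in Q1; apply is_lim_seq_unique in Q2.
  apply is_lim_seq_unique in R1; apply is_lim_seq_unique in R2.
  apply C_ext.
    rewrite Q1 in R1; now injection R1.
  rewrite Q2 in R2; now injection R2.
unfold Gamma; rewrite <- E; field; split; [exact N2|].
intros E0; apply Hz; exists 0%nat; rewrite E0; simpl; ring.
Qed.

Lemma Gamma_neq_0 (z : C) : ~ nonpos_int z -> Gamma z <> 0.
Proof.
intros Hz E; destruct (rGamma_spec z Hz) as [_ N]; unfold Gamma in E.
apply (RtoC_neq_0 1 R1_neq_R0); rewrite <- (Cinv_r _ N), E; ring.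
Qed.

Lemma poch_Gamma (z : C) (m : nat) :
  ~ nonpos_int z -> poch z m = Gamma (z + RtoC (INR m)) / Gamma z.
Proof.
intros Hz; assert (N := Gamma_neq_0 z Hz).
induction m as [|m IH]; simpl poch.
  simpl; rewrite Cplus_0_r; field; exact N.
rewrite IH, S_INR, RtoC_plus, Cplus_assoc, Gamma_S; [field; exact N|].
intros [k Hk]; apply Hz; exists (k + m)%nat; rewrite plus_INR, RtoC_plus.
replace z with (z + RtoC (INR m) - RtoC (INR m)) by ring; rewrite Hk; ring.
Qed.

(* Main.v *)
(** Write [g t = t^(l2-1) (1-t)^(l3-l2-1) M (- rho / (t (1-t)))], so that the coefficients
    of the hypergeometric series are the moments of [g]; the integral of [g] may converge
    only conditionally.  Summation by parts shows that a convergent improper integral stays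
    convergent, and depends continuously on the factor, when the integrand is multiplied by
    functions of uniformly bounded variation; this plays the role of dominated convergence.

    For [|z| < 1] the partial sums of the binomial series of [(1 - z t)^(-l1)] are such
    factors, and if [l1] is a nonpositive integer the series terminates.  For [|z| = 1]
    one applies Abel's theorem to the functions [(1 - r z t)^(-l1)] as [r] tends to 1; at
    [z = 1] these have unbounded variation, but [(1 - r t)^(-l1)] is a combination, with
    multipliers of bounded variation, of the integrable functions [g] and
    [(1 - t)^(-l1) g].  For [|z| > 1] and [l1] not a nonpositive integer, convergence of
    the series forces geometric decay of the moments of [g]; by Lerch's argument [g]
    vanishes near 1, so the M-series vanishes on a ray and all its coefficients are zero,
    which contradicts the assumptions on the parameters.  The other two representations
    follow by [t = u / (1 + u)] and [t = sin^2 theta]. *)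

Require Import Defs.
From Stdlib Require Import Reals List Factorial Lra Lia Classical.
From Coquelicot Require Import Coquelicot.

Local Open Scope R_scope.

(** The hypotheses say nothing about the size of [g] near the ends of (0, 1), where the argument of
    the M-series tends to infinity: only integrals are known to converge. Hence there is no majorant
    and no Fubini theorem; every exchange of a limit with an integral goes through
    [multiplier_limit], which asks for bounds on the factor alone. Convergence of the M-series at
    every t means convergence at - rho s for every s >= 4, which forces an infinite radius of
    convergence; the continuity of [g] and the final contradiction for |z| > 1 both rest on this.
    Principal powers stay harmless: for |z| <= 1 the base 1 - z t has positive real part on (0, 1),
    and for |z| > 1 only the terminating case survives, where the power is a polynomial. On the unit
    circle the partial sums of the binomial series may have unbounded variation, which is why radii
    r < 1 and Abel's theorem are used there. Division by the beta function is undone to recover the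
    series of moments; that it does not vanish is again obtained from Lerch's argument, applied to
    the beta integrand. *)

Notation Ccontinuous f t :=
  (@continuous R_UniformSpace (NormedModule.UniformSpace _ C_R_NormedModule) f t).
Notation is_Cderive f t l := (@is_derive R_AbsRing C_R_NormedModule f t l).
Notation is_CRInt f a b l := (@is_RInt C_R_NormedModule f a b l).

Definition CRInt (f : R -> C) (a b : R) : C := @RInt C_R_CompleteNormedModule f a b.
Notation is_CInt f Fa Fb l := (@is_RInt_gen C_R_NormedModule f Fa Fb l).

Lemma norm_C (z : C) : @norm R_AbsRing C_R_NormedModule z = Cmod z.
Proof.
destruct z as [x y].
change (sqrt (Rabs x ^ 2 + Rabs y ^ 2) = Cmod (x, y)).
unfold Cmod; simpl fst; simpl snd; now rewrite !pow2_abs.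
Qed.

(** * Continuity and differentiation of complex-valued functions of a real variable *)

Lemma Ccontinuous_Re (f : R -> C) t : Ccontinuous f t -> continuous (fun t => Re (f t)) t.
Proof. intros H; apply (continuous_comp f fst); [exact H|apply continuous_fst]. Qed.

Lemma Ccontinuous_Im (f : R -> C) t : Ccontinuous f t -> continuous (fun t => Im (f t)) t.
Proof. intros H; apply (continuous_comp f snd); [exact H|apply continuous_snd]. Qed.

Lemma Ccontinuous_pair (f : R -> C) t :
  continuous (fun t => Re (f t)) t -> continuous (fun t => Im (f t)) t -> Ccontinuous f t.
Proof.
intros H1 H2.
intros P [eps HP].
generalize (H1 _ (locally_ball _ eps)) (H2 _ (locally_ball _ eps)).
unfold filtermap; intros A B.
generalize (filter_and _ _ A B); apply filter_imp; intros x [X Y].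
apply HP; split; assumption.
Qed.

Lemma Ccontinuous_const (c : C) t : Ccontinuous (fun _ => c) t.
Proof. apply continuous_const. Qed.

Lemma Ccontinuous_RtoC (f : R -> R) t :
  continuous f t -> Ccontinuous (fun t => RtoC (f t)) t.
Proof. intros H; apply Ccontinuous_pair; [exact H|apply continuous_const]. Qed.

Lemma Ccontinuous_plus (f g : R -> C) t :
  Ccontinuous f t -> Ccontinuous g t -> Ccontinuous (fun t => f t + g t)%C t.
Proof. apply (continuous_plus (V := C_R_NormedModule)). Qed.

Lemma Ccontinuous_opp (f : R -> C) t :
  Ccontinuous f t -> Ccontinuous (fun t => - f t)%C t.
Proof. apply (continuous_opp (V := C_R_NormedModule)). Qed.

Lemma Ccontinuous_mult (f g : R -> C) t :
  Ccontinuous f t -> Ccontinuous g t -> Ccontinuous (fun t => f t * g t)%C t.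
Proof.
intros Hf Hg.
assert (A := Ccontinuous_Re _ _ Hf); assert (B := Ccontinuous_Im _ _ Hf).
assert (A' := Ccontinuous_Re _ _ Hg); assert (B' := Ccontinuous_Im _ _ Hg).
apply Ccontinuous_pair; simpl.
  apply (continuous_minus (V := R_NormedModule));
    now apply (continuous_mult (K := R_AbsRing)).
apply (continuous_plus (V := R_NormedModule));
  now apply (continuous_mult (K := R_AbsRing)).
Qed.

Lemma Ccontinuous_Cmod (f : R -> C) t :
  Ccontinuous f t -> continuous (fun t => Cmod (f t)) t.
Proof.
intros H; apply (continuous_ext (fun t => @norm R_AbsRing C_R_NormedModule (f t))).
  intros; apply norm_C.
apply (continuous_comp (V := C_R_NormedModule) f (@norm R_AbsRing C_R_NormedModule)).
  exact H.
apply (filterlim_norm (V := C_R_NormedModule)).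
Qed.

Lemma is_Cderive_pair (f : R -> C) t (l : C) :
  is_derive (fun t => Re (f t)) t (Re l) -> is_derive (fun t => Im (f t)) t (Im l) ->
  is_Cderive f t l.
Proof.
intros H1 H2.
(* [f] is a combination of the fixed vectors 1 and i with real coefficients, so the rule for a real
   function times a fixed vector suffices. *)
assert (E1 := is_derive_scal_l (V := C_R_NormedModule) _ _ _ ((1, 0) : C) H1).
assert (E2 := is_derive_scal_l (V := C_R_NormedModule) _ _ _ ((0, 1) : C) H2).
assert (E := is_derive_plus (V := C_R_NormedModule) _ _ _ _ _ E1 E2).
match type of E with is_derive _ _ ?m => replace l with m end.
  revert E; apply (is_derive_ext (V := C_R_NormedModule)).
  intros s; destruct (f s) as [x y]; apply C_ext; simpl;
    unfold scal, plus; simpl; unfold mult; simpl; ring.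
destruct l as [x y]; apply C_ext; simpl;
  unfold scal, plus; simpl; unfold mult; simpl; ring.
Qed.

Lemma is_Cderive_Re (f : R -> C) t l :
  is_Cderive f t l -> is_derive (fun t => Re (f t)) t (Re l).
Proof.
intros H.
apply (filterdiff_comp' (U := R_NormedModule) (V := C_R_NormedModule) f fst t
  (fun y => scal y l) fst H).
apply filterdiff_linear, is_linear_fst.
Qed.

Lemma is_Cderive_Im (f : R -> C) t l :
  is_Cderive f t l -> is_derive (fun t => Im (f t)) t (Im l).
Proof.
intros H.
apply (filterdiff_comp' (U := R_NormedModule) (V := C_R_NormedModule) f snd t
  (fun y => scal y l) snd H).
apply filterdiff_linear, is_linear_snd.
Qed.

Lemma is_Cderive_continuous (f : R -> C) t l : is_Cderive f t l -> Ccontinuous f t.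
Proof.
intros H; apply (ex_derive_continuous (V := C_R_NormedModule)); exists l; exact H.
Qed.

Lemma is_Cderive_RtoC (f : R -> R) t l :
  is_derive f t l -> is_Cderive (fun t => RtoC (f t)) t (RtoC l).
Proof.
intros H; apply is_Cderive_pair; simpl; [exact H|].
apply (is_derive_const (V := R_NormedModule)).
Qed.

Lemma is_Cderive_const (c : C) t : is_Cderive (fun _ => c) t (RtoC 0).
Proof. apply (is_derive_const (V := C_R_NormedModule)). Qed.

Lemma is_Cderive_plus (f g : R -> C) t l m :
  is_Cderive f t l -> is_Cderive g t m -> is_Cderive (fun t => f t + g t)%C t (l + m)%C.
Proof. apply (is_derive_plus (V := C_R_NormedModule)). Qed.

Lemma is_Cderive_opp (f : R -> C) t l :
  is_Cderive f t l -> is_Cderive (fun t => - f t)%C t (- l)%C.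
Proof. apply (is_derive_opp (V := C_R_NormedModule)). Qed.

Lemma is_Cderive_mult (f g : R -> C) t (l m : C) :
  is_Cderive f t l -> is_Cderive g t m ->
  is_Cderive (fun t => f t * g t)%C t (l * g t + f t * m)%C.
Proof.
intros Hf Hg.
assert (A := is_Cderive_Re _ _ _ Hf); assert (B := is_Cderive_Im _ _ _ Hf).
assert (A' := is_Cderive_Re _ _ _ Hg); assert (B' := is_Cderive_Im _ _ _ Hg).
assert (M : forall (u v : R -> R) (a b : R), is_derive u t a -> is_derive v t b ->
    is_derive (fun t => u t * v t) t (a * v t + u t * b)).
  intros u v a b Hu Hv.
  apply (is_derive_mult (K := R_AbsRing) u v t a b Hu Hv); intros; apply Rmult_comm.
assert (Q : forall (u : R -> R) (a b : R), a = b -> is_derive u t a -> is_derive u t b)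
  by (now intros u a b ->).
apply is_Cderive_pair.
  refine (Q _ _ _ _ (is_derive_minus (V := R_NormedModule) _ _ _ _ _
    (M _ _ _ _ A A') (M _ _ _ _ B B'))).
  unfold minus, plus, opp; unfold Re, Im; simpl; ring.
refine (Q _ _ _ _ (is_derive_plus (V := R_NormedModule) _ _ _ _ _
  (M _ _ _ _ A B') (M _ _ _ _ B A'))).
unfold plus; unfold Re, Im; simpl; ring.
Qed.

Lemma is_Cderive_eq (f : R -> C) t (l m : C) :
  is_Cderive f t l -> l = m -> is_Cderive f t m.
Proof. now intros H <-. Qed.

Lemma is_Cderive_ext (f g : R -> C) t (l : C) :
  (forall s, f s = g s) -> is_Cderive f t l -> is_Cderive g t l.
Proof. now apply (is_derive_ext (V := C_R_NormedModule)). Qed.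

Lemma is_Cderive_scal (c : C) (f : R -> C) t (l : C) :
  is_Cderive f t l -> is_Cderive (fun t => c * f t)%C t (c * l)%C.
Proof.
intros H; eapply is_Cderive_eq.
  apply (is_Cderive_mult (fun _ => c)); [apply is_Cderive_const|exact H].
ring.
Qed.

Lemma is_Cderive_comp (f : R -> C) (g : R -> R) t k (l : C) :
  is_Cderive f (g t) l -> is_derive g t k -> is_Cderive (fun t => f (g t)) t (RtoC k * l)%C.
Proof.
intros Hf Hg; eapply is_Cderive_eq.
  apply (is_derive_comp (V := C_R_NormedModule) f g t l k Hf Hg).
apply C_ext; unfold scal; simpl; unfold scal; simpl; unfold mult; simpl;
  unfold Re, Im; ring.
Qed.

(** * Integrals over compact intervals *)

Definition Ccontinuous_on (f : R -> C) (a b : R) : Prop :=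
  forall t, a <= t <= b -> Ccontinuous f t.

Lemma CRInt_correct (f : R -> C) a b : a <= b -> Ccontinuous_on f a b ->
  is_CRInt f a b (CRInt f a b).
Proof.
intros Hab H; apply (RInt_correct (V := C_R_CompleteNormedModule)).
apply (ex_RInt_continuous (V := C_R_CompleteNormedModule)).
rewrite Rmin_left, Rmax_right by lra; exact H.
Qed.

Lemma CRInt_unique (f : R -> C) a b l : is_CRInt f a b l -> CRInt f a b = l.
Proof. apply (is_RInt_unique (V := C_R_CompleteNormedModule)). Qed.

Lemma is_CRInt_scal (c : C) (f : R -> C) a b l : is_CRInt f a b l ->
  is_CRInt (fun t => c * f t)%C a b (c * l)%C.
Proof.
intros H.
assert (A := is_RInt_fct_extend_fst _ _ _ _ H).
assert (B := is_RInt_fct_extend_snd _ _ _ _ H).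
apply (is_RInt_fct_extend_pair (U := R_NormedModule) (V := R_NormedModule)); simpl.
  apply (is_RInt_minus (V := R_NormedModule) _ _ _ _ (Re c * Re l) (Im c * Im l));
    now apply (is_RInt_scal (V := R_NormedModule)).
apply (is_RInt_plus (V := R_NormedModule) _ _ _ _ (Re c * Im l) (Im c * Re l));
  now apply (is_RInt_scal (V := R_NormedModule)).
Qed.

Lemma CRInt_bound (f : R -> C) (sigma' : R -> R) a b l s : a <= b ->
  (forall t, a <= t <= b -> Cmod (f t) <= sigma' t) ->
  is_CRInt f a b l -> is_RInt sigma' a b s -> Cmod l <= s.
Proof.
intros Hab H H1 H2; rewrite <- norm_C.
apply (norm_RInt_le (V := C_R_NormedModule) f sigma' a b); auto.
intros x Hx; rewrite norm_C; auto.
Qed.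

Lemma CRInt_Chasles (f : R -> C) a b c : a <= b <= c -> Ccontinuous_on f a c ->
  (CRInt f a b + CRInt f b c)%C = CRInt f a c.
Proof.
intros H Hf.
assert (A : is_CRInt f a b (CRInt f a b)).
  apply CRInt_correct; [lra|]; intros t Ht; apply Hf; lra.
assert (B : is_CRInt f b c (CRInt f b c)).
  apply CRInt_correct; [lra|]; intros t Ht; apply Hf; lra.
symmetry; apply CRInt_unique.
exact (is_RInt_Chasles (V := C_R_NormedModule) _ _ _ _ _ _ A B).
Qed.

Lemma CRInt_bound_const (f : R -> C) a b K : a <= b -> Ccontinuous_on f a b ->
  (forall t, a <= t <= b -> Cmod (f t) <= K) -> Cmod (CRInt f a b) <= K * (b - a).
Proof.
intros Hab Hf H.
apply (CRInt_bound f (fun _ => K) a b); auto.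
  now apply CRInt_correct.
rewrite Rmult_comm; apply (is_RInt_const (V := R_NormedModule)).
Qed.

(** A complex-valued function has no mean value point; the increment is bounded as the integral of
    the derivative. *)
Lemma C_mean_value (f df : R -> C) a b K : a <= b ->
  (forall t, a <= t <= b -> is_Cderive f t (df t)) -> Ccontinuous_on df a b ->
  (forall t, a <= t <= b -> Cmod (df t) <= K) -> Cmod (f b - f a) <= K * (b - a).
Proof.
intros Hab H Hc HK.
assert (E : is_CRInt df a b (f b - f a)%C).
  apply (is_RInt_derive (V := C_R_CompleteNormedModule) f df);
    rewrite Rmin_left, Rmax_right by lra; assumption.
rewrite <- (CRInt_unique _ _ _ _ E); now apply CRInt_bound_const.
Qed.

Lemma Cmod_bounded (f : R -> C) a b : a <= b -> Ccontinuous_on f a b ->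
  exists K, 0 < K /\ forall t, a <= t <= b -> Cmod (f t) <= K.
Proof.
intros Hab Hf.
destruct (continuity_ab_maj (fun t => Cmod (f t)) a b Hab) as [m [Hm _]].
  intros t Ht; apply continuity_pt_filterlim, Ccontinuous_Cmod, Hf, Ht.
exists (Cmod (f m) + 1); split; [generalize (Cmod_ge_0 (f m)); lra|].
intros t Ht; generalize (Hm t Ht); lra.
Qed.

Definition Ccontinuous_in (f : R -> C) (A B : R) : Prop :=
  forall t, A < t < B -> Ccontinuous f t.

Lemma Ccontinuous_in_on f A B a b : Ccontinuous_in f A B -> A < a -> b < B ->
  Ccontinuous_on f a b.
Proof. intros H Ha Hb t Ht; apply H; lra. Qed.

Lemma CRInt_derive (h : R -> C) A B a t : Ccontinuous_in h A B -> A < a < B -> A < t < B ->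
  is_Cderive (fun t => CRInt h a t) t (h t).
Proof.
intros Hh Ha Ht.
apply (is_derive_RInt (V := C_R_NormedModule) h (fun t => CRInt h a t) a t); [|now apply Hh].
assert (L : locally t (fun y => A < y < B)) by
  (apply filter_and; [apply (open_gt A)|apply (open_lt B)]; lra).
revert L; apply filter_imp; intros y Hy.
apply (RInt_correct (V := C_R_CompleteNormedModule)).
apply (ex_RInt_continuous (V := C_R_CompleteNormedModule)).
intros z [Hz1 Hz2]; apply Hh; split.
  eapply Rlt_le_trans; [|exact Hz1]; apply Rmin_glb_lt; lra.
eapply Rle_lt_trans; [exact Hz2|]; apply Rmax_lub_lt; lra.
Qed.

(* Abel's summation by parts in integral form: psi has variation at most that of
   the nondecreasing function sigma. *)
Lemma Abel_bound (psi dpsi h : R -> C) (sigma dsigma : R -> R) A B a b eta :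
  A < a -> a <= b -> b < B ->
  (forall t, A < t < B -> is_Cderive psi t (dpsi t)) -> Ccontinuous_in dpsi A B ->
  (forall t, A < t < B -> is_derive sigma t (dsigma t)) ->
  (forall t, A < t < B -> continuous dsigma t) ->
  (forall t, A < t < B -> Cmod (dpsi t) <= dsigma t) ->
  Ccontinuous_in h A B ->
  (forall t, a <= t <= b -> Cmod (CRInt h a t) <= eta) ->
  Cmod (CRInt (fun t => psi t * h t)%C a b)
    <= eta * (Cmod (psi b) + sigma b - sigma a).
Proof.
intros Ha Hab Hb Hpsi Hdpsi Hsig Hdsig Hdom Hh Heta.
(* [H] vanishes at [a], so integration by parts leaves [psi b * H b] minus the integral of
   [dpsi * H], and [eta] bounds [H] in both. *)
set (H := (fun t => CRInt h a t) : R -> C).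
assert (HH : forall t, a <= t <= b -> is_Cderive H t (h t)).
  intros t Ht; apply (CRInt_derive h A B); auto; lra.
assert (Hpc : Ccontinuous_in psi A B).
  intros t Ht; apply (is_Cderive_continuous _ _ _ (Hpsi t Ht)).
assert (HHc : Ccontinuous_on H a b).
  intros t Ht; apply (is_Cderive_continuous _ _ _ (HH t Ht)).
assert (C1 : Ccontinuous_on (fun t => dpsi t * H t)%C a b).
  intros t Ht; apply Ccontinuous_mult; [apply Hdpsi; lra|now apply HHc].
assert (C2 : Ccontinuous_on (fun t => psi t * h t)%C a b).
  intros t Ht; apply Ccontinuous_mult; [apply Hpc|apply Hh]; lra.
assert (I1 : is_CRInt (fun t => dpsi t * H t + psi t * h t)%C a b
    (psi b * H b - psi a * H a)%C).
  apply (is_RInt_derive (V := C_R_CompleteNormedModule) (fun t => psi t * H t)%C);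
    rewrite Rmin_left, Rmax_right by lra; intros t Ht.
    apply is_Cderive_mult; [apply Hpsi; lra|now apply HH].
  apply Ccontinuous_plus; [now apply C1|now apply C2].
assert (I2 : is_CRInt (fun t => dpsi t * H t + psi t * h t)%C a b
    (CRInt (fun t => dpsi t * H t)%C a b + CRInt (fun t => psi t * h t)%C a b)%C).
  apply (is_RInt_plus (V := C_R_NormedModule)); now apply CRInt_correct.
assert (Ha0 : H a = RtoC 0).
  unfold H; exact (RInt_point (V := C_R_CompleteNormedModule) a h).
assert (E := CRInt_unique _ _ _ _ I1).
rewrite (CRInt_unique _ _ _ _ I2), Ha0 in E.
replace (CRInt (fun t => psi t * h t)%C a b)
  with (psi b * H b - CRInt (fun t => dpsi t * H t)%C a b)%C
  by (rewrite <- (Cplus_0_r (CRInt (fun t => psi t * h t)%C a b));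
      replace (psi b * H b)%C with (psi b * H b - psi a * 0)%C by ring;
      rewrite <- E; ring).
assert (Heta0 : 0 <= eta).
  eapply Rle_trans; [apply Cmod_ge_0|apply (Heta b); lra].
assert (B1 : Cmod (CRInt (fun t => dpsi t * H t)%C a b) <= eta * (sigma b - sigma a)).
  apply (CRInt_bound (fun t => dpsi t * H t)%C (fun t => eta * dsigma t) a b); auto.
  - intros t Ht; rewrite Cmod_mult, Rmult_comm.
    apply Rmult_le_compat; try apply Cmod_ge_0; [now apply Heta|apply Hdom; lra].
  - now apply CRInt_correct.
  - apply (is_RInt_scal (V := R_NormedModule)).
    apply (is_RInt_derive (V := R_CompleteNormedModule) sigma);
      rewrite Rmin_left, Rmax_right by lra; intros t Ht; [apply Hsig|apply Hdsig]; lra.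
assert (B2 : Cmod (psi b * H b) <= eta * Cmod (psi b)).
  rewrite Cmod_mult, Rmult_comm; apply Rmult_le_compat_r; [apply Cmod_ge_0|].
  apply Heta; lra.
unfold Cminus; eapply Rle_trans; [apply Cmod_triangle|]; rewrite Cmod_opp; lra.
Qed.

Lemma locally_Cmod (l : C) (eps : R) : 0 < eps ->
  @locally (NormedModule.UniformSpace _ C_R_NormedModule) l (fun y => Cmod (y - l)%C < eps).
Proof.
intros He.
assert (L := locally_norm_ball_norm (V := C_R_NormedModule) l (mkposreal _ He)).
apply (locally_le_locally_norm (V := C_R_NormedModule)) in L.
revert L; apply filter_imp; intros y Hy; rewrite <- norm_C; exact Hy.
Qed.

Lemma locally_Cmod_inv (l : C) (P : C -> Prop) :
  @locally (NormedModule.UniformSpace _ C_R_NormedModule) l P ->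
  exists eps, 0 < eps /\ forall y, Cmod (y - l)%C < eps -> P y.
Proof.
intros L; apply (locally_norm_le_locally (V := C_R_NormedModule)) in L.
destruct L as [eps L]; exists eps; split; [apply cond_pos|].
intros y Hy; apply L; unfold ball_norm.
change (@norm R_AbsRing C_R_NormedModule (y - l)%C < eps); now rewrite norm_C.
Qed.

(** * Improper integrals of functions continuous on an open interval *)

(** Stated with the total integral [CRInt] and explicit distances, so that estimates need no
    filters; for continuous integrands [improper_iff] identifies it with [RInt_gen]. *)
Definition improper (f : R -> C) (A B : R) (l : C) : Prop :=
  forall eps, 0 < eps -> exists d, 0 < d /\
    forall a b, A < a < A + d -> B - d < b < B -> Cmod (CRInt f a b - l)%C < eps.

(** Cauchy's criterion at the two ends. It involves compact subintervals only, where [Abel_bound]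
    applies, and the weak inequality survives a passage to the limit in [f]. *)
Definition small_tails (f : R -> C) (A B d eps : R) : Prop :=
  (forall a b, A < a <= b -> b < A + d -> Cmod (CRInt f a b) <= eps) /\
  (forall a b, B - d < a <= b -> b < B -> Cmod (CRInt f a b) <= eps).

Lemma filter_ends (A B : R) (P : R * R -> Prop) :
  filter_prod (at_right A) (at_left B) P <->
  exists d, 0 < d /\ forall a b, A < a < A + d -> B - d < b < B -> P (a, b).
Proof.
split.
  intros [Q S [d1 H1] [d2 H2] H].
  exists (Rmin d1 d2); split; [apply Rmin_pos; apply cond_pos|].
  intros a b Ha Hb.
  assert (M1 := Rmin_l d1 d2); assert (M2 := Rmin_r d1 d2).
  apply H; [apply H1|apply H2]; try lra; apply Rabs_def1; unfold minus, plus, opp; simpl; lra.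
intros [d [Hd H]].
apply (Filter_prod _ _ _ (fun a => A < a < A + d) (fun b => B - d < b < B)).
- exists (mkposreal d Hd); intros y Hy Hy'; apply Rabs_lt_between in Hy.
  unfold minus, plus, opp in Hy; simpl in Hy; lra.
- exists (mkposreal d Hd); intros y Hy Hy'; apply Rabs_lt_between in Hy.
  unfold minus, plus, opp in Hy; simpl in Hy; lra.
- exact H.
Qed.

Lemma improper_filterlim (f : R -> C) A B l : improper f A B l <->
  filterlim (fun ab => CRInt f (fst ab) (snd ab)) (filter_prod (at_right A) (at_left B))
    (@locally (NormedModule.UniformSpace _ C_R_NormedModule) l).
Proof.
split.
  intros H P HP; destruct (locally_Cmod_inv _ _ HP) as [eps [He Heps]].
  apply filter_ends; destruct (H eps He) as [d [Hd Hab]].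
  exists d; split; [exact Hd|]; intros a b Ha Hb; apply Heps, Hab; assumption.
intros H eps He; generalize (H _ (locally_Cmod l eps He)); intros L.
now apply filter_ends in L.
Qed.

Lemma improper_iff (f : R -> C) A B l : A < B -> Ccontinuous_in f A B ->
  is_CInt f (at_right A) (at_left B) l <-> improper f A B l.
Proof.
intros HAB Hf; split.
  intros H eps He.
  generalize (H _ (locally_Cmod l eps He)); intros L; apply filter_ends in L.
  destruct L as [d [Hd L]]; exists d; split; [exact Hd|]; intros a b Ha Hb.
  destruct (L a b Ha Hb) as [y [Hy1 Hy2]].
  rewrite (CRInt_unique f a b y Hy1); exact Hy2.
intros H P HP; destruct (locally_Cmod_inv _ _ HP) as [eps [He Heps]].
apply filter_ends; destruct (H eps He) as [d [Hd Hab]].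
(* Half the length keeps [a] to the left of [b], so that the segment lies inside the open
   interval. *)
exists (Rmin d ((B - A) / 2)); split; [apply Rmin_pos; lra|].
intros a b Ha Hb.
assert (M1 := Rmin_l d ((B - A) / 2)); assert (M2 := Rmin_r d ((B - A) / 2)).
exists (CRInt f a b); split; [|apply Heps, Hab; lra].
apply CRInt_correct; [simpl; lra|].
intros t Ht; apply Hf; simpl in Ht; lra.
Qed.

Lemma improper_tails (f : R -> C) A B l eps : A < B -> Ccontinuous_in f A B ->
  improper f A B l -> 0 < eps -> exists d, 0 < d < (B - A) / 2 /\ small_tails f A B d eps.
Proof.
intros HAB Hf H He; destruct (H (eps / 2) ltac:(lra)) as [d0 [Hd0 D]].
set (d := Rmin (d0 / 2) ((B - A) / 4)).
assert (M1 : d <= d0 / 2) by apply Rmin_l.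
assert (M2 : d <= (B - A) / 4) by apply Rmin_r.
assert (Hd : 0 < d) by (apply Rmin_pos; lra).
exists d; split; [lra|].
assert (T : forall x y : C, Cmod (x - l) < eps / 2 -> Cmod (y - l) < eps / 2 ->
    Cmod (x - y) <= eps).
  intros x y Hx Hy; replace (x - y)%C with ((x - l) + - (y - l))%C by ring.
  eapply Rle_trans; [apply Cmod_triangle|]; rewrite Cmod_opp; lra.
split; intros a b Ha Hb.
  (* The tail is the difference of two integrals with the common end [c], each within [eps / 2] of
     [l]. *)
  set (c := B - d / 2).
  replace (CRInt f a b) with (CRInt f a c - CRInt f b c)%C.
    apply T; apply D; unfold c; lra.
  rewrite <- (CRInt_Chasles f a b c); [ring|unfold c; lra|].
  apply (Ccontinuous_in_on _ A B); auto; unfold c; lra.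
set (c := A + d / 2).
replace (CRInt f a b) with (CRInt f c b - CRInt f c a)%C.
  apply T; apply D; unfold c; lra.
rewrite <- (CRInt_Chasles f c a b); [ring|unfold c; lra|].
apply (Ccontinuous_in_on _ A B); auto; unfold c; lra.
Qed.

(** One end is moved at a time, and each move costs [eps]. *)
Lemma tails_diff (f : R -> C) A B d eps a b a' b' : A < B -> Ccontinuous_in f A B ->
  0 < d < (B - A) / 2 -> small_tails f A B d eps ->
  A < a < A + d -> A < a' < A + d -> B - d < b < B -> B - d < b' < B ->
  Cmod (CRInt f a b - CRInt f a' b') <= 2 * eps.
Proof.
intros HAB Hf Hd [T1 T2] Ha Ha' Hb Hb'.
assert (Hc : forall x y, A < x -> y < B -> Ccontinuous_on f x y)
  by (intros; now apply (Ccontinuous_in_on _ A B)).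
assert (P1 : Cmod (CRInt f a b - CRInt f a' b) <= eps).
  destruct (Rle_dec a a').
    rewrite <- (CRInt_Chasles f a a' b) by (try apply Hc; lra).
    replace (_ - _)%C with (CRInt f a a') by ring; apply T1; lra.
  rewrite <- (CRInt_Chasles f a' a b) by (try apply Hc; lra).
  replace (_ - _)%C with (- CRInt f a' a)%C by ring; rewrite Cmod_opp; apply T1; lra.
assert (P2 : Cmod (CRInt f a' b - CRInt f a' b') <= eps).
  destruct (Rle_dec b b').
    rewrite <- (CRInt_Chasles f a' b b') by (try apply Hc; lra).
    replace (_ - _)%C with (- CRInt f b b')%C by ring; rewrite Cmod_opp; apply T2; lra.
  rewrite <- (CRInt_Chasles f a' b' b) by (try apply Hc; lra).
  replace (_ - _)%C with (CRInt f b' b) by ring; apply T2; lra.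
replace (CRInt f a b - CRInt f a' b')%C
  with ((CRInt f a b - CRInt f a' b) + (CRInt f a' b - CRInt f a' b'))%C by ring.
eapply Rle_trans; [apply Cmod_triangle|]; lra.
Qed.

(** The error is governed by the tails alone: integrands with common small tails converge at a
    common rate. *)
Lemma tails_limit (f : R -> C) A B l d eps a b : A < B -> Ccontinuous_in f A B ->
  improper f A B l -> 0 < d < (B - A) / 2 -> small_tails f A B d eps ->
  A < a < A + d -> B - d < b < B -> Cmod (CRInt f a b - l) <= 2 * eps.
Proof.
intros HAB Hf H Hd T Ha Hb.
apply le_epsilon; intros e He.
destruct (H e He) as [d0 [Hd0 D]].
set (d1 := Rmin d0 d).
assert (M1 : d1 <= d0) by apply Rmin_l.
assert (M2 : d1 <= d) by apply Rmin_r.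
assert (M0 : 0 < d1) by (apply Rmin_pos; lra).
assert (X := D (A + d1 / 2) (B - d1 / 2) ltac:(lra) ltac:(lra)).
assert (Y := tails_diff f A B d eps a b (A + d1 / 2) (B - d1 / 2)
  HAB Hf Hd T Ha ltac:(lra) Hb ltac:(lra)).
set (I := CRInt f (A + d1 / 2) (B - d1 / 2)) in *.
replace (CRInt f a b - l)%C with ((CRInt f a b - I) + (I - l))%C by ring.
eapply Rle_trans; [apply Cmod_triangle|]; lra.
Qed.

Lemma improper_exists (f : R -> C) A B : A < B -> Ccontinuous_in f A B ->
  (forall eps, 0 < eps -> exists d, 0 < d < (B - A) / 2 /\ small_tails f A B d eps) ->
  exists l, improper f A B l.
Proof.
intros HAB Hf H.
destruct (proj1 (filterlim_locally_cauchy (U := C_R_CompleteNormedModule)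
   (F := filter_prod (at_right A) (at_left B))
   (fun ab => CRInt f (fst ab) (snd ab)))) as [l Hl].
  intros eps.
  destruct (H (eps / 4)) as [d [Hd T]]; [generalize (cond_pos eps); lra|].
  exists (fun ab => A < fst ab < A + d /\ B - d < snd ab < B); split.
    apply filter_ends; exists d; split; [lra|]; simpl; tauto.
  intros [a b] [a' b'] [Ha Hb] [Ha' Hb'].
  apply (norm_compat1 (V := C_R_NormedModule)).
  change (@norm R_AbsRing C_R_NormedModule (CRInt f a' b' - CRInt f a b)%C < eps).
  rewrite norm_C; eapply Rle_lt_trans;
    [apply (tails_diff f A B d (eps / 4)); auto|generalize (cond_pos eps); lra].
exists l; now apply improper_filterlim.
Qed.

Lemma improper_unique (f : R -> C) A B l m : improper f A B l -> improper f A B m -> l = m.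
Proof.
intros H1 H2; apply improper_filterlim in H1; apply improper_filterlim in H2.
exact (filterlim_locally_unique (V := C_R_NormedModule) _ _ _ H1 H2).
Qed.

Lemma improper_ext (f g : R -> C) A B l : A < B -> (forall t, A < t < B -> f t = g t) ->
  improper f A B l -> improper g A B l.
Proof.
intros HAB E H eps He; destruct (H eps He) as [d [Hd D]].
exists (Rmin d ((B - A) / 2)); split; [apply Rmin_pos; lra|].
intros a b Ha Hb.
assert (M1 := Rmin_l d ((B - A) / 2)); assert (M2 := Rmin_r d ((B - A) / 2)).
unfold CRInt; rewrite <- (RInt_ext (V := C_R_CompleteNormedModule) f g); [apply D; lra|].
intros x; rewrite Rmin_left, Rmax_right by lra; intros; apply E; lra.
Qed.

Lemma improper_scal (c : C) (f : R -> C) A B l : A < B -> Ccontinuous_in f A B ->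
  improper f A B l -> improper (fun t => c * f t)%C A B (c * l)%C.
Proof.
intros HAB Hf H eps He.
assert (Hc := Cmod_ge_0 c).
destruct (H (eps / (Cmod c + 1))) as [d [Hd D]]; [apply Rdiv_lt_0_compat; lra|].
exists (Rmin d ((B - A) / 2)); split; [apply Rmin_pos; lra|].
intros a b Ha Hb.
assert (M1 := Rmin_l d ((B - A) / 2)); assert (M2 := Rmin_r d ((B - A) / 2)).
rewrite (CRInt_unique _ _ _ (c * CRInt f a b)%C).
2:{ apply is_CRInt_scal, CRInt_correct; [lra|].
    apply (Ccontinuous_in_on _ A B); auto; lra. }
replace (c * CRInt f a b - c * l)%C with (c * (CRInt f a b - l))%C by ring.
rewrite Cmod_mult.
assert (X := D a b ltac:(lra) ltac:(lra)).
apply Rle_lt_trans with (Cmod c * (eps / (Cmod c + 1))).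
  apply Rmult_le_compat_l; lra.
apply Rlt_le_trans with ((Cmod c + 1) * (eps / (Cmod c + 1))).
  apply Rmult_lt_compat_r; [apply Rdiv_lt_0_compat|]; lra.
right; field; lra.
Qed.

Lemma improper_plus (f g : R -> C) A B l m : A < B -> Ccontinuous_in f A B ->
  Ccontinuous_in g A B -> improper f A B l -> improper g A B m ->
  improper (fun t => f t + g t)%C A B (l + m)%C.
Proof.
intros HAB Hf Hg H1 H2 eps He.
destruct (H1 (eps / 2)) as [d1 [Hd1 D1]]; [lra|].
destruct (H2 (eps / 2)) as [d2 [Hd2 D2]]; [lra|].
exists (Rmin (Rmin d1 d2) ((B - A) / 2)); split; [repeat apply Rmin_pos; lra|].
intros a b Ha Hb.
assert (M1 := Rmin_l (Rmin d1 d2) ((B - A) / 2)).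
assert (M2 := Rmin_r (Rmin d1 d2) ((B - A) / 2)).
assert (M3 := Rmin_l d1 d2); assert (M4 := Rmin_r d1 d2).
rewrite (CRInt_unique _ _ _ (CRInt f a b + CRInt g a b)%C).
2:{ apply (is_RInt_plus (V := C_R_NormedModule)); apply CRInt_correct; try lra;
    apply (Ccontinuous_in_on _ A B); auto; lra. }
replace (CRInt f a b + CRInt g a b - (l + m))%C
  with ((CRInt f a b - l) + (CRInt g a b - m))%C by ring.
eapply Rle_lt_trans; [apply Cmod_triangle|].
generalize (D1 a b ltac:(lra) ltac:(lra)) (D2 a b ltac:(lra) ltac:(lra)); lra.
Qed.

(** * Multipliers of conditionally convergent integrals *)

(* A function of variation at most that of the bounded nondecreasing sigma is a
   multiplier of conditionally convergent integrals. *)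
Definition multiplier (psi : R -> C) (A B V : R) : Prop :=
  exists (dpsi : R -> C) (sigma dsigma : R -> R),
  (forall t, A < t < B -> is_Cderive psi t (dpsi t)) /\ Ccontinuous_in dpsi A B /\
  (forall t, A < t < B -> is_derive sigma t (dsigma t)) /\
  (forall t, A < t < B -> continuous dsigma t) /\
  (forall t, A < t < B -> Cmod (dpsi t) <= dsigma t) /\
  (forall t, A < t < B -> Cmod (psi t) <= V) /\
  (forall t, A < t < B -> Rabs (sigma t) <= V).

Lemma multiplier_continuous psi A B V : multiplier psi A B V -> Ccontinuous_in psi A B.
Proof.
intros [dpsi [_ [_ [H _]]]] t Ht; apply (is_Cderive_continuous _ _ _ (H t Ht)).
Qed.

Lemma Ccontinuous_in_mult f g A B : Ccontinuous_in f A B -> Ccontinuous_in g A B ->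
  Ccontinuous_in (fun t => f t * g t)%C A B.
Proof. intros H1 H2 t Ht; apply Ccontinuous_mult; auto. Qed.

(** The factor [3 * V] bounds [Cmod (psi b) + sigma b - sigma a] in [Abel_bound], each of the three
    terms being at most [V] in absolute value. *)
Lemma multiplier_tails psi h A B V d eps : A < B -> multiplier psi A B V ->
  Ccontinuous_in h A B -> d < B - A -> small_tails h A B d eps ->
  small_tails (fun t => psi t * h t)%C A B d (eps * (3 * V)).
Proof.
intros HAB [dpsi [sg [dsg [H1 [H2 [H3 [H4 [H5 [H6 H7]]]]]]]]] Hh Hd [T1 T2].
assert (P : forall a b, A < a <= b -> b < B ->
    (forall t, a <= t <= b -> Cmod (CRInt h a t) <= eps) ->
    Cmod (CRInt (fun t => psi t * h t)%C a b) <= eps * (3 * V)).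
  intros a b Ha Hb Heps.
  eapply Rle_trans.
    apply (Abel_bound psi dpsi h sg dsg A B a b eps); auto; lra.
  apply Rmult_le_compat_l.
    eapply Rle_trans; [apply Cmod_ge_0|apply (Heps a); lra].
  assert (X := H6 b ltac:(lra)); assert (Y := H7 b ltac:(lra)).
  assert (Z := H7 a ltac:(lra)).
  apply Rabs_le_between in Y; apply Rabs_le_between in Z; lra.
split; intros a b Ha Hb; apply P; auto; try lra; intros t Ht.
  apply T1; lra.
apply T2; lra.
Qed.

(** Uniformity is asked on compact subintervals only; near the ends the bound on the variation takes
    over. *)
Definition uniform_limit {T : Type} (F : (T -> Prop) -> Prop) (psi : T -> R -> C)
    (phi : R -> C) (A B : R) : Prop :=
  forall a b eps, A < a -> a <= b -> b < B -> 0 < eps ->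
    F (fun i => forall t, a <= t <= b -> Cmod (psi i t - phi t) <= eps).

(* A version of the dominated convergence theorem for conditionally convergent
   integrals. *)
Lemma multiplier_limit {T : Type} (F : (T -> Prop) -> Prop) {FF : ProperFilter F}
    (psi : T -> R -> C) (phi h : R -> C) (A B V : R) (m : C) :
  A < B -> Ccontinuous_in h A B -> improper h A B m -> Ccontinuous_in phi A B ->
  F (fun i => multiplier (psi i) A B V) -> uniform_limit F psi phi A B ->
  exists J, improper (fun t => phi t * h t)%C A B J /\
  (forall eps, 0 < eps -> F (fun i => forall Ji,
     improper (fun t => psi i t * h t)%C A B Ji -> Cmod (Ji - J) < eps)).
Proof.
intros HAB Hh Hm Hphi HM HU.
assert (HV : 0 <= V).
  destruct (filter_ex _ HM) as [i [dpsi [sg [dsg [_ [_ [_ [_ [_ [H6 _]]]]]]]]]].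
  eapply Rle_trans; [apply Cmod_ge_0|apply (H6 ((A + B) / 2)); lra].
assert (TP : forall d eps, 0 < d < (B - A) / 2 -> small_tails h A B d eps ->
    F (fun i => multiplier (psi i) A B V /\
       small_tails (fun t => psi i t * h t)%C A B d (eps * (3 * V)))).
  intros d eps Hd HT; revert HM; apply filter_imp; intros i Hi; split; [exact Hi|].
  apply multiplier_tails; auto; lra.
assert (DI : forall a b, A < a -> a <= b -> b < B -> forall eps, 0 < eps ->
    F (fun i => multiplier (psi i) A B V -> Cmod (CRInt (fun t => psi i t * h t)%C a b
      - CRInt (fun t => phi t * h t)%C a b) <= eps)).
  intros a b Ha Hab Hb eps Heps.
  destruct (Cmod_bounded h a b Hab (Ccontinuous_in_on _ _ _ _ _ Hh Ha Hb)) as [K [HK0 HK]].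
  assert (He' : 0 < eps / (K * (b - a) + 1)).
    apply Rdiv_lt_0_compat; [exact Heps|].
    assert (0 <= K * (b - a)) by (apply Rmult_le_pos; lra); lra.
  generalize (HU a b _ Ha Hab Hb He'); apply filter_imp; intros i Hi Mi.
  assert (Ci := multiplier_continuous _ _ _ _ Mi).
  assert (X1 := Ccontinuous_in_on _ _ _ _ _ (Ccontinuous_in_mult _ _ _ _ Ci Hh) Ha Hb).
  assert (X2 := Ccontinuous_in_on _ _ _ _ _ (Ccontinuous_in_mult _ _ _ _ Hphi Hh) Ha Hb).
  assert (E := is_RInt_minus (V := C_R_NormedModule) _ _ _ _ _ _
    (CRInt_correct _ _ _ Hab X1) (CRInt_correct _ _ _ Hab X2)).
  set (e' := eps / (K * (b - a) + 1)) in *.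
  apply Rle_trans with (e' * K * (b - a)).
    refine (CRInt_bound _ (fun _ => e' * K) a b _ _ Hab _ E _).
      intros t Ht.
      change (Cmod (psi i t * h t - phi t * h t) <= e' * K).
      replace (psi i t * h t - phi t * h t)%C with ((psi i t - phi t) * h t)%C by ring.
      rewrite Cmod_mult; apply Rmult_le_compat; auto using Cmod_ge_0.
    rewrite (Rmult_comm (e' * K)); apply (is_RInt_const (V := R_NormedModule) a b (e' * K)).
  assert (0 <= K * (b - a)) by (apply Rmult_le_pos; lra).
  replace eps with (e' * (K * (b - a) + 1)) by (unfold e'; field; lra).
  rewrite Rmult_assoc; apply Rmult_le_compat_l; lra.
(* [phi] is not known to be a multiplier; its tail bounds are limits of those for [psi i], which
   share the constant [V]. *)
assert (TQ : forall d eps, 0 < d < (B - A) / 2 -> small_tails h A B d eps ->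
    small_tails (fun t => phi t * h t)%C A B d (eps * (3 * V))).
  intros d eps Hd HT.
  assert (P : forall a b, A < a <= b -> b < B ->
      F (fun i => Cmod (CRInt (fun t => psi i t * h t)%C a b) <= eps * (3 * V)) ->
      Cmod (CRInt (fun t => phi t * h t)%C a b) <= eps * (3 * V)).
    intros a b Ha Hb HF; apply le_epsilon; intros e He.
    destruct (filter_ex _ (filter_and _ _ HF (filter_and _ _ HM
      (DI a b ltac:(lra) ltac:(lra) Hb e He)))) as [i [X [Y Z]]].
    specialize (Z Y).
    set (u := CRInt (fun t => psi i t * h t)%C a b) in *.
    set (v := CRInt (fun t => phi t * h t)%C a b) in *.
    replace v with (u + - (u - v))%C by ring.
    eapply Rle_trans; [apply Cmod_triangle|]; rewrite Cmod_opp; lra.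
  split; intros a b Ha Hb; apply P; auto; try lra;
    generalize (TP d eps Hd HT); apply filter_imp; intros i [_ [Y1 Y2]]; auto.
assert (Hc := Ccontinuous_in_mult _ _ _ _ Hphi Hh).
assert (HT : forall eps, 0 < eps -> exists d, 0 < d < (B - A) / 2 /\
    small_tails h A B d (eps / (3 * V + 1)) /\ eps / (3 * V + 1) * (3 * V) <= eps).
  intros eps He.
  assert (He' : 0 < eps / (3 * V + 1)) by (apply Rdiv_lt_0_compat; lra).
  destruct (improper_tails h A B m _ HAB Hh Hm He') as [d [Hd T']].
  exists d; split; [exact Hd|]; split; [exact T'|].
  apply Rle_trans with (eps / (3 * V + 1) * (3 * V + 1)); [apply Rmult_le_compat_l; lra|].
  right; field; lra.
destruct (improper_exists (fun t => phi t * h t)%C A B HAB Hc) as [J HJ].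
  intros eps He; destruct (HT eps He) as [d [Hd [T1 T2]]].
  exists d; split; [exact Hd|].
  destruct (TQ d _ Hd T1) as [Q1 Q2].
  split; intros a b Ha Hb; eapply Rle_trans; eauto.
exists J; split; [exact HJ|]; intros eps He.
(* The total error is at most five sixths of [eps]: two sixths from the tails on each side and one
   from the compact part. *)
destruct (HT (eps / 6)) as [d [Hd [T1 T2]]]; [lra|].
set (a := A + d / 2); set (b := B - d / 2).
generalize (filter_and _ _ (TP d _ Hd T1)
  (DI a b ltac:(unfold a; lra) ltac:(unfold a, b; lra) ltac:(unfold b; lra)
    (eps / 6) ltac:(lra))).
apply filter_imp; intros i [[Mi Ti] Di] Ji HJi.
specialize (Di Mi).
assert (Ci := Ccontinuous_in_mult _ _ _ _ (multiplier_continuous _ _ _ _ Mi) Hh).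
assert (L1 := tails_limit _ A B Ji d _ a b HAB Ci HJi Hd Ti
  ltac:(unfold a; lra) ltac:(unfold b; lra)).
assert (L2 := tails_limit _ A B J d _ a b HAB Hc HJ Hd (TQ d _ Hd T1)
  ltac:(unfold a; lra) ltac:(unfold b; lra)).
set (u := CRInt (fun t => psi i t * h t)%C a b) in *.
set (v := CRInt (fun t => phi t * h t)%C a b) in *.
replace (Ji - J)%C with (- (u - Ji) + ((u - v) + (v - J)))%C by ring.
eapply Rle_lt_trans; [apply Cmod_triangle|].
eapply Rle_lt_trans; [apply Rplus_le_compat_l, Cmod_triangle|].
rewrite Cmod_opp; lra.
Qed.

(** * Complex series as limits of partial sums *)

Fixpoint Csum (a : nat -> C) (n : nat) : C :=
  match n with O => a O | S k => (Csum a k + a (S k))%C end.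

(** The common form to which [ex_series] over the complex module and the componentwise [CSeries] are
    both reduced. *)
Definition Csum_lim (a : nat -> C) (s : C) : Prop :=
  forall eps, 0 < eps -> eventually (fun n => Cmod (Csum a n - s) < eps).

Lemma Csum_Re a n : Re (Csum a n) = sum_n (fun k => Re (a k)) n.
Proof.
induction n as [|n IH]; [now rewrite sum_O|].
rewrite sum_Sn, <- IH; reflexivity.
Qed.

Lemma Csum_Im a n : Im (Csum a n) = sum_n (fun k => Im (a k)) n.
Proof.
induction n as [|n IH]; [now rewrite sum_O|].
rewrite sum_Sn, <- IH; reflexivity.
Qed.

Lemma Csum_ext a b n : (forall k, (k <= n)%nat -> a k = b k) -> Csum a n = Csum b n.
Proof.
induction n as [|n IH]; intros H; simpl; [apply H; lia|].
rewrite IH by (intros; apply H; lia); rewrite H by lia; reflexivity.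
Qed.

Lemma Csum_scal c a n : (c * Csum a n)%C = Csum (fun k => c * a k)%C n.
Proof. induction n as [|n IH]; simpl; [reflexivity|rewrite <- IH; ring]. Qed.

Lemma Csum_RtoC a n : Csum (fun k => RtoC (a k)) n = RtoC (sum_n a n).
Proof.
induction n as [|n IH]; [now rewrite sum_O|].
simpl; rewrite IH, sum_Sn, <- RtoC_plus; reflexivity.
Qed.

Lemma Csum_Cmod a n : Cmod (Csum a n) <= sum_n (fun k => Cmod (a k)) n.
Proof.
induction n as [|n IH]; [rewrite sum_O; simpl; lra|].
rewrite sum_Sn; eapply Rle_trans; [apply Cmod_triangle|].
apply Rplus_le_compat_r, IH.
Qed.

Lemma sum_n_le_R a b n : (forall k, (k <= n)%nat -> a k <= b k) -> sum_n a n <= sum_n b n.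
Proof.
induction n as [|n IH]; intros H; [rewrite !sum_O; apply H; lia|].
rewrite !sum_Sn; apply Rplus_le_compat; [apply IH; intros|]; apply H; lia.
Qed.

Lemma Csum_lim_Re_Im a s : Csum_lim a s <->
  is_series (fun k => Re (a k)) (Re s) /\ is_series (fun k => Im (a k)) (Im s).
Proof.
split.
  intros H; split; intros P [eps HP]; unfold filtermap;
    generalize (H eps (cond_pos eps)); apply filter_imp; intros n Hn; apply HP.
    rewrite <- Csum_Re.
    eapply Rle_lt_trans; [|exact Hn]; apply (Re_le_Cmod (Csum a n - s)).
  rewrite <- Csum_Im.
  eapply Rle_lt_trans; [|exact Hn]; apply (Im_le_Cmod (Csum a n - s)).
intros [H1 H2] eps He.
assert (He' : 0 < eps / 2) by lra.
assert (X : eventually (fun n => Rabs (sum_n (fun k => Re (a k)) n - Re s) < eps / 2))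
  by exact (H1 _ (locally_ball _ (mkposreal _ He'))).
assert (Y : eventually (fun n => Rabs (sum_n (fun k => Im (a k)) n - Im s) < eps / 2))
  by exact (H2 _ (locally_ball _ (mkposreal _ He'))).
generalize (filter_and _ _ X Y); apply filter_imp; clear X Y; intros n [X Y].
rewrite <- Csum_Re in X; rewrite <- Csum_Im in Y.
eapply Rle_lt_trans; [apply Cmod_le_abs|].
simpl; unfold Re, Im, Rminus in X, Y; lra.
Qed.

Lemma CSeries_unique a s : Csum_lim a s -> CSeries a = s.
Proof.
intros H; apply Csum_lim_Re_Im in H; destruct H as [H1 H2].
unfold CSeries; rewrite (is_series_unique _ _ H1), (is_series_unique _ _ H2).
now destruct s.
Qed.

Lemma ex_series_C (a : nat -> C) : ex_series (V := C_NormedModule) a ->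
  ex_series (fun k => Re (a k)) /\ ex_series (fun k => Im (a k)).
Proof.
intros [s H].
assert (E : forall n, sum_n (G := C_NormedModule) a n = Csum a n).
  induction n as [|n IH]; [now rewrite sum_O|rewrite sum_Sn, IH; reflexivity].
assert (L : Csum_lim a s).
  intros eps He.
  assert (X : eventually (fun n =>
      ball_norm (V := C_NormedModule) s (mkposreal eps He) (sum_n (G := C_NormedModule) a n))).
    apply H, (locally_le_locally_norm (V := C_NormedModule)), locally_norm_ball_norm.
  revert X; apply filter_imp; intros n Hn; rewrite <- E; exact Hn.
apply Csum_lim_Re_Im in L; destruct L as [L1 L2]; split; eexists; eassumption.
Qed.

Lemma CSeries_correct (a : nat -> C) : ex_series (V := C_NormedModule) a ->
  Csum_lim a (CSeries a).
Proof.
intros H; destruct (ex_series_C a H) as [H1 H2].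
apply Csum_lim_Re_Im; split; now apply Series_correct.
Qed.

Lemma Csum_lim_scal c a s : Csum_lim a s -> Csum_lim (fun k => c * a k)%C (c * s)%C.
Proof.
intros H eps He; assert (Hc := Cmod_ge_0 c).
assert (He' : 0 < eps / (Cmod c + 1)) by (apply Rdiv_lt_0_compat; lra).
generalize (H _ He'); apply filter_imp; intros n Hn.
rewrite <- Csum_scal; replace (c * Csum a n - c * s)%C with (c * (Csum a n - s))%C by ring.
rewrite Cmod_mult.
apply Rle_lt_trans with (Cmod c * (eps / (Cmod c + 1))).
  apply Rmult_le_compat_l; lra.
apply Rlt_le_trans with ((Cmod c + 1) * (eps / (Cmod c + 1))).
  apply Rmult_lt_compat_r; lra.
right; field; lra.
Qed.

Lemma Csum_lim_ext a b s : (forall k, a k = b k) -> Csum_lim a s -> Csum_lim b s.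
Proof.
intros E H eps He; generalize (H eps He); apply filter_imp; intros n Hn.
now rewrite <- (Csum_ext a b) by (intros; apply E).
Qed.

Lemma Csum_lim_terms a s : Csum_lim a s -> exists K, forall n, Cmod (a n) <= K.
Proof.
intros H; apply Csum_lim_Re_Im in H; destruct H as [H1 H2].
assert (L : forall u : nat -> R, ex_series u -> exists K, forall n, Rabs (u n) <= K).
  intros u Hu; apply ex_series_lim_0 in Hu.
  destruct (filterlim_bounded u) as [K HK]; [exists 0; exact Hu|].
  exists K; exact HK.
destruct (L _ (ex_intro _ _ H1)) as [K1 HK1].
destruct (L _ (ex_intro _ _ H2)) as [K2 HK2].
exists (K1 + K2); intros n; eapply Rle_trans; [apply Cmod_le_abs|].
generalize (HK1 n) (HK2 n); lra.
Qed.

Lemma improper_Csum (c : nat -> C) (p : nat -> R -> C) (h : R -> C) A B (m : nat -> C) n :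
  A < B -> Ccontinuous_in h A B -> (forall k, Ccontinuous_in (p k) A B) ->
  (forall k, improper (fun t => p k t * h t)%C A B (m k)) ->
  improper (fun t => Csum (fun k => c k * p k t)%C n * h t)%C A B
    (Csum (fun k => c k * m k)%C n).
Proof.
intros HAB Hh Hp Hm.
assert (Hc : forall n, Ccontinuous_in (fun t => Csum (fun k => c k * p k t)%C n) A B).
  intros k; induction k as [|k IH]; simpl; intros t Ht.
    apply Ccontinuous_mult; [apply Ccontinuous_const|now apply Hp].
  apply Ccontinuous_plus; [now apply IH|].
  apply Ccontinuous_mult; [apply Ccontinuous_const|now apply Hp].
assert (Hs : forall k, improper (fun t => c k * p k t * h t)%C A B (c k * m k)%C).
  intros k; apply (improper_ext (fun t => c k * (p k t * h t))%C); [exact HAB| |].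
    intros; ring.
  apply improper_scal; auto; now apply Ccontinuous_in_mult.
assert (Hsc : forall k, Ccontinuous_in (fun t => c k * p k t * h t)%C A B).
  intros k; apply Ccontinuous_in_mult; [|exact Hh].
  intros t Ht; apply Ccontinuous_mult; [apply Ccontinuous_const|now apply Hp].
induction n as [|n IH]; simpl; [apply Hs|].
apply (improper_ext (fun t => Csum (fun k => c k * p k t) n * h t
   + c (S n) * p (S n) t * h t)%C); [exact HAB|intros t _; ring|].
apply improper_plus; auto; now apply Ccontinuous_in_mult.
Qed.

(** * Term-by-term integration of power series *)

Lemma is_derive_power e t : is_derive (fun t => t ^ e) t (INR e * t ^ (pred e)).
Proof. auto_derive; [trivial|ring]. Qed.

Lemma continuous_power e t : continuous (fun t => t ^ e) t.
Proof.
apply (ex_derive_continuous (V := R_NormedModule)); eexists; apply is_derive_power.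
Qed.

Lemma pow_01 t n : 0 <= t <= 1 -> 0 <= t ^ n <= 1.
Proof.
intros H; split; [apply pow_le; lra|].
rewrite <- (pow1 n); apply pow_incr; lra.
Qed.

(** On (0, 1) the weighted sum dominates both the polynomial and its derivative, so
    [sigma t = V * t] works. The exponents are left free because the binomial series uses [k] and
    the exponential kernel [N * k]. *)
Lemma polynomial_multiplier (c : nat -> C) (e : nat -> nat) (V : R) n :
  sum_n (fun k => (INR (e k) + 1) * Cmod (c k)) n <= V ->
  multiplier (fun t => Csum (fun k => c k * RtoC (t ^ e k))%C n) 0 1 V.
Proof.
intros HV.
exists (fun t => Csum (fun k => c k * RtoC (INR (e k) * t ^ (pred (e k))))%C n).
exists (fun t => V * t), (fun _ => V).
assert (V0 : 0 <= V).
  eapply Rle_trans; [|exact HV].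
  assert (G : forall n, 0 <= sum_n (fun k => (INR (e k) + 1) * Cmod (c k)) n).
    intros j; induction j as [|j IH]; [rewrite sum_O|rewrite sum_Sn; apply Rplus_le_le_0_compat; [exact IH|]];
      apply Rmult_le_pos; try apply Cmod_ge_0;
      match goal with |- 0 <= INR ?x + 1 => generalize (pos_INR x); lra end.
  apply G.
split; [|split; [|split; [|split; [|split; [|split]]]]].
- intros t _; clear HV; induction n as [|n IH]; simpl.
    apply is_Cderive_scal, is_Cderive_RtoC, is_derive_power.
  apply is_Cderive_plus; [exact IH|].
  apply is_Cderive_scal, is_Cderive_RtoC, is_derive_power.
- intros t _; clear HV.
  assert (X : forall k, Ccontinuous (fun t => c k * RtoC (INR (e k) * t ^ (pred (e k))))%C t).
    intros k; apply Ccontinuous_mult; [apply Ccontinuous_const|].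
    apply Ccontinuous_RtoC, (continuous_scal_r (V := R_NormedModule)), continuous_power.
  induction n as [|n IH]; simpl; [apply X|].
  apply Ccontinuous_plus; [exact IH|apply X].
- intros t _; auto_derive; [trivial|ring].
- intros t _; apply continuous_const.
- intros t Ht; eapply Rle_trans; [apply Csum_Cmod|]; eapply Rle_trans; [|exact HV].
  apply sum_n_le_R; intros k _; rewrite Cmod_mult, Cmod_R, Rmult_comm.
  apply Rmult_le_compat_r; [apply Cmod_ge_0|].
  assert (P := pow_01 t (pred (e k)) ltac:(lra)); assert (Q := pos_INR (e k)).
  rewrite Rabs_pos_eq by (apply Rmult_le_pos; lra); nra.
- intros t Ht; eapply Rle_trans; [apply Csum_Cmod|]; eapply Rle_trans; [|exact HV].
  apply sum_n_le_R; intros k _; rewrite Cmod_mult, Cmod_R, Rmult_comm.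
  apply Rmult_le_compat_r; [apply Cmod_ge_0|].
  assert (P := pow_01 t (e k) ltac:(lra)); assert (Q := pos_INR (e k)).
  rewrite Rabs_pos_eq by lra; lra.
- intros t Ht; rewrite Rabs_pos_eq; nra.
Qed.

(** The weighted bound makes all partial sums multipliers with the same [V], so [multiplier_limit]
    applies to them. Convergence of the series of moments is part of the conclusion. *)
Lemma moment_series (h phi : R -> C) (c : nat -> C) (e : nat -> nat) (m : nat -> C) V m0 :
  Ccontinuous_in h 0 1 -> improper h 0 1 m0 ->
  (forall k, improper (fun t => RtoC (t ^ e k) * h t)%C 0 1 (m k)) ->
  (forall n, sum_n (fun k => (INR (e k) + 1) * Cmod (c k)) n <= V) ->
  Ccontinuous_in phi 0 1 ->
  uniform_limit eventually (fun n t => Csum (fun k => c k * RtoC (t ^ e k))%C n) phi 0 1 ->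
  exists J, improper (fun t => phi t * h t)%C 0 1 J /\ Csum_lim (fun k => c k * m k)%C J.
Proof.
intros Hh H0 Hm HV Hphi HU.
destruct (multiplier_limit eventually _ phi h 0 1 V m0 ltac:(lra) Hh H0 Hphi
  ltac:(exists 0%nat; intros n _; apply polynomial_multiplier, HV) HU) as [J [HJ L]].
exists J; split; [exact HJ|]; intros eps He.
generalize (L eps He); apply filter_imp; intros n Hn; apply Hn.
apply improper_Csum; auto; try lra.
intros k t Ht; apply Ccontinuous_RtoC, continuous_power.
Qed.

(** * Splitting an improper integral at an interior point *)

Lemma Ccontinuous_in_sub f A B A' B' : Ccontinuous_in f A B -> A <= A' -> B' <= B ->
  Ccontinuous_in f A' B'.
Proof. intros H HA HB t Ht; apply H; lra. Qed.

Lemma Cmod_small (z w : C) K : (forall eps, 0 < eps -> Cmod (z - w) <= K * eps) -> z = w.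
Proof.
intros H.
assert (Z : Cmod (z - w) = 0).
  apply Rle_antisym; [|apply Cmod_ge_0].
  apply le_epsilon; intros e He; rewrite Rplus_0_l.
  destruct (Rle_dec K 0) as [HK|HK].
    assert (X := H 1 ltac:(lra)); assert (Y := Cmod_ge_0 (z - w)); lra.
  replace e with (K * (e / K)) by (field; lra); apply H, Rdiv_lt_0_compat; lra.
apply Cmod_eq_0 in Z; replace z with (z - w + w)%C by ring; rewrite Z; ring.
Qed.

(** Since [h] is bounded near [c], integrals over short segments there are small; this supplies the
    tails at the new end [c], while the outer tails are those of [h]. *)
Lemma improper_split (h : R -> C) A c B l : A < c < B -> Ccontinuous_in h A B ->
  improper h A B l ->
  exists l1 l2, improper h A c l1 /\ improper h c B l2 /\ l = (l1 + l2)%C.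
Proof.
intros Hc Hh Hl.
set (u := Rmin ((c - A) / 2) ((B - c) / 2)).
assert (U1 : u <= (c - A) / 2) by apply Rmin_l.
assert (U2 : u <= (B - c) / 2) by apply Rmin_r.
assert (U0 : 0 < u) by (apply Rmin_pos; lra).
destruct (Cmod_bounded h (c - u) (c + u)) as [K [HK0 HK]].
  lra. apply (Ccontinuous_in_on _ A B); auto; lra.
assert (N : forall a b, c - u <= a <= b -> b <= c + u -> Cmod (CRInt h a b) <= K * (b - a)).
  intros a b Ha Hb; apply CRInt_bound_const; [lra| |].
    apply (Ccontinuous_in_on _ A B); auto; lra.
  intros t Ht; apply HK; lra.
assert (C1 : Ccontinuous_in h A c) by (apply (Ccontinuous_in_sub h A B); auto; lra).
assert (C2 : Ccontinuous_in h c B) by (apply (Ccontinuous_in_sub h A B); auto; lra).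
assert (T : forall eps, 0 < eps -> exists d, 0 < d <= u /\ K * d <= eps /\
    d < (c - A) / 2 /\ d < (B - c) / 2 /\ d < (B - A) / 2 /\
    small_tails h A B d eps /\ small_tails h A c d eps /\ small_tails h c B d eps).
  intros eps He.
  destruct (improper_tails h A B l eps ltac:(lra) Hh Hl He) as [d [Hd [T1 T2]]].
  set (d' := Rmin d (Rmin (u / 2) (eps / K))).
  assert (M1 : d' <= d) by apply Rmin_l.
  assert (M2 : d' <= u / 2) by (eapply Rle_trans; [apply Rmin_r|apply Rmin_l]).
  assert (M3 : d' <= eps / K) by (eapply Rle_trans; [apply Rmin_r|apply Rmin_r]).
  assert (M0 : 0 < d').
    repeat apply Rmin_pos; try lra; now apply Rdiv_lt_0_compat.
  assert (M4 : K * d' <= eps).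
    replace eps with (K * (eps / K)) by (field; lra); apply Rmult_le_compat_l; lra.
  assert (Q : forall a b, c - d' < a <= b -> b < c + d' -> b - a <= d' ->
      Cmod (CRInt h a b) <= eps).
    intros a b Ha Hb Hab; apply Rle_trans with (K * (b - a)); [apply N; lra|].
    apply Rle_trans with (K * d'); [apply Rmult_le_compat_l|]; lra.
  exists d'; split; [lra|]; split; [exact M4|].
  split; [lra|]; split; [lra|]; split; [lra|].
  split; [|split]; split; intros a b Ha Hb;
    try (apply T1; lra); try (apply T2; lra); apply Q; lra.
destruct (improper_exists h A c ltac:(lra) C1) as [l1 L1].
  intros eps He; destruct (T eps He) as [d X]; exists d; split; [lra|tauto].
destruct (improper_exists h c B ltac:(lra) C2) as [l2 L2].
  intros eps He; destruct (T eps He) as [d X]; exists d; split; [lra|tauto].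
exists l1, l2; split; [exact L1|]; split; [exact L2|].
(* Three truncations cost [2 * eps] each and the gap around [c] at most [K * d <= eps]; 8 exceeds
   the total 7. *)
apply (Cmod_small _ _ 8); intros eps He.
destruct (T eps He) as [d [D1 [D2 [D3 [D4 [D5 [T0 [T1 T2]]]]]]]].
assert (X0 := tails_limit h A B l d eps (A + d / 2) (B - d / 2) ltac:(lra) Hh Hl
  ltac:(lra) T0 ltac:(lra) ltac:(lra)).
assert (X1 := tails_limit h A c l1 d eps (A + d / 2) (c - d / 2) ltac:(lra) C1 L1
  ltac:(lra) T1 ltac:(lra) ltac:(lra)).
assert (X2 := tails_limit h c B l2 d eps (c + d / 2) (B - d / 2) ltac:(lra) C2 L2
  ltac:(lra) T2 ltac:(lra) ltac:(lra)).
assert (X3 := N (c - d / 2) (c + d / 2) ltac:(lra) ltac:(lra)).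
assert (E : CRInt h (A + d / 2) (B - d / 2) = (CRInt h (A + d / 2) (c - d / 2)
    + (CRInt h (c - d / 2) (c + d / 2) + CRInt h (c + d / 2) (B - d / 2)))%C).
  rewrite (CRInt_Chasles h (c - d / 2)), CRInt_Chasles; [reflexivity|lra| |lra|];
    apply (Ccontinuous_in_on _ A B); auto; lra.
set (I := CRInt h (A + d / 2) (B - d / 2)) in *.
set (I1 := CRInt h (A + d / 2) (c - d / 2)) in *.
set (I2 := CRInt h (c + d / 2) (B - d / 2)) in *.
set (I3 := CRInt h (c - d / 2) (c + d / 2)) in *.
replace (l - (l1 + l2))%C with (- (I - l) + ((I1 - l1) + ((I2 - l2) + I3)))%C
  by (rewrite E; ring).
replace (c + d / 2 - (c - d / 2)) with d in X3 by field.
eapply Rle_trans; [apply Cmod_triangle|]; rewrite Cmod_opp.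
eapply Rle_trans; [apply Rplus_le_compat_l, Cmod_triangle|].
eapply Rle_trans; [apply Rplus_le_compat_l, Rplus_le_compat_l, Cmod_triangle|].
lra.
Qed.

Lemma improper_compact (h : R -> C) A B a b : A < a -> a < b -> b < B ->
  Ccontinuous_in h A B -> improper h a b (CRInt h a b).
Proof.
intros Ha Hab Hb Hh eps He.
assert (Hc : forall x y, a <= x -> y <= b -> Ccontinuous_on h x y)
  by (intros; apply (Ccontinuous_in_on _ A B); auto; lra).
destruct (Cmod_bounded h a b ltac:(lra)) as [K [HK0 HK]]; [apply Hc; lra|].
set (d := Rmin ((b - a) / 2) (eps / (3 * K))).
assert (M1 : d <= (b - a) / 2) by apply Rmin_l.
assert (M2 : d <= eps / (3 * K)) by apply Rmin_r.
assert (M0 : 0 < d) by (apply Rmin_pos; [lra|apply Rdiv_lt_0_compat; lra]).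
assert (M3 : 3 * (K * d) <= eps).
  replace eps with (3 * (K * (eps / (3 * K)))) by (field; lra).
  apply Rmult_le_compat_l; [lra|]; apply Rmult_le_compat_l; lra.
exists d; split; [exact M0|]; intros x y Hx Hy.
assert (N : forall u v, a <= u -> u <= v -> v <= b -> v - u <= d -> Cmod (CRInt h u v) <= K * d).
  intros u v Hu Huv Hv Hd; apply Rle_trans with (K * (v - u)).
    apply CRInt_bound_const; [lra|apply Hc; lra|intros; apply HK; lra].
  apply Rmult_le_compat_l; lra.
rewrite <- (CRInt_Chasles h a x b), <- (CRInt_Chasles h x y b) by (try apply Hc; lra).
replace (_ - _)%C with (- (CRInt h a x + CRInt h y b))%C by ring.
rewrite Cmod_opp; eapply Rle_lt_trans; [apply Cmod_triangle|].
assert (X := N a x ltac:(lra) ltac:(lra) ltac:(lra) ltac:(lra)).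
assert (Y := N y b ltac:(lra) ltac:(lra) ltac:(lra) ltac:(lra)).
assert (0 < K * d) by (apply Rmult_lt_0_compat; lra); lra.
Qed.

Lemma exp_le_compat x y : x <= y -> exp x <= exp y.
Proof. intros [H| ->]; [apply Rlt_le; now apply exp_increasing|lra]. Qed.

(** * Functions with geometrically decaying moments *)

Definition exp_term (x : R) (k : nat) : R := x ^ k / INR (fact k).

Lemma is_series_exp x : is_series (exp_term x) (exp x).
Proof.
generalize (is_exp_Reals x); apply is_series_ext.
intros n; unfold exp_term; rewrite pow_n_pow; unfold scal; simpl; unfold mult; simpl.
field; apply INR_fact_neq_0.
Qed.

Lemma is_lim_partial_sums (a : nat -> R) l : is_series a l -> is_lim_seq (sum_n a) l.
Proof. exact (fun H => H). Qed.

Lemma exp_term_pos x k : 0 <= x -> 0 <= exp_term x k.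
Proof.
intros Hx; apply Rmult_le_pos; [now apply pow_le|].
apply Rlt_le, Rinv_0_lt_compat, INR_fact_lt_0.
Qed.

Lemma exp_partial_le x n : 0 <= x -> sum_n (exp_term x) n <= exp x.
Proof.
intros Hx.
apply (is_lim_seq_incr_compare (sum_n (exp_term x))).
  apply is_series_exp.
intros k; rewrite sum_Sn; unfold plus; simpl.
generalize (exp_term_pos x (S k) Hx); lra.
Qed.

(** The remainder at [- u] is dominated term by term by the remainder at [U], hence uniformly in
    [u]; the comparison is made on finite sections and passed to the limit. *)
Lemma exp_partial_opp u U n : 0 <= u <= U ->
  Rabs (sum_n (exp_term (- u)) n - exp (- u)) <= exp U - sum_n (exp_term U) n.
Proof.
intros Hu.
assert (P : forall k, Rabs (sum_n (exp_term (- u)) n - sum_n (exp_term (- u)) (n + k))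
    <= sum_n (exp_term U) (n + k) - sum_n (exp_term U) n).
  induction k as [|k IH].
    rewrite Nat.add_0_r, !Rminus_diag, Rabs_R0; lra.
  rewrite Nat.add_succ_r, !sum_Sn; unfold plus; simpl.
  assert (Q : Rabs (exp_term (- u) (S (n + k))) <= exp_term U (S (n + k))).
    unfold exp_term, Rdiv; rewrite Rabs_mult, <- RPow_abs, Rabs_Ropp, (Rabs_pos_eq u) by lra.
    rewrite (Rabs_pos_eq (/ _)) by (apply Rlt_le, Rinv_0_lt_compat, INR_fact_lt_0).
    apply Rmult_le_compat_r; [apply Rlt_le, Rinv_0_lt_compat, INR_fact_lt_0|].
    now apply pow_incr.
  set (x := sum_n (exp_term (- u)) n) in *; set (y := sum_n (exp_term (- u)) (n + k)) in *.
  replace (x - (y + exp_term (- u) (S (n + k))))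
    with ((x - y) + - exp_term (- u) (S (n + k))) by ring.
  eapply Rle_trans; [apply Rabs_triang|]; rewrite Rabs_Ropp; lra.
assert (L1 := is_lim_partial_sums _ _ (is_series_exp (- u))).
assert (L2 := is_lim_partial_sums _ _ (is_series_exp U)).
apply (is_lim_seq_incr_n _ n) in L1; apply (is_lim_seq_incr_n _ n) in L2.
assert (L3 := is_lim_seq_abs _ _ (is_lim_seq_minus' _ _ _ _
  (is_lim_seq_const (sum_n (exp_term (- u)) n)) L1)).
assert (L4 := is_lim_seq_minus' _ _ _ _ L2 (is_lim_seq_const (sum_n (exp_term U) n))).
refine (is_lim_seq_le _ _ _ _ _ L3 L4).
intros k; rewrite (Nat.add_comm k n); apply P.
Qed.

Lemma succ_le_pow2 k : INR k + 1 <= 2 ^ k.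
Proof.
induction k as [|k IH]; [simpl; lra|].
rewrite S_INR; simpl; generalize (pos_INR k); lra.
Qed.

Lemma eventually_pow_small q eps : 0 <= q < 1 -> 0 < eps -> eventually (fun n => q ^ n <= eps).
Proof.
intros Hq He; destruct (pow_lt_1_zero q ltac:(rewrite Rabs_pos_eq; lra) eps He) as [n0 H].
exists n0; intros n Hn; generalize (H n Hn); rewrite Rabs_pos_eq by (apply pow_le; lra); lra.
Qed.

Section ExponentialKernel.

Variable a : R.
Hypothesis Ha : 0 < a.

(** A smooth decreasing cut-off at [a], steeper as [N] grows. It is a power series in t^N, so only
    the moments of orders [N * k] enter its integral against [h]. *)
Definition kernel (N : nat) (t : R) : C := RtoC (exp (- (t / a) ^ N)).

Lemma kernel_derive N t :
  is_derive (fun t => exp (- (t / a) ^ N)) t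
    (- (INR N * (t / a) ^ pred N / a * exp (- (t / a) ^ N))).
Proof. auto_derive; [trivial|]. unfold Rdiv; ring. Qed.

Lemma kernel_dcontinuous N t :
  continuous (fun t => - (INR N * (t / a) ^ pred N / a * exp (- (t / a) ^ N))) t.
Proof.
apply (ex_derive_continuous (V := R_NormedModule)); auto_derive; lra.
Qed.

(** A monotone function with values in [0, 1] measures its own variation: [sigma] is its opposite,
    and the constant 1 is the same for all [N]. *)
Lemma kernel_multiplier N A B : 0 <= A -> multiplier (kernel N) A B 1.
Proof.
intros HA.
set (d := fun t => - (INR N * (t / a) ^ pred N / a * exp (- (t / a) ^ N))).
exists (fun t => RtoC (d t)), (fun t => - exp (- (t / a) ^ N)), (fun t => - d t).
assert (Hq : forall t n, A < t -> 0 <= (t / a) ^ n).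
  intros t n Ht; apply pow_le, Rlt_le, Rdiv_lt_0_compat; lra.
assert (He : forall t, A < t -> 0 < exp (- (t / a) ^ N) <= 1).
  intros t Ht; split; [apply exp_pos|].
  rewrite <- exp_0; apply exp_le_compat; generalize (Hq t N Ht); lra.
split; [|split; [|split; [|split; [|split; [|split]]]]]; intros t Ht.
- apply is_Cderive_RtoC, kernel_derive.
- apply Ccontinuous_RtoC, kernel_dcontinuous.
- apply (is_derive_opp (V := R_NormedModule)), kernel_derive.
- apply (continuous_opp (V := R_NormedModule)), kernel_dcontinuous.
- rewrite Cmod_R, <- Rabs_Ropp, Rabs_pos_eq; [lra|].
  unfold d; rewrite Ropp_involutive; apply Rmult_le_pos; [|apply Rlt_le, exp_pos].
  apply Rmult_le_pos; [|apply Rlt_le, Rinv_0_lt_compat; lra].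
  apply Rmult_le_pos; [apply pos_INR|apply Hq; lra].
- unfold kernel; rewrite Cmod_R, Rabs_pos_eq; generalize (He t ltac:(lra)); lra.
- rewrite Rabs_Ropp, Rabs_pos_eq; generalize (He t ltac:(lra)); lra.
Qed.

Lemma kernel_limit_below : uniform_limit eventually kernel (fun _ => 1%C) 0 a.
Proof.
intros x y eps Hx Hxy Hy He.
assert (Hq : 0 <= y / a < 1).
  split; [apply Rlt_le, Rdiv_lt_0_compat; lra|].
  apply (Rmult_lt_reg_r a); [lra|]; field_simplify; lra.
generalize (eventually_pow_small _ _ Hq He); apply filter_imp; intros n Hn t Ht.
unfold kernel; rewrite <- RtoC_minus, Cmod_R.
assert (H0 : 0 <= (t / a) ^ n) by (apply pow_le, Rlt_le, Rdiv_lt_0_compat; lra).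
assert (H1 : (t / a) ^ n <= (y / a) ^ n).
  apply pow_incr; split; [apply Rlt_le, Rdiv_lt_0_compat; lra|].
  apply Rmult_le_compat_r; [apply Rlt_le, Rinv_0_lt_compat|]; lra.
assert (H2 := exp_ineq1_le (- (t / a) ^ n)).
assert (H3 : exp (- (t / a) ^ n) <= 1) by (rewrite <- exp_0; apply exp_le_compat; lra).
apply Rabs_le; lra.
Qed.

Lemma kernel_limit_above B : uniform_limit eventually kernel (fun _ => 0%C) a B.
Proof.
intros x y eps Hx Hxy Hy He.
assert (Hq : 0 <= a / x < 1).
  split; [apply Rlt_le, Rdiv_lt_0_compat; lra|].
  apply (Rmult_lt_reg_r x); [lra|]; field_simplify; lra.
generalize (eventually_pow_small _ _ Hq He); apply filter_imp; intros n Hn t Ht.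
unfold kernel; rewrite <- RtoC_minus, Cmod_R, Rminus_0_r.
rewrite Rabs_pos_eq by (apply Rlt_le, exp_pos).
eapply Rle_trans; [|exact Hn].
assert (H0 : 0 < (x / a) ^ n) by (apply pow_lt, Rdiv_lt_0_compat; lra).
assert (H1 : (x / a) ^ n <= (t / a) ^ n).
  apply pow_incr; split; [apply Rlt_le, Rdiv_lt_0_compat; lra|].
  apply Rmult_le_compat_r; [apply Rlt_le, Rinv_0_lt_compat|]; lra.
rewrite exp_Ropp.
replace (a / x) with (/ (x / a)) by (field; lra); rewrite pow_inv.
apply Rinv_le_contravar; [exact H0|].
generalize (exp_ineq1_le ((t / a) ^ n)); lra.
Qed.

(** Expanding the exponential, the term of index k contributes at most K (r / a)^(N k) / k!; the
    index 0 gives [m O], and the others sum up to the bound. *)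
Lemma kernel_moments (h : R -> C) (m : nat -> C) r K N : 0 <= r < a -> a <= 1 ->
  Ccontinuous_in h 0 1 -> (forall n, improper (fun t => RtoC (t ^ n) * h t)%C 0 1 (m n)) ->
  (forall n, Cmod (m n) <= K * r ^ n) ->
  exists J, improper (fun t => kernel N t * h t)%C 0 1 J /\
    Cmod (J - m O) <= K * (exp ((r / a) ^ N) - 1).
Proof.
intros Hr Ha1 Hh Hm HK.
set (U := / a ^ N).
assert (HU : 0 < U) by (apply Rinv_0_lt_compat, pow_lt, Ha).
set (c := fun k => RtoC (exp_term (- U) k)).
set (e := fun k => (N * k)%nat).
assert (HcU : forall k, Cmod (c k) = exp_term U k).
  intros k; unfold c, exp_term, Rdiv; rewrite Cmod_R, Rabs_mult, <- RPow_abs, Rabs_Ropp.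
  rewrite (Rabs_pos_eq U), (Rabs_pos_eq (/ _)); [reflexivity| |lra].
  apply Rlt_le, Rinv_0_lt_compat, INR_fact_lt_0.
assert (Ht : forall t k, (c k * RtoC (t ^ e k))%C = RtoC (exp_term (- (t / a) ^ N) k)).
  intros t k; unfold c, e; rewrite <- RtoC_mult; f_equal.
  unfold exp_term, Rdiv; rewrite Rpow_mult_distr, pow_inv, pow_mult; fold U.
  replace (- (t ^ N * U)) with (t ^ N * - U) by ring; rewrite Rpow_mult_distr; ring.
assert (M0 : improper h 0 1 (m O)).
  apply (improper_ext (fun t => RtoC (t ^ 0) * h t)%C); [lra| |apply Hm].
  intros t _; simpl; ring.
(* The constant comes from N k + 1 <= (N + 1) 2^k. It depends on [N], which is harmless because [N]
   is fixed here. *)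
destruct (moment_series h (kernel N) c e (fun k => m (e k)) ((INR N + 1) * exp (2 * U)) (m O))
  as [J [HJ HS]]; auto.
- intros n.
  apply Rle_trans with ((INR N + 1) * sum_n (exp_term (2 * U)) n).
    rewrite <- (sum_n_mult_l (K := R_Ring)); apply sum_n_le_R; intros k _.
    change (mult (INR N + 1) (exp_term (2 * U) k)) with ((INR N + 1) * exp_term (2 * U) k).
    rewrite HcU; unfold e, exp_term, Rdiv; rewrite Rpow_mult_distr, mult_INR.
    assert (P := succ_le_pow2 k); assert (P0 := pos_INR k); assert (PN := pos_INR N).
    rewrite !(Rmult_assoc (2 ^ k)), <- (Rmult_assoc (INR N + 1)).
    apply Rmult_le_compat_r; [apply (exp_term_pos U); lra|].
    assert (INR N * (INR k + 1) <= INR N * 2 ^ k) by (apply Rmult_le_compat_l; lra).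
    lra.
  apply Rmult_le_compat_l; [generalize (pos_INR N); lra|].
  apply exp_partial_le; lra.
- apply (multiplier_continuous _ _ _ 1), kernel_multiplier; lra.
- intros x y eps Hx Hxy Hy He.
  assert (L := is_lim_partial_sums _ _ (is_series_exp U)).
  generalize (L _ (locally_ball _ (mkposreal _ He))); unfold filtermap.
  apply filter_imp; intros n Hn t Htt.
  rewrite (Csum_ext _ (fun k => RtoC (exp_term (- (t / a) ^ N) k))) by (intros; apply Ht).
  rewrite Csum_RtoC; unfold kernel; rewrite <- RtoC_minus, Cmod_R.
  change (Rabs (sum_n (exp_term U) n - exp U) < eps) in Hn; apply Rabs_def2 in Hn.
  eapply Rle_trans; [apply (exp_partial_opp _ U)|lra].
  split; [apply pow_le, Rlt_le, Rdiv_lt_0_compat; lra|].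
  unfold U; rewrite <- pow_inv; apply pow_incr.
  split; [apply Rlt_le, Rdiv_lt_0_compat; lra|].
  rewrite <- (Rmult_1_l (/ a)); apply Rmult_le_compat_r; [apply Rlt_le, Rinv_0_lt_compat|]; lra.
exists J; split; [exact HJ|].
assert (Q0 : 0 <= (r / a) ^ N).
  apply pow_le, Rmult_le_pos; [|apply Rlt_le, Rinv_0_lt_compat]; lra.
assert (B : forall n, Cmod (Csum (fun k => c k * m (e k))%C n - m O)
    <= K * (sum_n (exp_term ((r / a) ^ N)) n - 1)).
  induction n as [|n IH].
    simpl Csum; rewrite sum_O; unfold c, e, exp_term; rewrite Nat.mul_0_r; simpl.
    replace (RtoC (1 / 1) * m 0%nat - m 0%nat)%C with (RtoC 0)
      by (replace (1 / 1) with 1 by field; ring).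
    rewrite Cmod_0; lra.
  simpl Csum; rewrite sum_Sn; unfold plus; simpl.
  replace (Csum (fun k => c k * m (e k)) n + c (S n) * m (e (S n)) - m O)%C
    with ((Csum (fun k => c k * m (e k)) n - m O) + c (S n) * m (e (S n)))%C by ring.
  eapply Rle_trans; [apply Cmod_triangle|].
  assert (X : Cmod (c (S n) * m (e (S n))) <= K * exp_term ((r / a) ^ N) (S n)).
    rewrite Cmod_mult, HcU.
    apply Rle_trans with (exp_term U (S n) * (K * r ^ e (S n))).
      apply Rmult_le_compat_l; [apply exp_term_pos; lra|apply HK].
    right; unfold exp_term, e, Rdiv; rewrite (Rpow_mult_distr r (/ a) N), pow_inv; fold U.
    rewrite (Rpow_mult_distr (r ^ N)), pow_mult; ring.
  lra.
assert (K0 : 0 <= K).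
  generalize (HK O) (Cmod_ge_0 (m O)); simpl; lra.
apply le_epsilon; intros eps He.
destruct (HS eps He) as [n Hn]; specialize (Hn n (le_n n)).
replace (J - m O)%C with (- (Csum (fun k => c k * m (e k)) n - J)
  + (Csum (fun k => c k * m (e k)) n - m O))%C by ring.
eapply Rle_trans; [apply Cmod_triangle|]; rewrite Cmod_opp.
assert (Y := exp_partial_le ((r / a) ^ N) n Q0); specialize (B n).
assert (K * (sum_n (exp_term ((r / a) ^ N)) n - 1) <= K * (exp ((r / a) ^ N) - 1))
  by (apply Rmult_le_compat_l; lra).
lra.
Qed.

End ExponentialKernel.

(* Lerch's argument: against the kernel [exp (- (t / a) ^ N)], which tends to the
   indicator function of [(0, a)], all the moments but the one of order 0 are
   negligible. *)
Lemma decaying_moments (h : R -> C) (m : nat -> C) r K : 0 <= r < 1 ->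
  Ccontinuous_in h 0 1 -> (forall n, improper (fun t => RtoC (t ^ n) * h t)%C 0 1 (m n)) ->
  (forall n, Cmod (m n) <= K * r ^ n) ->
  forall t, r < t < 1 -> h t = 0%C.
Proof.
intros Hr Hh Hm HK.
assert (K0 : 0 <= K).
  generalize (HK O) (Cmod_ge_0 (m O)); simpl; lra.
assert (M0 : improper h 0 1 (m O)).
  apply (improper_ext (fun t => RtoC (t ^ 0) * h t)%C); [lra| |apply Hm].
  intros t _; simpl; ring.
(* It is enough that the integral over (0, a) already equals the moment [m O]. *)
assert (Z : forall a, r < a < 1 -> improper h a 1 0).
  intros a Har.
  destruct (improper_split h 0 a 1 (m O) ltac:(lra) Hh M0) as [l1 [l2 [L1 [L2 E]]]].
  assert (C1 : Ccontinuous_in h 0 a) by (apply (Ccontinuous_in_sub h 0 1); auto; lra).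
  assert (C2 : Ccontinuous_in h a 1) by (apply (Ccontinuous_in_sub h 0 1); auto; lra).
  destruct (multiplier_limit eventually (kernel a) (fun _ => 1%C) h 0 a 1 l1)
    as [J1 [HJ1 S1]]; auto; try lra.
    intros t _; apply Ccontinuous_const.
    exists O; intros n _; apply kernel_multiplier; lra.
    apply kernel_limit_below; lra.
  destruct (multiplier_limit eventually (kernel a) (fun _ => 0%C) h a 1 1 l2)
    as [J2 [HJ2 S2]]; auto; try lra.
    intros t _; apply Ccontinuous_const.
    exists O; intros n _; apply kernel_multiplier; lra.
    apply kernel_limit_above; lra.
  assert (E1 : J1 = l1).
    apply (improper_unique h 0 a); [|exact L1].
    apply (improper_ext (fun t => 1 * h t)%C); auto; [lra|intros; ring].
  assert (E2 : J2 = 0%C).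
    replace (RtoC 0) with (0 * l2)%C by ring.
    apply (improper_unique (fun t => 0 * h t)%C a 1); [exact HJ2|].
    apply improper_scal; auto; lra.
  subst J1 J2.
  (* The integral of [h] against the kernel tends to [m O] by [kernel_moments], and to [l1] when it
     is split at [a]. *)
  assert (E3 : m O = l1).
    apply (Cmod_small _ _ 3); intros eps He.
    assert (Hq : 0 <= r / a < 1).
      split; [apply Rmult_le_pos; [|apply Rlt_le, Rinv_0_lt_compat]; lra|].
      apply (Rmult_lt_reg_r a); [lra|]; field_simplify; lra.
    (* The 3 comes from exp x - 1 <= 3 x on [0, 1]; the added 1 keeps the denominator positive when
       [K] is 0. *)
    assert (He' : 0 < Rmin 1 (eps / (3 * K + 1))).
      apply Rmin_pos; [lra|]; apply Rdiv_lt_0_compat; lra.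
    destruct (filter_ex _ (filter_and _ _ (eventually_pow_small _ _ Hq He')
      (filter_and _ _ (S1 eps He) (S2 eps He)))) as [N [P1 [P2 P3]]].
    assert (P4 : (r / a) ^ N <= 1) by (eapply Rle_trans; [exact P1|apply Rmin_l]).
    assert (P5 : (r / a) ^ N <= eps / (3 * K + 1)) by (eapply Rle_trans; [exact P1|apply Rmin_r]).
    assert (P6 : 0 <= (r / a) ^ N) by (apply pow_le; lra).
    destruct (kernel_moments a ltac:(lra) h m r K N ltac:(lra) ltac:(lra) Hh Hm HK)
      as [J [HJ BJ]].
    assert (CJ : Ccontinuous_in (fun t => kernel a N t * h t)%C 0 1).
      apply Ccontinuous_in_mult; [|exact Hh].
      apply (multiplier_continuous _ _ _ 1), kernel_multiplier; lra.
    destruct (improper_split _ 0 a 1 J ltac:(lra) CJ HJ) as [j1 [j2 [Q1 [Q2 EJ]]]].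
    specialize (P2 _ Q1); specialize (P3 _ Q2).
    assert (Q3 : exp ((r / a) ^ N) - 1 <= 3 * (r / a) ^ N).
      assert (X := exp_bound2 ((r / a) ^ N) ltac:(rewrite Rabs_pos_eq; lra)).
      apply Rabs_le_between in X; nra.
    assert (Q4 : K * (exp ((r / a) ^ N) - 1) <= eps).
      apply Rle_trans with (K * (3 * (eps / (3 * K + 1)))).
        apply Rmult_le_compat_l; lra.
      apply Rle_trans with ((3 * K + 1) * (eps / (3 * K + 1))); [|right; field; lra].
      replace (K * (3 * (eps / (3 * K + 1)))) with (3 * K * (eps / (3 * K + 1))) by ring.
      apply Rmult_le_compat_r; lra.
    replace (m O - l1)%C with (- (J - m O) + ((j1 - l1) + (j2 - 0)))%C by (rewrite EJ; ring).
    eapply Rle_trans; [apply Cmod_triangle|]; rewrite Cmod_opp.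
    eapply Rle_trans; [apply Rplus_le_compat_l, Cmod_triangle|]; lra.
  replace (RtoC 0) with l2; [exact L2|].
  replace l2 with (l1 + l2 - l1)%C by ring; rewrite <- E, E3; ring.
assert (I0 : forall a b, r < a < b -> b < 1 -> CRInt h a b = 0%C).
  intros a b Hab Hb.
  assert (Ca : Ccontinuous_in h a 1) by (apply (Ccontinuous_in_sub h 0 1); auto; lra).
  destruct (improper_split h a b 1 0 ltac:(lra) Ca (Z a ltac:(lra))) as [l1 [l2 [L1 [L2 E]]]].
  rewrite (improper_unique _ _ _ _ _ L2 (Z b ltac:(lra))), Cplus_0_r in E.
  rewrite <- (improper_unique _ _ _ _ _ L1
    (improper_compact h 0 1 a b ltac:(lra) ltac:(lra) ltac:(lra) Hh)); auto.
(* The integrals over all segments inside (r, 1) vanish; differentiating in the upper end gives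
   [h t]. *)
intros t Ht.
set (a := (r + t) / 2).
assert (D := CRInt_derive h 0 1 a t Hh ltac:(unfold a; lra) ltac:(lra)).
assert (D0 : is_Cderive (fun t => CRInt h a t) t (RtoC 0)).
  apply (is_derive_ext_loc (V := C_R_NormedModule) (fun _ => RtoC 0)).
    assert (L : locally t (fun y => a < y < 1)).
      apply filter_and; [apply (open_gt a)|apply (open_lt 1)]; unfold a; lra.
    revert L; apply filter_imp; intros y Hy; symmetry; apply I0; unfold a in *; lra.
  apply is_Cderive_const.
assert (U1 := is_derive_unique _ _ _ (is_Cderive_Re _ _ _ D)).
assert (U2 := is_derive_unique _ _ _ (is_Cderive_Im _ _ _ D)).
assert (V1 := is_derive_unique _ _ _ (is_Cderive_Re _ _ _ D0)).
assert (V2 := is_derive_unique _ _ _ (is_Cderive_Im _ _ _ D0)).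
apply C_ext; congruence.
Qed.

(** * Principal powers *)

Lemma Cmod_sqr (w : C) : Cmod w * Cmod w = Re w * Re w + Im w * Im w.
Proof. generalize (Cmod2_alt w); simpl; lra. Qed.

Lemma Re_div_Cmod (w : C) : w <> 0 -> -1 <= Re w / Cmod w <= 1.
Proof.
intros Hw; apply Cmod_gt_0 in Hw.
assert (H := Re_le_Cmod w); apply Rabs_le_between in H.
split; apply (Rmult_le_reg_r (Cmod w)); try lra; field_simplify; lra.
Qed.

Lemma sqrt_Re_div_Cmod (w : C) : w <> 0 -> sqrt (1 - (Re w / Cmod w)²) = Rabs (Im w) / Cmod w.
Proof.
intros Hw; apply Cmod_gt_0 in Hw; assert (S := Cmod_sqr w).
replace (1 - (Re w / Cmod w)²) with ((Im w / Cmod w)²).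
  rewrite sqrt_Rsqr_abs; unfold Rdiv; rewrite Rabs_mult, (Rabs_pos_eq (/ _)); [reflexivity|].
  apply Rlt_le, Rinv_0_lt_compat, Hw.
unfold Rsqr; field_simplify_eq; [|lra]; lra.
Qed.

Lemma Cexp_Clog (w : C) : w <> 0 -> Cexp (Clog w) = w.
Proof.
intros Hw; assert (Hm := proj1 (Cmod_gt_0 w) Hw).
unfold Cexp, Clog; simpl; rewrite exp_ln by exact Hm.
assert (Hb := Re_div_Cmod w Hw); assert (Hs := sqrt_Re_div_Cmod w Hw).
unfold Carg; destruct (Rle_dec 0 (Im w)) as [Hi|Hi].
  rewrite cos_acos, sin_acos, Hs, Rabs_pos_eq by assumption.
  apply C_ext; simpl; unfold Re, Im; field; lra.
rewrite cos_neg, sin_neg, cos_acos, sin_acos, Hs, Rabs_left by (assumption || lra).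
apply C_ext; simpl; unfold Re, Im; field; lra.
Qed.

Lemma Cpower_neq_0 (w s : C) : w <> 0 -> Cpower w s = Cexp (s * Clog w).
Proof. intros Hw; unfold Cpower; destruct (Ceq_dec w 0); [contradiction|reflexivity]. Qed.

Lemma Cpower_plus (w s r : C) : w <> 0 -> Cpower w (s + r) = (Cpower w s * Cpower w r)%C.
Proof.
intros Hw; rewrite !Cpower_neq_0, <- Cexp_plus by exact Hw; f_equal; ring.
Qed.

Lemma Cpower_0 (w : C) : Cpower w 0 = 1.
Proof.
unfold Cpower; destruct (Ceq_dec w 0).
  destruct (Ceq_dec 0 0) as [_|H]; [reflexivity|now elim H].
rewrite Cmult_0_l; apply Cexp_0.
Qed.

Lemma Cpower_1 (w : C) : Cpower w 1 = w.
Proof.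
unfold Cpower; destruct (Ceq_dec w 0) as [->|Hw].
  destruct (Ceq_dec 1 0) as [H|_]; [|reflexivity]; apply RtoC_inj in H; lra.
rewrite Cmult_1_l; now apply Cexp_Clog.
Qed.

(** True also at [w = 0], by the convention 0^0 = 1. The terminating case relies on this, since 1 -
    z t may vanish inside the interval. *)
Lemma Cpower_INR (w : C) n : Cpower w (RtoC (INR n)) = Cpow w n.
Proof.
destruct (Ceq_dec w 0) as [->|Hw].
  unfold Cpower; destruct (Ceq_dec 0 0) as [_|H]; [|now elim H].
  destruct n as [|n].
    destruct (Ceq_dec _ 0) as [_|H]; [reflexivity|now elim H].
  destruct (Ceq_dec _ 0) as [H|_]; [|simpl; ring].
  apply RtoC_inj in H; generalize (pos_INR n); rewrite S_INR in H; lra.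
induction n as [|n IH]; [apply Cpower_0|].
rewrite S_INR, RtoC_plus, Cpower_plus, Cpower_1, IH by exact Hw; simpl; ring.
Qed.

Lemma Cpower_opp (w s : C) : w <> 0 -> (Cpower w s * Cpower w (- s))%C = 1.
Proof.
intros Hw; rewrite <- Cpower_plus by exact Hw.
replace (s + - s)%C with (RtoC 0) by ring; apply Cpower_0.
Qed.

Lemma Carg_scal (x : R) (w : C) : 0 < x -> Carg (x * w) = Carg w.
Proof.
intros Hx; unfold Carg; rewrite Cmod_mult, Cmod_R, Rabs_pos_eq by lra.
replace (Re (x * w)) with (x * Re w) by (simpl; unfold Re; ring).
replace (Im (x * w)) with (x * Im w) by (simpl; unfold Im; ring).
replace (x * Re w / (x * Cmod w)) with (Re w / Cmod w).
2:{ destruct (Req_dec (Cmod w) 0) as [E|E]; [|field; lra].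
    rewrite E; unfold Rdiv; rewrite Rmult_0_r, Rinv_0; ring. }
destruct (Rle_dec 0 (x * Im w)), (Rle_dec 0 (Im w)); try reflexivity; exfalso; nra.
Qed.

(** A positive factor does not change the principal argument, whereas the rule fails for two
    arbitrary complex factors. In the substitution t = u / (1 + u) the base 1 - z t is a positive
    multiple of 1 + u (1 - z). *)
Lemma Cpower_scal (x : R) (w s : C) : 0 < x ->
  Cpower (x * w) s = (Cpower x s * Cpower w s)%C.
Proof.
intros Hx; assert (Hx' : RtoC x <> 0) by (apply RtoC_neq_0; lra).
destruct (Ceq_dec w 0) as [->|Hw].
  rewrite Cmult_0_r; unfold Cpower at 1 3.
  destruct (Ceq_dec 0 0) as [_|H]; [|now elim H].
  destruct (Ceq_dec s 0) as [->|_]; [rewrite Cpower_0|]; ring.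
rewrite !Cpower_neq_0, <- Cexp_plus by (try apply Cmult_neq_0; assumption).
f_equal; rewrite <- Cmult_plus_distr_l; f_equal.
unfold Clog; rewrite Carg_scal, Carg_pos by exact Hx.
assert (Hm := proj1 (Cmod_gt_0 w) Hw).
rewrite Cmod_mult, Cmod_R, Rabs_pos_eq, ln_mult by lra.
apply C_ext; simpl; ring.
Qed.

Lemma Cmod_Cexp (w : C) : Cmod (Cexp w) = exp (Re w).
Proof.
assert (S := Cmod_sqr (Cexp w)).
assert (E : Re (Cexp w) * Re (Cexp w) + Im (Cexp w) * Im (Cexp w) = exp (Re w) * exp (Re w)).
  unfold Cexp; simpl.
  generalize (sin2_cos2 (Im w)); unfold Rsqr; intros T.
  replace (exp (Re w) * exp (Re w)) with
    (exp (Re w) * exp (Re w) * (sin (Im w) * sin (Im w) + cos (Im w) * cos (Im w)))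
    by (rewrite T; ring); ring.
rewrite E in S.
apply Rsqr_inj; [apply Cmod_ge_0|apply Rlt_le, exp_pos|exact S].
Qed.

Lemma Cmod_Cpower_pos (x : R) (s : C) : 0 < x -> Cmod (Cpower x s) = Rpower x (Re s).
Proof.
intros Hx; rewrite Cpower_pos, Cmod_Cexp by exact Hx; unfold Rpower; f_equal.
simpl; unfold Re; ring.
Qed.

Lemma is_Cderive_Cexp (f : R -> C) t (l : C) : is_Cderive f t l ->
  is_Cderive (fun t => Cexp (f t)) t (l * Cexp (f t))%C.
Proof.
intros H.
assert (H1 := is_Cderive_Re _ _ _ H); assert (H2 := is_Cderive_Im _ _ _ H).
assert (E1 : is_derive exp (Re (f t)) (exp (Re (f t)))) by apply is_derive_exp.
assert (E2 : is_derive cos (Im (f t)) (- sin (Im (f t)))) by apply is_derive_cos.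
assert (E3 : is_derive sin (Im (f t)) (cos (Im (f t)))) by apply is_derive_sin.
assert (A := is_derive_comp _ _ _ _ _ E1 H1).
assert (B := is_derive_comp _ _ _ _ _ E2 H2).
assert (D := is_derive_comp _ _ _ _ _ E3 H2).
apply (is_Cderive_ext (fun t => RtoC (exp (Re (f t))) *
   (RtoC (cos (Im (f t))) + Ci * RtoC (sin (Im (f t)))))%C).
  intros s; unfold Cexp; apply C_ext; simpl; ring.
eapply is_Cderive_eq.
  apply is_Cderive_mult; [apply is_Cderive_RtoC, A|].
  apply is_Cderive_plus; [apply is_Cderive_RtoC, B|].
  apply is_Cderive_scal, is_Cderive_RtoC, D.
unfold scal, Cexp; simpl; unfold mult; simpl.
apply C_ext; simpl; unfold Re, Im; ring.
Qed.

(** On the right half-plane, away from the cut, this replaces the case distinction in [Carg] by one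
    differentiable formula. *)
Lemma Carg_atan (w : C) : 0 < Re w -> Carg w = atan (Im w / Re w).
Proof.
intros Hw.
assert (H0 : w <> 0) by (intros E; rewrite E in Hw; simpl in Hw; lra).
assert (Hm := proj1 (Cmod_gt_0 w) H0).
unfold Carg; rewrite acos_atan by now apply Rdiv_lt_0_compat.
rewrite sqrt_Re_div_Cmod by exact H0.
destruct (Rle_dec 0 (Im w)) as [Hi|Hi].
  rewrite Rabs_pos_eq by exact Hi; f_equal; field; lra.
rewrite <- atan_opp, Rabs_left by lra; f_equal; field; lra.
Qed.

Lemma is_Cderive_Clog (f : R -> C) t (l : C) : 0 < Re (f t) -> is_Cderive f t l ->
  is_Cderive (fun t => Clog (f t)) t (l / f t)%C.
Proof.
intros Hp H.
assert (H1 := is_Cderive_Re _ _ _ H); assert (H2 := is_Cderive_Im _ _ _ H).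
assert (L : locally t (fun s => 0 < Re (f s))).
  apply (Ccontinuous_Re f t (is_Cderive_continuous _ _ _ H) (fun x => 0 < x)).
  now apply (open_gt 0).
apply (is_derive_ext_loc (V := C_R_NormedModule)
  (fun s => (/ 2 * ln (Re (f s) * Re (f s) + Im (f s) * Im (f s)), atan (Im (f s) / Re (f s))) : C)).
  revert L; apply filter_imp; intros s Hs; unfold Clog.
  rewrite Carg_atan, <- Cmod_sqr by exact Hs.
  assert (Hm : 0 < Cmod (f s)).
    apply Cmod_gt_0; intros E; rewrite E in Hs; simpl in Hs; lra.
  rewrite ln_mult by exact Hm; f_equal; field.
set (x := fun s => Re (f s)) in *; set (y := fun s => Im (f s)) in *.
assert (D1 : Derive (fun s => x s) t = Re l) by exact (is_derive_unique _ _ _ H1).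
assert (D2 : Derive (fun s => y s) t = Im l) by exact (is_derive_unique _ _ _ H2).
assert (Hn : 0 < x t * x t + y t * y t) by (unfold x; nra).
apply is_Cderive_pair.
  change (is_derive (fun s => / 2 * ln (x s * x s + y s * y s)) t (Re (l / f t))).
  replace (Re (l / f t)) with (/ 2 * ((Re l * x t + x t * Re l + (Im l * y t + y t * Im l))
     / (x t * x t + y t * y t))).
    apply (is_derive_scal (fun s => ln (x s * x s + y s * y s))).
    auto_derive.
      repeat split; try (eexists; eassumption); exact Hn.
    rewrite D1, D2; field; lra.
  unfold Cdiv, Cinv; simpl; fold (Re (f t)) (Im (f t)) (Re l) (Im l) (x t) (y t).
  unfold x, y in *; unfold Re, Im in *; field; lra.
change (is_derive (fun s => atan (y s / x s)) t (Im (l / f t))).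
auto_derive.
  repeat split; try (eexists; eassumption); unfold x; lra.
rewrite D1, D2.
unfold Cdiv, Cinv; simpl.
unfold x, y in *; unfold Re, Im, Rsqr in *; field; lra.
Qed.

Lemma Re_pos_neq_0 (w : C) : 0 < Re w -> w <> 0.
Proof. intros H E; rewrite E in H; simpl in H; lra. Qed.

Lemma is_Cderive_Cpower (f : R -> C) t (l s : C) : 0 < Re (f t) -> is_Cderive f t l ->
  is_Cderive (fun t => Cpower (f t) s) t (s * l * Cpower (f t) (s - 1))%C.
Proof.
intros Hp H.
assert (L : locally t (fun s => 0 < Re (f s))).
  apply (Ccontinuous_Re f t (is_Cderive_continuous _ _ _ H) (fun x => 0 < x)).
  now apply (open_gt 0).
apply (is_derive_ext_loc (V := C_R_NormedModule) (fun t => Cexp (s * Clog (f t)))).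
  revert L; apply filter_imp; intros x Hx; symmetry.
  now apply Cpower_neq_0, Re_pos_neq_0.
eapply is_Cderive_eq.
  apply is_Cderive_Cexp, is_Cderive_scal, is_Cderive_Clog; eassumption.
assert (Hn := Re_pos_neq_0 _ Hp).
change (s * (l / f t) * Cexp (s * Clog (f t)) = s * l * Cpower (f t) (s - 1))%C.
rewrite <- Cpower_neq_0 by exact Hn.
replace s with (s - 1 + 1)%C at 2 by ring.
rewrite Cpower_plus, Cpower_1 by exact Hn; field; exact Hn.
Qed.

Lemma is_Cderive_line (z : C) t : is_Cderive (fun t => 1 - z * RtoC t)%C t (- z)%C.
Proof.
eapply is_Cderive_eq.
  apply (is_Cderive_plus (fun _ => RtoC 1) (fun t => - (z * RtoC t))%C).
    apply is_Cderive_const.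
  apply is_Cderive_opp, is_Cderive_scal, is_Cderive_RtoC, (is_derive_id (K := R_AbsRing)).
change (0 + - (z * 1) = - z)%C; ring.
Qed.

Lemma is_Cderive_Cpower_line (z s : C) t : 0 < Re (1 - z * RtoC t) ->
  is_Cderive (fun t => Cpower (1 - z * RtoC t) s) t
    (- (s * z) * Cpower (1 - z * RtoC t) (s - 1))%C.
Proof.
intros H; eapply is_Cderive_eq.
  apply (is_Cderive_Cpower (fun t => 1 - z * RtoC t)%C); [exact H|apply is_Cderive_line].
simpl; ring.
Qed.

Lemma Ccontinuous_Cpower_line (z s : C) t : 0 < Re (1 - z * RtoC t) ->
  Ccontinuous (fun t => Cpower (1 - z * RtoC t) s) t.
Proof. intros H; exact (is_Cderive_continuous _ _ _ (is_Cderive_Cpower_line z s t H)). Qed.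

(** * The binomial series *)

(** The coefficient of w^n in the expansion of (1 - w)^(-l). *)
Definition binom (l : C) (n : nat) : C := (poch l n / RtoC (INR (fact n)))%C.

Lemma binom_S (l : C) n : (binom l (S n) * RtoC (INR (S n)) = binom l n * (l + RtoC (INR n)))%C.
Proof.
unfold binom; rewrite fact_simpl, mult_INR, RtoC_mult; simpl poch.
assert (H1 : RtoC (INR (fact n)) <> 0) by apply RtoC_neq_0, INR_fact_neq_0.
assert (H2 : RtoC (INR (S n)) <> 0) by (apply RtoC_neq_0, not_0_INR; lia).
field; split; assumption.
Qed.

Lemma binom_0 (l : C) : binom l 0 = 1.
Proof. unfold binom; simpl; field. Qed.

Lemma binom_Cmod_S (l : C) n :
  Cmod (binom l (S n)) * (INR n + 1) = Cmod (binom l n) * Cmod (l + RtoC (INR n)).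
Proof.
rewrite <- Cmod_mult, <- binom_S, Cmod_mult, Cmod_R, S_INR, Rabs_pos_eq; [reflexivity|].
generalize (pos_INR n); lra.
Qed.

(** The ratio test; the finitely many terms up to [N] are absorbed in [K]. *)
Lemma geometric_growth (u : nat -> R) q N : 0 < q -> (forall n, 0 <= u n) ->
  (forall n, (N <= n)%nat -> u (S n) <= q * u n) ->
  exists K, 0 < K /\ forall n, u n <= K * q ^ n.
Proof.
intros Hq Hu H.
assert (F : forall M, exists K, 0 < K /\ forall n, (n <= M)%nat -> u n <= K * q ^ n).
  induction M as [|M [K [K0 HK]]].
    exists (u O + 1); split; [generalize (Hu O); lra|].
    intros n Hn; replace n with O by lia; simpl; lra.
  assert (Hp : 0 < q ^ S M) by now apply pow_lt.
  exists (Rmax K (u (S M) / q ^ S M)); split.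
    eapply Rlt_le_trans; [exact K0|apply Rmax_l].
  intros n Hn; destruct (Nat.eq_dec n (S M)) as [->|Hn'].
    apply Rle_trans with (u (S M) / q ^ S M * q ^ S M); [right; field; lra|].
    apply Rmult_le_compat_r; [lra|apply Rmax_r].
  eapply Rle_trans; [apply HK; lia|].
  apply Rmult_le_compat_r; [apply pow_le; lra|apply Rmax_l].
destruct (F N) as [K [K0 HK]]; exists K; split; [exact K0|].
intros n; destruct (Compare_dec.le_lt_dec n N) as [Hn|Hn]; [now apply HK|].
induction n as [|n IH]; [lia|].
destruct (Nat.eq_dec n N) as [->|Hn'].
  eapply Rle_trans; [apply H; lia|]; simpl.
  replace (K * (q * q ^ N)) with (q * (K * q ^ N)) by ring.
  apply Rmult_le_compat_l; [lra|apply HK; lia].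
eapply Rle_trans; [apply H; lia|]; simpl.
replace (K * (q * q ^ n)) with (q * (K * q ^ n)) by ring.
apply Rmult_le_compat_l; [lra|apply IH; lia].
Qed.

Lemma binom_decay (l z : C) : Cmod z < 1 -> exists K q, 0 < K /\ 0 < q < 1 /\
  forall n, (INR n + 1) * Cmod (binom l n * Cpow z n) <= K * q ^ n.
Proof.
intros Hz; assert (Hz0 := Cmod_ge_0 z); assert (Hl := Cmod_ge_0 l).
set (L := Cmod l) in *; set (x := Cmod z) in *.
set (q := (1 + x) / 2).
(* With k = n + 1, the ratio of consecutive terms is at most |z| (1 + (1 + 2 L) / k); from [N] on it
   is below the midpoint [q] of |z| and 1. *)
destruct (INR_unbounded ((1 + 2 * L) * x / (q - x))) as [N HN].
destruct (geometric_growth (fun n => (INR n + 1) * Cmod (binom l n * Cpow z n)) q N)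
  as [K [K0 HK]].
- unfold q; lra.
- intros n; apply Rmult_le_pos; [generalize (pos_INR n); lra|apply Cmod_ge_0].
- intros n Hn; rewrite !Cmod_mult, !Cmod_pow, S_INR; fold x; simpl pow.
  set (b := Cmod (binom l n)); set (b' := Cmod (binom l (S n))).
  assert (E := binom_Cmod_S l n); fold b b' in E.
  assert (T : Cmod (l + RtoC (INR n)) <= L + INR n).
    eapply Rle_trans; [apply Cmod_triangle|].
    rewrite Cmod_R, Rabs_pos_eq by apply pos_INR; unfold L; lra.
  assert (HnN := le_INR _ _ Hn); assert (Hn0 := pos_INR n).
  set (k := INR n + 1); assert (Hk : 1 <= k) by (unfold k; lra).
  assert (Hb : 0 <= b) by apply Cmod_ge_0.
  assert (Hb' : b' = b * Cmod (l + RtoC (INR n)) / k) by (rewrite <- E; unfold k; field; lra).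
  assert (Hkx : (1 + 2 * L) * x <= (q - x) * k).
    replace ((1 + 2 * L) * x) with ((q - x) * ((1 + 2 * L) * x / (q - x)))
      by (field; unfold q; lra).
    apply Rmult_le_compat_l; unfold q, k; [|unfold q in HN]; lra.
  assert (P : (k + 1) * (L + INR n) * x <= q * (k * k)).
    assert ((k + 1) * (L + INR n) <= k * k + (1 + 2 * L) * k).
      unfold k; nra.
    apply Rle_trans with ((k * k + (1 + 2 * L) * k) * x); [apply Rmult_le_compat_r; lra|].
    replace ((k * k + (1 + 2 * L) * k) * x) with (k * (k * x + (1 + 2 * L) * x)) by ring.
    replace (q * (k * k)) with (k * (k * x + (q - x) * k)) by ring.
    apply Rmult_le_compat_l; lra.
  assert (Hxn : 0 <= x ^ n) by now apply pow_le.
  rewrite Hb'.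
  replace ((k + 1) * (b * Cmod (l + RtoC (INR n)) / k * (x * x ^ n)))
    with ((b * x ^ n / k) * ((k + 1) * Cmod (l + RtoC (INR n)) * x)) by (field; lra).
  replace (q * (k * (b * x ^ n))) with ((b * x ^ n / k) * (q * (k * k))) by (field; lra).
  apply Rmult_le_compat_l.
    apply Rmult_le_pos; [now apply Rmult_le_pos|apply Rlt_le, Rinv_0_lt_compat; lra].
  eapply Rle_trans; [|exact P].
  apply Rmult_le_compat_r; [exact Hz0|]; apply Rmult_le_compat_l; lra.
exists K, q; split; [exact K0|]; split; [unfold q; lra|exact HK].
Qed.

Lemma sum_geometric K q n : 0 < K -> 0 < q < 1 -> sum_n (fun k => K * q ^ k) n <= K / (1 - q).
Proof.
intros HK Hq.
assert (E : sum_n (fun k => K * q ^ k) n = K / (1 - q) * (1 - q ^ S n)).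
  induction n as [|n IH]; [rewrite sum_O; simpl; field; lra|].
  rewrite sum_Sn, IH; unfold plus; simpl; field; lra.
rewrite E; rewrite <- (Rmult_1_r (K / (1 - q))) at 2.
assert (0 < K / (1 - q)) by (apply Rdiv_lt_0_compat; lra).
apply Rmult_le_compat_l; [lra|].
assert (0 <= q ^ S n) by (apply pow_le; lra); lra.
Qed.

Lemma binom_summable (l z : C) : Cmod z < 1 -> exists V, forall n,
  sum_n (fun k => (INR k + 1) * Cmod (binom l k * Cpow z k)) n <= V.
Proof.
intros Hz; destruct (binom_decay l z Hz) as [K [q [K0 [Hq HK]]]].
exists (K / (1 - q)); intros n; eapply Rle_trans; [|apply (sum_geometric K q n K0 Hq)].
now apply sum_n_le_R.
Qed.

Definition binom_partial (l z : C) (n : nat) (t : R) : C :=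
  Csum (fun k => binom l k * Cpow z k * RtoC (t ^ k))%C n.

Lemma is_Cderive_binom_partial (l z : C) n t :
  is_Cderive (binom_partial l z n) t
    (Csum (fun k => binom l k * Cpow z k * RtoC (INR k * t ^ pred k))%C n).
Proof.
induction n as [|n IH].
  apply (is_Cderive_scal (binom l 0 * Cpow z 0)), is_Cderive_RtoC, is_derive_power.
apply is_Cderive_plus; [exact IH|].
apply (is_Cderive_scal (binom l (S n) * Cpow z (S n))), is_Cderive_RtoC, is_derive_power.
Qed.

(* The defect of the differential equation (1 - z t) S' = l z S on partial sums. *)
Lemma binom_partial_ode (l z : C) n t :
  ((1 - z * RtoC t) * Csum (fun k => binom l k * Cpow z k * RtoC (INR k * t ^ pred k)) n
    - l * z * binom_partial l z n t
   = - (RtoC (INR (S n)) * (binom l (S n) * Cpow z (S n)) * RtoC (t ^ n)))%C.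
Proof.
unfold binom_partial; induction n as [|n IH].
  assert (E := binom_S l 0).
  replace (RtoC (INR 1) * (binom l 1 * z ^ 1) * RtoC (t ^ 0))%C
    with (binom l 1 * RtoC (INR 1) * z)%C by (simpl; ring).
  rewrite E; simpl; rewrite Rmult_0_l; ring.
change (Csum (fun k => binom l k * z ^ k * RtoC (INR k * t ^ pred k)) (S n))%C
  with (Csum (fun k => binom l k * z ^ k * RtoC (INR k * t ^ pred k)) n
   + binom l (S n) * z ^ S n * RtoC (INR (S n) * t ^ n))%C.
change (Csum (fun k => binom l k * z ^ k * RtoC (t ^ k)) (S n))%C
  with (Csum (fun k => binom l k * z ^ k * RtoC (t ^ k)) n
   + binom l (S n) * z ^ S n * RtoC (t ^ S n))%C.
set (X := Csum (fun k => binom l k * z ^ k * RtoC (INR k * t ^ pred k))%C n) in *.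
set (Y := Csum (fun k => binom l k * z ^ k * RtoC (t ^ k))%C n) in *.
replace ((1 - z * t) * (X + binom l (S n) * z ^ S n * RtoC (INR (S n) * t ^ n))
   - l * z * (Y + binom l (S n) * z ^ S n * RtoC (t ^ S n)))%C
  with (((1 - z * t) * X - l * z * Y)
   + (1 - z * t) * (binom l (S n) * z ^ S n * RtoC (INR (S n) * t ^ n))
   - l * z * (binom l (S n) * z ^ S n * RtoC (t ^ S n)))%C by ring.
rewrite IH.
assert (E := binom_S l (S n)).
replace (RtoC (INR (S (S n))) * (binom l (S (S n)) * z ^ S (S n)) * RtoC (t ^ S n))%C
  with (binom l (S (S n)) * RtoC (INR (S (S n))) * (z ^ S (S n) * RtoC (t ^ S n)))%C by ring.
rewrite E, RtoC_mult.
change (t ^ S n) with (t * t ^ n); rewrite RtoC_mult, !Cpow_S; ring.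
Qed.

Lemma Re_line_pos (z : C) t : Cmod z < 1 -> 0 <= t <= 1 -> 0 < Re (1 - z * RtoC t).
Proof.
intros Hz Ht; assert (H := Re_le_Cmod z); apply Rabs_le_between in H.
replace (Re (1 - z * RtoC t)) with (1 - Re z * t) by (simpl; unfold Re; ring); nra.
Qed.

(** The product of a partial sum with (1 - z t)^l equals 1 at t = 0, and by [binom_partial_ode] its
    derivative is a single small term; the product therefore stays close to 1, uniformly on
    [0, 1]. *)
Lemma binomial_series (l z : C) : Cmod z < 1 ->
  uniform_limit eventually (binom_partial l z) (fun t => Cpower (1 - z * RtoC t) (- l)) 0 1.
Proof.
intros Hz.
assert (Hc : forall s, Ccontinuous_on (fun t => Cpower (1 - z * RtoC t) s) 0 1).
  intros s t Ht; apply Ccontinuous_Cpower_line, Re_line_pos; assumption.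
destruct (Cmod_bounded _ 0 1 Rle_0_1 (Hc (l - 1)%C)) as [K1 [K10 HK1]].
destruct (Cmod_bounded _ 0 1 Rle_0_1 (Hc (- l)%C)) as [K2 [K20 HK2]].
destruct (binom_decay l z Hz) as [K [q [K0 [Hq HK]]]].
assert (D : forall n t, 0 <= t <= 1 ->
    Cmod (binom_partial l z n t - Cpower (1 - z * RtoC t) (- l)) <= K2 * (K1 * (K * q ^ S n))).
  intros n t Ht.
  set (P := fun t => Cpower (1 - z * RtoC t) l).
  assert (PP : forall t, 0 <= t <= 1 -> (P t * Cpower (1 - z * RtoC t) (- l))%C = 1).
    intros s Hs; apply Cpower_opp, Re_pos_neq_0, Re_line_pos; assumption.
  set (dE := fun t => (- (RtoC (INR (S n)) * (binom l (S n) * Cpow z (S n)) * RtoC (t ^ n))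
     * Cpower (1 - z * RtoC t) (l - 1))%C).
  assert (dP : forall t, 0 <= t <= 1 ->
      is_Cderive (fun t => binom_partial l z n t * P t)%C t (dE t)).
    intros s Hs; assert (Hp := Re_line_pos z s Hz Hs).
    eapply is_Cderive_eq.
      apply is_Cderive_mult; [apply is_Cderive_binom_partial|].
      apply is_Cderive_Cpower_line; exact Hp.
    unfold P, dE; rewrite <- (binom_partial_ode l z n s).
    assert (EP : Cpower (1 - z * s) l = (Cpower (1 - z * s) (l - 1) * (1 - z * s))%C).
      rewrite <- (Cpower_1 (1 - z * s)) at 3.
      rewrite <- Cpower_plus by now apply Re_pos_neq_0.
      f_equal; ring.
    rewrite EP; ring.
  assert (dB : forall t, 0 <= t <= 1 -> Cmod (dE t) <= K1 * (K * q ^ S n)).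
    intros s Hs; unfold dE; rewrite Cmod_mult, Cmod_opp, Rmult_comm.
    apply Rmult_le_compat; try apply Cmod_ge_0; [now apply HK1|].
    set (X := (binom l (S n) * Cpow z (S n))%C).
    rewrite (Cmod_mult (_ * _)), (Cmod_mult (RtoC _)), !Cmod_R.
    assert (Hs' := pow_01 s n Hs).
    rewrite !Rabs_pos_eq by (apply pos_INR || lra).
    apply Rle_trans with ((INR (S n) + 1) * Cmod (binom l (S n) * Cpow z (S n))); [|apply HK].
    fold X; assert (H0 := pos_INR (S n)); assert (H1 := Cmod_ge_0 X).
    assert (0 <= INR (S n) * Cmod X) by now apply Rmult_le_pos.
    nra.
  assert (dC : Ccontinuous_on dE 0 1).
    intros s Hs; apply Ccontinuous_mult; [|now apply Hc].
    apply Ccontinuous_opp, Ccontinuous_mult; [apply Ccontinuous_const|].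
    apply Ccontinuous_RtoC, continuous_power.
  assert (M : Cmod (binom_partial l z n t * P t - binom_partial l z n 0 * P 0)
      <= K1 * (K * q ^ S n) * (t - 0)).
    apply (C_mean_value (fun t => binom_partial l z n t * P t)%C dE 0 t); [lra| | |].
    - intros s Hs; apply dP; lra.
    - intros s Hs; apply dC; lra.
    - intros s Hs; apply dB; lra.
  assert (E0 : (binom_partial l z n 0 * P 0)%C = 1).
    replace (P 0) with (RtoC 1).
      clear; unfold binom_partial; induction n as [|n IH]; simpl; [rewrite binom_0; ring|].
      rewrite Cmult_1_r in IH; rewrite IH, Rmult_0_l; ring.
    unfold P; rewrite Cmult_0_r; replace (1 - 0)%C with (RtoC 1) by ring.
    rewrite Cpower_pos by lra; rewrite ln_1, Cmult_0_r; symmetry; apply Cexp_0.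
  rewrite E0 in M.
  replace (binom_partial l z n t - Cpower (1 - z * RtoC t) (- l))%C
    with (Cpower (1 - z * RtoC t) (- l) * (binom_partial l z n t * P t - 1))%C
    by (replace (Cpower (1 - z * t) (- l) * (binom_partial l z n t * P t - 1))%C with
         (binom_partial l z n t * (P t * Cpower (1 - z * t) (- l)) - Cpower (1 - z * t) (- l))%C
         by ring; rewrite PP by exact Ht; ring).
  rewrite Cmod_mult; apply Rmult_le_compat; try apply Cmod_ge_0; [now apply HK2|].
  eapply Rle_trans; [exact M|].
  assert (0 <= K1 * (K * q ^ S n)).
    apply Rmult_le_pos; [lra|]; apply Rmult_le_pos; [lra|apply pow_le; lra].
  nra.
intros a b eps Ha Hab Hb He.
assert (Hpos : 0 < K2 * K1 * K) by (repeat apply Rmult_lt_0_compat; lra).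
assert (He' : 0 < eps / (K2 * K1 * K)) by (apply Rdiv_lt_0_compat; lra).
generalize (eventually_pow_small q _ ltac:(lra) He'); apply filter_imp; intros n Hn t Ht.
eapply Rle_trans; [apply D; lra|].
assert (Hqn : 0 <= q ^ n) by (apply pow_le; lra).
apply Rle_trans with (K2 * K1 * K * (eps / (K2 * K1 * K))); [|right; field; lra].
replace (K2 * (K1 * (K * q ^ S n))) with (K2 * K1 * K * (q * q ^ n)) by (simpl; ring).
apply Rmult_le_compat_l; [lra|]; nra.
Qed.

(** * The terminating case *)

Lemma poch_zero (n k : nat) : poch (- RtoC (INR n)) (S n + k) = 0%C.
Proof.
induction k as [|k IH].
  rewrite Nat.add_0_r; simpl; ring.
rewrite Nat.add_succ_r; simpl poch; simpl in IH; rewrite IH; ring.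
Qed.

Lemma binom_pascal (l : C) n : binom (l - 1) (S n) = (binom l (S n) - binom l n)%C.
Proof.
assert (P : poch (l - 1) (S n) = ((l - 1) * poch l n)%C).
  rewrite <- poch_shift; f_equal; f_equal; ring.
unfold binom; rewrite P, fact_simpl, mult_INR, RtoC_mult; simpl poch.
assert (H1 : RtoC (INR (fact n)) <> 0) by apply RtoC_neq_0, INR_fact_neq_0.
assert (H2 : RtoC (INR (S n)) <> 0) by (apply RtoC_neq_0, not_0_INR; lia).
rewrite S_INR, RtoC_plus in *; field; split; assumption.
Qed.

(** The truncation of (1 - w)^(1 - l) = (1 - w) (1 - w)^(-l), with the one term that does not
    cancel. *)
Lemma binom_sum_pascal (l w : C) n :
  (Csum (fun k => binom (l - 1) k * Cpow w k) (S n)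
   = (1 - w) * Csum (fun k => binom l k * Cpow w k) n + binom l (S n) * Cpow w (S n))%C.
Proof.
induction n as [|n IH].
  simpl; rewrite (binom_pascal l 0), !binom_0; simpl; ring.
change (Csum (fun k => binom (l - 1) k * w ^ k) (S (S n)))%C
  with (Csum (fun k => binom (l - 1) k * w ^ k) (S n)
   + binom (l - 1) (S (S n)) * w ^ S (S n))%C.
rewrite IH, binom_pascal; simpl; ring.
Qed.

(** Induction on the degree by [binom_sum_pascal]. The surplus [k] expresses that the partial sums
    are constant from [m] on, whatever the size of [w]. *)
Lemma binom_terminating (m k : nat) (w : C) :
  Csum (fun j => binom (- RtoC (INR m)) j * Cpow w j)%C (m + k) = Cpow (1 - w) m.
Proof.
revert k; induction m as [|m IH]; intros k.
  change (0 + k)%nat with k; induction k as [|k IH].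
    simpl; rewrite binom_0; ring.
  change (Csum (fun j => binom (- RtoC (INR 0)) j * w ^ j) (S k))%C
    with (Csum (fun j => binom (- RtoC (INR 0)) j * w ^ j) k
      + binom (- RtoC (INR 0)) (S k) * w ^ S k)%C.
  rewrite IH; unfold binom.
  rewrite (poch_zero 0 k : poch _ (S k) = _); unfold Cdiv; simpl; ring.
change (S m + k)%nat with (S (m + k)).
replace (- RtoC (INR (S m)))%C with (- RtoC (INR m) - 1)%C by (rewrite S_INR, RtoC_plus; ring).
rewrite binom_sum_pascal, IH.
replace (binom (- RtoC (INR m)) (S (m + k))) with (RtoC 0).
  simpl; ring.
unfold binom; rewrite (poch_zero m k : poch _ (S (m + k)) = _); unfold Cdiv; ring.
Qed.

(** * Abel's limit theorem *)

Lemma Abel_limit (a : nat -> R) (s : R) : is_series a s ->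
  filterlim (PSeries a) (at_left 1) (locally s).
Proof.
intros Hs.
assert (E1 : PSeries a 1 = s).
  unfold PSeries; apply is_series_unique; revert Hs; apply is_series_ext.
  intros n; rewrite pow1; symmetry; apply Rmult_1_r.
assert (X : ex_pseries a 1).
  exists s; revert Hs; apply is_series_ext.
  intros n; rewrite pow_n_pow, pow1; symmetry; apply (scal_one (K := R_Ring) (a n)).
assert (L : Rbar_le 1 (CV_radius a)).
  apply Rbar_not_lt_le; intros H.
  apply (CV_disk_outside a 1); [rewrite Rabs_R1; exact H|].
  apply (is_lim_seq_ext a); [intros n; rewrite pow1; ring|].
  apply ex_series_lim_0; exists s; exact Hs.
rewrite <- E1.
(* If the radius exceeds 1, continuity inside the disk is enough; Abel's theorem proper is the case
   of radius 1. *)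
destruct (Rbar_le_lt_or_eq_dec _ _ L) as [H|H].
  assert (Q : continuous (PSeries a) 1) by (apply continuity_pt_filterlim, PSeries_continuity; now rewrite Rabs_R1).
  intros P HP; destruct (Q P HP) as [eps HQ].
  exists eps; intros y Hy _; now apply HQ.
assert (A := Abel a); rewrite <- H in A; apply A; simpl; auto; lra.
Qed.

Lemma Csum_lim_PSeries (a : nat -> C) (r : R) (s : C) :
  Csum_lim (fun n => a n * RtoC (r ^ n))%C s ->
  s = (PSeries (fun n => Re (a n)) r, PSeries (fun n => Im (a n)) r).
Proof.
intros H; rewrite <- (CSeries_unique _ _ H); unfold CSeries, PSeries; f_equal;
  apply Series_ext; intros n; simpl; unfold Re, Im; ring.
Qed.

Lemma Abel_limit_C (a : nat -> C) (S : C) eps : Csum_lim a S -> 0 < eps ->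
  at_left 1 (fun r => forall s, Csum_lim (fun n => a n * RtoC (r ^ n))%C s -> Cmod (s - S) < eps).
Proof.
intros HS He; apply Csum_lim_Re_Im in HS; destruct HS as [H1 H2].
assert (He' : 0 < eps / 2) by lra.
assert (X : at_left 1 (fun r => Rabs (PSeries (fun n => Re (a n)) r - Re S) < eps / 2))
  by exact (Abel_limit _ _ H1 _ (locally_ball _ (mkposreal _ He'))).
assert (Y : at_left 1 (fun r => Rabs (PSeries (fun n => Im (a n)) r - Im S) < eps / 2))
  by exact (Abel_limit _ _ H2 _ (locally_ball _ (mkposreal _ He'))).
generalize (filter_and _ _ X Y); apply filter_imp; clear X Y; intros r [X Y] s Hs.
rewrite (Csum_lim_PSeries _ _ _ Hs).
eapply Rle_lt_trans; [apply Cmod_le_abs|].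
simpl; unfold Re, Im, Rminus in *; lra.
Qed.

Lemma at_left_1_half : at_left 1 (fun r => 1 / 2 < r < 1).
Proof.
exists (mkposreal (1 / 2) ltac:(lra)); intros r Hr Hr1; split; [|exact Hr1].
apply Rabs_lt_between in Hr; unfold minus, plus, opp in Hr; simpl in Hr; lra.
Qed.

(** [multiplier_limit] for a constant sequence. *)
Lemma multiplier_improper (psi h : R -> C) A B V m : A < B -> multiplier psi A B V ->
  Ccontinuous_in h A B -> improper h A B m ->
  exists J, improper (fun t => psi t * h t)%C A B J.
Proof.
intros HAB Hm Hh Hi.
destruct (multiplier_limit eventually (fun _ => psi) psi h A B V m HAB Hh Hi) as [J [HJ _]].
- now apply (multiplier_continuous _ _ _ V).
- now exists O.
- intros a b eps Ha Hab Hb He; exists O; intros n _ t Ht.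
  replace (psi t - psi t)%C with (RtoC 0) by ring; rewrite Cmod_0; lra.
- now exists J.
Qed.

(** * Integration of the binomial series against a function with given moments *)

Section Moments.

Variables (g : R -> C) (m : nat -> C) (l : C).
Hypothesis Hg : Ccontinuous_in g 0 1.
Hypothesis Hm : forall n, improper (fun t => RtoC (t ^ n) * g t)%C 0 1 (m n).

Lemma moment_0 : improper g 0 1 (m O).
Proof.
apply (improper_ext (fun t => RtoC (t ^ 0) * g t)%C); [lra| |apply Hm].
intros t _; simpl; ring.
Qed.

Lemma Ccontinuous_in_Cpower_line (z s : C) : (forall t, 0 < t < 1 -> 0 < Re (1 - z * RtoC t)) ->
  Ccontinuous_in (fun t => Cpower (1 - z * RtoC t) s) 0 1.
Proof. intros H t Ht; now apply Ccontinuous_Cpower_line, H. Qed.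

Lemma integral_disk (z : C) : Cmod z < 1 ->
  exists J, improper (fun t => Cpower (1 - z * RtoC t) (- l) * g t)%C 0 1 J /\
    Csum_lim (fun n => binom l n * Cpow z n * m n)%C J.
Proof.
intros Hz; destruct (binom_summable l z Hz) as [V HV].
apply (moment_series g _ (fun n => binom l n * Cpow z n)%C (fun n => n) m V (m O));
  auto using moment_0.
  apply Ccontinuous_in_Cpower_line; intros t Ht; apply Re_line_pos; lra.
exact (binomial_series l z Hz).
Qed.

(** The partial sums coincide with the power from index [n] on, so the uniform limit is trivial and
    |z| may be arbitrary; the sum up to [n] serves as the weighted bound. *)
Lemma integral_terminating (z : C) n : l = (- RtoC (INR n))%C ->
  exists J, improper (fun t => Cpower (1 - z * RtoC t) (- l) * g t)%C 0 1 J /\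
    Csum_lim (fun n => binom l n * Cpow z n * m n)%C J.
Proof.
intros Hl.
assert (E : forall k t, Cpower (1 - z * RtoC t) (- l)
    = Csum (fun j => binom l j * Cpow z j * RtoC (t ^ j))%C (n + k)).
  intros k t; rewrite Hl; replace (- - RtoC (INR n))%C with (RtoC (INR n)) by ring.
  rewrite Cpower_INR, <- (binom_terminating n k); apply Csum_ext; intros j _.
  rewrite Cpow_mult_l, RtoC_pow; ring.
set (c := fun j => (binom l j * Cpow z j)%C).
assert (Z : forall k, c (S n + k)%nat = 0%C).
  intros k; unfold c, binom; rewrite Hl, poch_zero; unfold Cdiv; ring.
assert (V : forall k, sum_n (fun j => (INR j + 1) * Cmod (c j)) k
    <= sum_n (fun j => (INR j + 1) * Cmod (c j)) n).
  assert (P : forall j, 0 <= (INR j + 1) * Cmod (c j)).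
    intros j; apply Rmult_le_pos; [generalize (pos_INR j); lra|apply Cmod_ge_0].
  intros k; destruct (Compare_dec.le_lt_dec k n) as [Hk|Hk].
    replace n with (k + (n - k))%nat by lia; clear Z.
    induction (n - k)%nat as [|d IH]; [rewrite Nat.add_0_r; lra|].
    rewrite Nat.add_succ_r, sum_Sn; unfold plus; simpl; generalize (P (S (k + d))); simpl; lra.
  replace k with (n + (k - n))%nat by lia.
  induction (k - n)%nat as [|d IH]; [rewrite Nat.add_0_r; lra|].
  rewrite Nat.add_succ_r, sum_Sn; unfold plus; simpl.
  rewrite (Z d : c (S (n + d)) = _), Cmod_0; simpl in IH |- *; lra.
apply (moment_series g _ c (fun j => j) m (sum_n (fun j => (INR j + 1) * Cmod (c j)) n) (m O));
  auto using moment_0.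
- intros t Ht; apply (continuous_ext (T := R_UniformSpace) (U := NormedModule.UniformSpace _ C_R_NormedModule)
    (fun t => Csum (fun j => c j * RtoC (t ^ j))%C n)).
    intros s; rewrite (E O s), Nat.add_0_r; reflexivity.
  apply (multiplier_continuous _ 0 1 _ (polynomial_multiplier c (fun j => j) _ n (V n)) t Ht).
- intros a b eps Ha Hab Hb He; exists n; intros k Hk t Ht.
  replace k with (n + (k - n))%nat by lia; rewrite (E (k - n)%nat t).
  unfold c; replace (_ - _)%C with (RtoC 0) by ring; rewrite Cmod_0; lra.
Qed.

(* Abel's theorem: [F] is the Euler integral at [r z], where [|r z| < 1]. *)
Lemma boundary_limit (z S J : C) : Cmod z <= 1 ->
  Csum_lim (fun n => binom l n * Cpow z n * m n)%C S ->
  (forall eps, 0 < eps -> at_left 1 (fun r => forall F,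
     improper (fun t => Cpower (1 - RtoC r * z * RtoC t) (- l) * g t)%C 0 1 F ->
     Cmod (F - J) < eps)) ->
  S = J.
Proof.
intros Hz HS HJ; apply (Cmod_small _ _ 2); intros eps He.
destruct (filter_ex _ (filter_and _ _ at_left_1_half
  (filter_and _ _ (HJ eps He) (Abel_limit_C _ S eps HS He)))) as [r [Hr [H1 H2]]].
destruct (integral_disk (RtoC r * z)) as [F [HF HL]].
  rewrite Cmod_mult, Cmod_R, Rabs_pos_eq by lra.
  assert (r * Cmod z <= r * 1) by (apply Rmult_le_compat_l; lra); lra.
specialize (H1 F HF).
assert (HL' : Csum_lim (fun n => binom l n * z ^ n * m n * RtoC (r ^ n))%C F).
  revert HL; apply Csum_lim_ext; intros n; rewrite Cpow_mult_l, RtoC_pow; ring.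
specialize (H2 F HL').
replace (S - J)%C with (- (F - S) + (F - J))%C by ring.
eapply Rle_trans; [apply Cmod_triangle|]; rewrite Cmod_opp; lra.
Qed.

(** With Re z < 1 the real part of 1 - z t is positive on all of [0, 1], so [phi] and its derivative
    are bounded there. The dilations t -> phi (r t) are then multipliers with one constant, and the
    mean value inequality gives their convergence as r tends to 1. *)
Lemma integral_circle (z S : C) : Cmod z <= 1 -> Re z < 1 ->
  Csum_lim (fun n => binom l n * Cpow z n * m n)%C S ->
  improper (fun t => Cpower (1 - z * RtoC t) (- l) * g t)%C 0 1 S.
Proof.
intros Hz Hz1 HS.
assert (Hre : forall t, 0 <= t <= 1 -> 0 < Re (1 - z * RtoC t)).
  intros t Ht; replace (Re (1 - z * RtoC t)) with (1 - Re z * t) by (simpl; unfold Re; ring).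
  assert (0 <= (1 - Re z) * t) by (apply Rmult_le_pos; lra).
  destruct (Req_dec t 1) as [->|]; lra.
assert (Hc : forall s, Ccontinuous_on (fun t => Cpower (1 - z * RtoC t) s) 0 1).
  intros s t Ht; now apply Ccontinuous_Cpower_line, Hre.
set (phi := fun t => Cpower (1 - z * RtoC t) (- l)).
set (dphi := fun t => (- (- l * z) * Cpower (1 - z * RtoC t) (- l - 1))%C).
assert (Hd : forall t, 0 <= t <= 1 -> is_Cderive phi t (dphi t)).
  intros t Ht; now apply is_Cderive_Cpower_line, Hre.
assert (Hdc : Ccontinuous_on dphi 0 1).
  intros t Ht; apply Ccontinuous_mult; [apply Ccontinuous_const|now apply Hc].
destruct (Cmod_bounded phi 0 1 Rle_0_1 (Hc (- l)%C)) as [K1 [K10 HK1]].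
destruct (Cmod_bounded dphi 0 1 Rle_0_1 Hdc) as [K2 [K20 HK2]].
assert (El : forall r t, (1 - RtoC r * z * RtoC t)%C = (1 - z * RtoC (r * t))%C).
  intros r t; rewrite RtoC_mult; ring.
destruct (multiplier_limit (at_left 1)
  (fun r t => Cpower (1 - RtoC r * z * RtoC t) (- l)) phi g 0 1 (K1 + K2) (m O))
  as [J [HJ L]]; auto using moment_0; try lra.
- intros t Ht; apply Hc; lra.
- generalize at_left_1_half; apply filter_imp; intros r Hr.
  exists (fun t => RtoC r * dphi (r * t)%R)%C, (fun t => K2 * t), (fun _ => K2).
  split; [|split; [|split; [|split; [|split; [|split]]]]]; intros t Ht.
  + apply (is_Cderive_ext (fun t => phi (r * t))).
      intros s; unfold phi; now rewrite El.
    apply (is_Cderive_comp phi (fun t => r * t)); [apply Hd; nra|].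
    auto_derive; [trivial|ring].
  + apply Ccontinuous_mult; [apply Ccontinuous_const|].
    apply (continuous_comp (fun t => r * t) dphi).
      apply (continuous_scal_r (V := R_NormedModule)), continuous_id.
    apply Hdc; nra.
  + auto_derive; [trivial|ring].
  + apply continuous_const.
  + rewrite Cmod_mult, Cmod_R, Rabs_pos_eq by lra.
    assert (B := HK2 (r * t) ltac:(nra)); assert (B0 := Cmod_ge_0 (dphi (r * t))); nra.
  + rewrite El; assert (B := HK1 (r * t) ltac:(nra)); unfold phi in B; lra.
  + rewrite Rabs_pos_eq; nra.
- intros a b eps Ha Hab Hb He.
  assert (A : at_left 1 (fun r => 1 - eps / K2 < r)).
    assert (Hp : 0 < eps / K2) by (apply Rdiv_lt_0_compat; lra).
    exists (mkposreal _ Hp); intros r Hr _.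
    apply Rabs_lt_between in Hr; unfold minus, plus, opp in Hr; simpl in Hr; lra.
  generalize (filter_and _ _ at_left_1_half A); apply filter_imp; intros r [Hr Hr'] t Ht.
  rewrite El.
  replace (_ - _)%C with (- (phi t - phi (r * t)%R))%C by (unfold phi; ring).
  rewrite Cmod_opp.
  eapply Rle_trans; [apply (C_mean_value phi dphi (r * t) t K2)|].
  + nra.
  + intros s Hs; apply Hd; nra.
  + intros s Hs; apply Hdc; nra.
  + intros s Hs; apply HK2; nra.
  + replace eps with (K2 * (eps / K2)) by (field; lra).
    apply Rmult_le_compat_l; nra.
- rewrite (boundary_limit z S J Hz HS L); exact HJ.
Qed.

End Moments.

(** * Powers as multipliers, and the point z = 1 *)

Lemma is_Cderive_Cpower_RtoC (x : R -> R) t k (c : C) : 0 < x t -> is_derive x t k ->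
  is_Cderive (fun t => Cpower (RtoC (x t)) c) t (c * RtoC k * Cpower (RtoC (x t)) (c - 1))%C.
Proof.
intros Hp Hx; apply (is_Cderive_Cpower (fun t => RtoC (x t))); [exact Hp|].
now apply is_Cderive_RtoC.
Qed.

Lemma Rpower_le_1 x y : 0 < x <= 1 -> 0 <= y -> Rpower x y <= 1.
Proof.
intros Hx Hy; unfold Rpower; rewrite <- exp_0; apply exp_le_compat.
assert (ln x <= 0) by (rewrite <- ln_1; apply ln_le; lra).
nra.
Qed.

(** For nonincreasing [x], the modulus of the derivative of x^c is exactly the derivative of - (|c|
    / Re c) x^(Re c), which is bounded because Re c > 0. The constant depends on [c] only, so it is
    common to a whole family of functions [x]. *)
Lemma power_multiplier (x dx : R -> R) (c : C) A B : 0 < Re c ->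
  (forall t, A < t < B -> 0 < x t <= 1) -> (forall t, A < t < B -> is_derive x t (dx t)) ->
  (forall t, A < t < B -> continuous dx t) -> (forall t, A < t < B -> dx t <= 0) ->
  multiplier (fun t => Cpower (RtoC (x t)) c) A B (1 + Cmod c / Re c).
Proof.
intros Hc Hx Hd Hdc Hd0.
assert (Hm := Cmod_ge_0 c).
assert (HV : 0 <= Cmod c / Re c) by (apply Rmult_le_pos; [|apply Rlt_le, Rinv_0_lt_compat]; lra).
assert (Hxc : forall t, A < t < B -> continuous x t).
  intros t Ht; apply (ex_derive_continuous (V := R_NormedModule)); exists (dx t); auto.
exists (fun t => c * RtoC (dx t) * Cpower (RtoC (x t)) (c - 1))%C.
exists (fun t => - (Cmod c / Re c) * Rpower (x t) (Re c)).
exists (fun t => - Cmod c * dx t * Rpower (x t) (Re c - 1)).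
split; [|split; [|split; [|split; [|split; [|split]]]]]; intros t Ht;
  assert (Hxt := Hx t Ht).
- apply is_Cderive_Cpower_RtoC; [lra|now apply Hd].
- apply Ccontinuous_mult.
    apply Ccontinuous_mult; [apply Ccontinuous_const|apply Ccontinuous_RtoC, Hdc, Ht].
  eapply is_Cderive_continuous; apply is_Cderive_Cpower_RtoC; [lra|now apply Hd].
- assert (Hdt := Hd t Ht); unfold Rpower.
  assert (D : Derive (fun t => x t) t = dx t) by exact (is_derive_unique _ _ _ Hdt).
  auto_derive; [split; [eexists; exact Hdt|lra]|].
  rewrite D.
  replace (exp ((Re c - 1) * ln (x t))) with (exp (Re c * ln (x t)) / x t).
    field; lra.
  rewrite <- (exp_ln (x t)) at 2 by lra; unfold Rdiv; rewrite <- exp_Ropp, <- exp_plus.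
  f_equal; ring.
- apply (continuous_mult (K := R_AbsRing) (fun t => - Cmod c * dx t)).
    apply (continuous_scal_r (V := R_NormedModule) (- Cmod c)), Hdc, Ht.
  apply (continuous_comp x (fun y => Rpower y (Re c - 1))); [now apply Hxc|].
  apply (ex_derive_continuous (V := R_NormedModule)); unfold Rpower; auto_derive; lra.
- rewrite !Cmod_mult, Cmod_R, Cmod_Cpower_pos by lra.
  rewrite <- Rabs_Ropp, Rabs_pos_eq by (generalize (Hd0 t Ht); lra).
  right; replace (Re (c - 1)) with (Re c - 1) by (simpl; unfold Re; ring); ring.
- rewrite Cmod_Cpower_pos by lra.
  generalize (Rpower_le_1 (x t) (Re c) Hxt ltac:(lra)); lra.
- rewrite Rabs_mult, Rabs_Ropp, (Rabs_pos_eq (Cmod c / Re c)) by exact HV.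
  assert (0 < Rpower (x t) (Re c)) by apply exp_pos.
  rewrite Rabs_pos_eq by lra.
  generalize (Rpower_le_1 (x t) (Re c) Hxt ltac:(lra)); nra.
Qed.

Lemma Cpower_near_1 (c : C) eps : 0 < eps ->
  exists d, 0 < d /\ forall x, 0 < x -> 1 - d < x <= 1 -> Cmod (Cpower (RtoC x) c - 1) <= eps.
Proof.
intros He.
assert (D : Ccontinuous (fun x => Cpower (RtoC x) c) 1).
  eapply is_Cderive_continuous; apply (is_Cderive_Cpower_RtoC (fun x => x)); [lra|].
  apply (is_derive_id (K := R_AbsRing)).
assert (E1 : Cpower (RtoC 1) c = RtoC 1).
  rewrite Cpower_pos, ln_1, Cmult_0_r by lra; apply Cexp_0.
destruct (D _ (locally_Cmod _ eps He)) as [d Hd].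
exists d; split; [apply cond_pos|]; intros x Hx Hx1.
rewrite <- E1; apply Rlt_le, Hd, Rabs_def1; unfold minus, plus, opp; simpl; lra.
Qed.

(** The ratio for which (1 - r t)^(-l) is [shrink r t] to the power l times (1 - t)^(-l). It
    decreases from 1 to 0 on [0, 1] and tends to 1, locally uniformly, as r tends to 1. *)
Definition shrink (r t : R) : R := (1 - t) / (1 - r * t).

Lemma shrink_range r t : 0 < r < 1 -> 0 < t < 1 -> 0 < shrink r t <= 1.
Proof.
intros Hr Ht; assert (0 < r * t < 1) by nra; unfold shrink; split.
  apply Rdiv_lt_0_compat; lra.
apply (Rmult_le_reg_r (1 - r * t)); [lra|]; field_simplify; nra.
Qed.

Lemma shrink_multiplier r c : 0 < r < 1 -> 0 < Re c ->
  multiplier (fun t => Cpower (RtoC (shrink r t)) c) 0 1 (1 + Cmod c / Re c).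
Proof.
intros Hr Hc.
apply (power_multiplier _ (fun t => - (1 - r) / ((1 - r * t) * (1 - r * t))));
  auto; intros t Ht; assert (Hrt : 0 < r * t < 1) by nra.
- now apply shrink_range.
- unfold shrink; auto_derive; [lra|field; lra].
- apply (ex_derive_continuous (V := R_NormedModule)); auto_derive; nra.
- apply Rmult_le_0_r; [lra|]; apply Rlt_le, Rinv_0_lt_compat; nra.
Qed.

Lemma shrink_near_1 r t b : 0 < r < 1 -> 0 < t <= b -> b < 1 ->
  1 - (1 - r) / (1 - b) <= shrink r t.
Proof.
intros Hr Ht Hb; unfold shrink; assert (0 < r * t < 1) by nra.
replace ((1 - t) / (1 - r * t)) with (1 - t * ((1 - r) / (1 - r * t))) by (field; lra).
assert ((1 - r) / (1 - r * t) <= (1 - r) / (1 - b)).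
  apply Rmult_le_compat_l; [lra|]; apply Rinv_le_contravar; nra.
assert (0 <= (1 - r) / (1 - r * t)).
  apply Rmult_le_pos; [lra|]; apply Rlt_le, Rinv_0_lt_compat; lra.
nra.
Qed.

Lemma at_left_1_near d : 0 < d -> at_left 1 (fun r => 1 - d < r).
Proof.
intros Hd; exists (mkposreal d Hd); intros r Hr _.
apply Rabs_lt_between in Hr; unfold minus, plus, opp in Hr; simpl in Hr; lra.
Qed.

Lemma shrink_power_limit c b eps : b < 1 -> 0 < eps ->
  at_left 1 (fun r => 1 / 2 < r < 1 /\
    forall t, 0 < t <= b -> Cmod (Cpower (RtoC (shrink r t)) c - 1) <= eps).
Proof.
intros Hb He; destruct (Cpower_near_1 c eps He) as [d [Hd D]].
assert (Hd' : 0 < d * (1 - b)) by (apply Rmult_lt_0_compat; lra).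
generalize (filter_and _ _ at_left_1_half (at_left_1_near _ Hd')); apply filter_imp.
intros r [Hr Hr']; split; [exact Hr|]; intros t Ht.
assert (R0 := shrink_range r t ltac:(lra) ltac:(lra)).
apply D; [lra|]; split; [|lra].
eapply Rlt_le_trans; [|apply (shrink_near_1 r t b); lra].
assert ((1 - r) / (1 - b) < d).
  apply (Rmult_lt_reg_r (1 - b)); [lra|]; field_simplify; lra.
lra.
Qed.

Lemma shrink_power r t c : 0 < r < 1 -> 0 < t < 1 ->
  Cpower (RtoC (shrink r t)) c = (Cpower (RtoC (1 - t)) c * Cpower (RtoC (1 - r * t)) (- c))%C.
Proof.
intros Hr Ht; assert (Hrt : 0 < r * t < 1) by nra.
unfold shrink; rewrite !Cpower_pos by (try apply Rdiv_lt_0_compat; lra).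
rewrite <- Cexp_plus; f_equal; rewrite ln_div, RtoC_minus by lra; ring.
Qed.

Section AtOne.

Variables (g : R -> C) (m : nat -> C) (l : C).
Hypothesis Hg : Ccontinuous_in g 0 1.
Hypothesis Hm : forall n, improper (fun t => RtoC (t ^ n) * g t)%C 0 1 (m n).

Let f := (fun t => Cpower (RtoC (1 - t)) (- l) * g t)%C.

Lemma Ccontinuous_in_Cpower_1_minus c : Ccontinuous_in (fun t => Cpower (RtoC (1 - t)) c) 0 1.
Proof.
intros t Ht; eapply is_Cderive_continuous.
apply (is_Cderive_Cpower_RtoC (fun t => 1 - t)); [lra|].
auto_derive; [trivial|reflexivity].
Qed.

Lemma Cpower_line_RtoC r t c :
  Cpower (1 - RtoC r * 1 * RtoC t) c = Cpower (RtoC (1 - r * t)) c.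
Proof. f_equal; rewrite RtoC_minus, RtoC_mult; ring. Qed.

(** Abel's theorem leaves the limit of the integrals of (1 - r t)^(-l) g. For Re l > 0 this
    integrand is a power of [shrink] with exponent l times [f]; for Re l < 0 the factor is itself a
    multiplier of [g]; for Re l = 0 neither exponent has positive real part, so [power_multiplier]
    covers neither form. *)
Lemma integral_one (S I : C) : improper f 0 1 I ->
  Csum_lim (fun n => binom l n * Cpow 1 n * m n)%C S -> S = I.
Proof.
intros HI HS.
assert (Hf : Ccontinuous_in f 0 1).
  apply Ccontinuous_in_mult; [apply Ccontinuous_in_Cpower_1_minus|exact Hg].
assert (M0 := moment_0 g m Hm).
assert (H1 : Cmod 1 <= 1) by (rewrite Cmod_1; lra).
(* Powers of [shrink] with exponent of positive real part are multipliers of [f] tending to 1, so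
   the integrals tend to [I]. This is used with the exponents [l] and [1 + l]. *)
assert (SP : forall c, 0 < Re c -> exists J,
    improper (fun t => 1 * f t)%C 0 1 J /\ J = I /\
    (forall eps, 0 < eps -> at_left 1 (fun r => forall Ji,
       improper (fun t => Cpower (RtoC (shrink r t)) c * f t)%C 0 1 Ji -> Cmod (Ji - J) < eps))).
  intros c Hc.
  destruct (multiplier_limit (at_left 1) (fun r t => Cpower (RtoC (shrink r t)) c)
    (fun _ => RtoC 1) f 0 1 (1 + Cmod c / Re c) I) as [J [HJ L]]; auto; try lra.
  - intros t _; apply Ccontinuous_const.
  - generalize at_left_1_half; apply filter_imp; intros r Hr; apply shrink_multiplier; lra.
  - intros a b eps Ha Hab Hb He.
    generalize (shrink_power_limit c b eps Hb He); apply filter_imp.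
    intros r [Hr D] t Ht; apply D; lra.
  - exists J; split; [exact HJ|]; split; [|exact L].
    apply (improper_unique f 0 1); [|exact HI].
    apply (improper_ext (fun t => 1 * f t)%C); auto; [lra|intros; ring].
destruct (Rtotal_order (Re l) 0) as [Hl|[Hl|Hl]].
- (* Here (1 - r t)^(-l) has bounded variation. *)
  assert (Hl' : 0 < Re (- l)) by (simpl; unfold Re in Hl; lra).
  destruct (multiplier_limit (at_left 1) (fun r t => Cpower (RtoC (1 - r * t)) (- l))
    (fun t => Cpower (RtoC (1 - t)) (- l)) g 0 1 (1 + Cmod (- l) / Re (- l)) (m O))
    as [J [HJ L]]; auto; try lra.
  + apply Ccontinuous_in_Cpower_1_minus.
  + generalize at_left_1_half; apply filter_imp; intros r Hr.
    apply (power_multiplier (fun t => 1 - r * t) (fun _ => - r)); auto; intros t Ht.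
    * nra.
    * auto_derive; [trivial|ring].
    * apply continuous_const.
    * lra.
  + intros a b eps Ha Hab Hb He.
    generalize (shrink_power_limit (- l) b eps Hb He); apply filter_imp.
    intros r [Hr D] t Ht; assert (Hrt : 0 < r * t < 1) by nra.
    (* Extracting (1 - r t)^(-l), of modulus at most 1 here, reduces the convergence to that of a
       power of [shrink]. *)
    assert (E : (Cpower (RtoC (1 - r * t)) (- l) - Cpower (RtoC (1 - t)) (- l)
       = - (Cpower (RtoC (1 - r * t)) (- l) * (Cpower (RtoC (shrink r t)) (- l) - 1)))%C).
      rewrite shrink_power by lra.
      assert (P := Cpower_opp (RtoC (1 - r * t)) (- l) ltac:(apply RtoC_neq_0; lra)).
      set (u := Cpower (RtoC (1 - r * t)) (- l)) in *.
      set (v := Cpower (RtoC (1 - r * t)) (- - l)) in *.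
      set (w := Cpower (RtoC (1 - t)) (- l)).
      replace (- (u * (w * v - 1)))%C with (u - w * (u * v))%C by ring.
      rewrite P; ring.
    rewrite E, Cmod_opp, Cmod_mult, Cmod_Cpower_pos by lra.
    assert (Q := Rpower_le_1 (1 - r * t) (Re (- l)) ltac:(lra) ltac:(lra)).
    assert (Q0 : 0 < Rpower (1 - r * t) (Re (- l))) by apply exp_pos.
    specialize (D t ltac:(lra)).
    assert (D0 := Cmod_ge_0 (Cpower (RtoC (shrink r t)) (- l) - 1)); nra.
  + replace I with J by (apply (improper_unique f 0 1); assumption).
    apply (boundary_limit g m l Hg Hm 1 S J H1 HS).
    intros eps He; generalize (L eps He); apply filter_imp; intros r Hr F HF.
    apply Hr; revert HF; apply improper_ext; [lra|].
    intros t Ht; now rewrite Cpower_line_RtoC.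
- (* With s := (1 - t) / (1 - r t), split (1 - r t)^(-l) with the weights s and 1 - s. *)
  assert (Hl1 : 0 < Re (1 + l)) by (simpl; unfold Re in Hl; lra).
  destruct (SP (1 + l)%C Hl1) as [J1 [_ [EJ1 L1]]].
  set (K := 1 + Cmod (1 + l)).
  assert (HK : 1 <= K) by (unfold K; generalize (Cmod_ge_0 (1 + l)); lra).
  (* This is (1 - s) (1 - r t)^(-l), since 1 - s = (1 - r) t / (1 - r t). *)
  set (psi := fun r t => (RtoC ((1 - r) * t) * Cpower (RtoC (1 - r * t)) (- 1 - l))%C).
  assert (Re1 : Re (- 1 - l) = -1) by (simpl; unfold Re in Hl; lra).
  assert (Re2 : Re (- 1 - l - 1) = -2) by (simpl; unfold Re in Hl; lra).
  assert (Cm1 : forall x, 0 < x -> Cmod (Cpower (RtoC x) (- 1 - l)) = / x).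
    intros x Hx; rewrite Cmod_Cpower_pos, Re1 by lra.
    replace (-1) with (- (1)) by ring; rewrite Rpower_Ropp, Rpower_1 by lra; reflexivity.
  assert (Cm2 : forall x, 0 < x -> Cmod (Cpower (RtoC x) (- 1 - l - 1)) = / x * / x).
    intros x Hx; rewrite Cmod_Cpower_pos, Re2 by lra.
    replace (-2) with (- (1) + - (1)) by ring.
    rewrite Rpower_plus, Rpower_Ropp, Rpower_1 by lra; reflexivity.
  assert (MU : forall r, 1 / 2 < r < 1 -> multiplier (psi r) 0 1 (2 * K)).
    intros r Hr.
    exists (fun t => RtoC (1 - r) * Cpower (RtoC (1 - r * t)) (- 1 - l) +
      RtoC ((1 - r) * t) * ((- 1 - l) * RtoC (- r) * Cpower (RtoC (1 - r * t)) (- 1 - l - 1)))%C.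
    (* A primitive of K (1 - r) / (1 - r t)^2, which dominates the derivative of [psi r]. It is at
       most [2 * K] because (1 - r) / (1 - r t) <= 1 and r > 1/2. *)
    exists (fun t => K * (1 - r) / r / (1 - r * t)).
    exists (fun t => K * (1 - r) / ((1 - r * t) * (1 - r * t))).
    assert (Hline : forall t, is_derive (fun t => 1 - r * t) t (- r)).
      intros t; auto_derive; [trivial|ring].
    split; [|split; [|split; [|split; [|split; [|split]]]]]; intros t Ht;
      assert (Hrt : 0 < r * t < 1) by nra;
      assert (Hi : 1 <= / (1 - r * t))
        by (rewrite <- Rinv_1 at 1; apply Rinv_le_contravar; lra);
      assert (Hi2 : (1 - r) * / (1 - r * t) <= 1)
        by (apply (Rmult_le_reg_r (1 - r * t)); [lra|]; field_simplify; nra).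
    + apply (is_Cderive_mult (fun t => RtoC ((1 - r) * t))).
        apply is_Cderive_RtoC; auto_derive; [trivial|ring].
      apply (is_Cderive_Cpower_RtoC (fun t => 1 - r * t)); [lra|apply Hline].
    + assert (Q : forall c, Ccontinuous (fun t => Cpower (RtoC (1 - r * t)) c) t).
        intros c; eapply is_Cderive_continuous.
        apply (is_Cderive_Cpower_RtoC (fun t => 1 - r * t)); [lra|apply Hline].
      apply Ccontinuous_plus; apply Ccontinuous_mult;
        try apply Ccontinuous_const; try apply Q.
        apply Ccontinuous_RtoC, (continuous_scal_r (V := R_NormedModule)), continuous_id.
      apply Ccontinuous_mult; [apply Ccontinuous_const|apply Q].
    + auto_derive; [lra|field; lra].
    + apply (ex_derive_continuous (V := R_NormedModule)); auto_derive; nra.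
    + eapply Rle_trans; [apply Cmod_triangle|].
      rewrite !Cmod_mult, Cm1, Cm2, !Cmod_R by lra.
      rewrite Rabs_Ropp, (Rabs_pos_eq r), (Rabs_pos_eq (1 - r)), (Rabs_pos_eq ((1 - r) * t))
        by nra.
      replace (Cmod (- 1 - l)) with (Cmod (1 + l)).
      2:{ rewrite <- Cmod_opp; f_equal; ring. }
      unfold K; set (i := / (1 - r * t)) in *; set (k := Cmod (1 + l)).
      assert (Hk : 0 <= k) by apply Cmod_ge_0.
      replace ((1 + k) * (1 - r) / ((1 - r * t) * (1 - r * t)))
        with ((1 - r) * (i * i) + (1 - r) * (k * (i * i))) by (unfold i; field; lra).
      apply Rplus_le_compat.
        apply Rmult_le_compat_l; nra.
      replace ((1 - r) * t * (k * r * (i * i))) with ((1 - r) * (k * (i * i)) * (r * t)) by ring.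
      assert (0 <= (1 - r) * (k * (i * i))) by (repeat apply Rmult_le_pos; lra).
      nra.
    + unfold psi; rewrite Cmod_mult, Cm1, Cmod_R, Rabs_pos_eq by nra.
      set (i := / (1 - r * t)) in *.
      replace ((1 - r) * t * i) with ((1 - r) * i * t) by ring.
      assert (0 <= (1 - r) * i) by (apply Rmult_le_pos; lra); nra.
    + replace (K * (1 - r) / r / (1 - r * t)) with (K * ((1 - r) * / (1 - r * t)) * / r)
        by (field; lra).
      set (i := / (1 - r * t)) in *.
      assert (Hj : 0 < / r <= 2).
        split; [apply Rinv_0_lt_compat; lra|].
        replace 2 with (/ (1 / 2)) by field; apply Rinv_le_contravar; lra.
      assert (0 <= (1 - r) * i) by (apply Rmult_le_pos; lra).
      assert (0 <= K * ((1 - r) * i) <= K) by (split; nra).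
      rewrite Rabs_pos_eq by (apply Rmult_le_pos; lra).
      rewrite (Rmult_comm 2); apply Rmult_le_compat; lra.
  destruct (multiplier_limit (at_left 1) psi (fun _ => RtoC 0) g 0 1 (2 * K) (m O))
    as [J2 [HJ2 L2]]; auto; try lra.
  + intros t _; apply Ccontinuous_const.
  + generalize at_left_1_half; apply filter_imp; exact MU.
  + intros a b eps Ha Hab Hb He.
    assert (Hd' : 0 < eps * (1 - b)) by (apply Rmult_lt_0_compat; lra).
    generalize (filter_and _ _ at_left_1_half (at_left_1_near _ Hd')); apply filter_imp.
    intros r [Hr Hr'] t Ht; assert (Hrt : 0 < r * t < 1) by nra.
    unfold psi; replace (_ - 0)%C with (RtoC ((1 - r) * t) * Cpower (RtoC (1 - r * t)) (- 1 - l))%C by ring.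
    rewrite Cmod_mult, Cm1, Cmod_R, Rabs_pos_eq by nra.
    apply (Rmult_le_reg_r (1 - r * t)); [lra|].
    rewrite Rmult_assoc, Rinv_l, Rmult_1_r by lra.
    assert (eps * (1 - b) <= eps * (1 - r * t)) by (apply Rmult_le_compat_l; nra).
    nra.
  + assert (EJ2 : J2 = 0%C).
      replace (RtoC 0) with (0 * m O)%C by ring.
      apply (improper_unique (fun t => 0 * g t)%C 0 1); [exact HJ2|].
      apply improper_scal; auto; lra.
    apply (boundary_limit g m l Hg Hm 1 S I H1 HS).
    intros eps He.
    assert (He' : 0 < eps / 2) by lra.
    generalize (filter_and _ _ at_left_1_half (filter_and _ _ (L1 _ He') (L2 _ He'))).
    apply filter_imp.
    intros r [Hr [X1 X2]] F HF.
    assert (MS := shrink_multiplier r (1 + l) ltac:(lra) Hl1).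
    destruct (multiplier_improper _ f 0 1 _ I Rlt_0_1 MS Hf HI) as [F1 HF1].
    destruct (multiplier_improper _ g 0 1 _ (m O) Rlt_0_1 (MU r Hr) Hg M0) as [F2 HF2].
    assert (EF : F = (F1 + F2)%C).
      apply (improper_unique _ _ _ _ _ HF).
      apply (improper_ext (fun t => Cpower (RtoC (shrink r t)) (1 + l) * f t + psi r t * g t)%C);
        [lra| |].
        intros t Ht; assert (Hrt : 0 < r * t < 1) by nra.
        rewrite Cpower_line_RtoC, shrink_power by lra; unfold f, psi.
        assert (N1 : RtoC (1 - t) <> 0) by (apply RtoC_neq_0; lra).
        assert (N2 : RtoC (1 - r * t) <> 0) by (apply RtoC_neq_0; lra).
        assert (P1 := Cpower_opp (RtoC (1 - t)) l N1).
        assert (P2 := Cpower_1 (RtoC (1 - r * t))).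
        rewrite Cpower_plus, Cpower_1 by exact N1.
        replace (- (1 + l))%C with (- 1 - l)%C by ring.
        replace (Cpower (RtoC (1 - r * t)) (- l))
          with (RtoC (1 - r * t) * Cpower (RtoC (1 - r * t)) (- 1 - l))%C.
        2:{ rewrite <- P2 at 1; rewrite <- Cpower_plus by exact N2; f_equal; ring. }
        set (u := Cpower (RtoC (1 - t)) l) in *; set (v := Cpower (RtoC (1 - t)) (- l)) in *.
        set (w := Cpower (RtoC (1 - r * t)) (- 1 - l)).
        replace (RtoC (1 - t) * u * w * (v * g t) + RtoC ((1 - r) * t) * w * g t)%C
          with ((RtoC (1 - t) * (u * v) + RtoC ((1 - r) * t)) * w * g t)%C by ring.
        rewrite P1; replace (RtoC (1 - r * t)) with (RtoC (1 - t) * 1 + RtoC ((1 - r) * t))%C.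
          reflexivity.
        rewrite <- RtoC_mult, <- RtoC_plus; f_equal; ring.
      apply improper_plus; auto; try lra; apply Ccontinuous_in_mult; auto;
        [apply (multiplier_continuous _ _ _ _ MS)|apply (multiplier_continuous _ _ _ _ (MU r Hr))].
    specialize (X1 F1 HF1); specialize (X2 F2 HF2).
    rewrite EF; rewrite EJ1 in X1; rewrite EJ2 in X2.
    replace (F1 + F2 - I)%C with ((F1 - I) + (F2 - 0))%C by ring.
    eapply Rle_lt_trans; [apply Cmod_triangle|]; lra.
- destruct (SP l Hl) as [J [_ [EJ L]]].
  apply (boundary_limit g m l Hg Hm 1 S I H1 HS).
  intros eps He; generalize (filter_and _ _ at_left_1_half (L eps He)); apply filter_imp.
  intros r [Hr Lr] F HF; rewrite <- EJ; apply Lr; revert HF; apply improper_ext; [lra|].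
  intros t Ht; rewrite Cpower_line_RtoC, shrink_power by lra; unfold f.
  assert (P := Cpower_opp (RtoC (1 - t)) l ltac:(apply RtoC_neq_0; lra)).
  set (u := Cpower (RtoC (1 - t)) l) in *; set (v := Cpower (RtoC (1 - t)) (- l)) in *.
  set (w := Cpower (RtoC (1 - r * t)) (- l)).
  replace (u * w * (v * g t))%C with (u * v * (w * g t))%C by ring.
  rewrite P; ring.
Qed.

End AtOne.

(** * Entire power series vanishing on a half-line *)

(** Beyond a finite radius of convergence the terms cannot tend to 0, and the hypothesis reaches
    arbitrarily large [x]. *)
Lemma CV_radius_infinite (a : nat -> R) x0 :
  (forall x, x0 < x -> is_lim_seq (fun n => a n * x ^ n) 0) -> CV_radius a = p_infty.
Proof.
intros H.
assert (N : forall y, ~ Rbar_lt (CV_radius a) (Finite y)).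
  intros y Hy; set (x := Rmax (Rabs x0 + 1) (Rabs y)).
  assert (X1 : Rabs x0 + 1 <= x) by apply Rmax_l.
  assert (X2 : Rabs y <= x) by apply Rmax_r.
  assert (X0 := Rabs_pos x0); assert (X3 := Rle_abs x0); assert (X4 := Rle_abs y).
  apply (CV_disk_outside a x); [|apply H; lra].
  rewrite Rabs_pos_eq by lra; eapply Rbar_lt_le_trans; [exact Hy|simpl; lra].
destruct (CV_radius a) as [y| |]; [|reflexivity|].
  elim (N (y + 1)); simpl; lra.
elim (N 0); exact I.
Qed.

(** The left side is a binomial coefficient; Pascal's rule and a double induction bound it. *)
Lemma fact_binomial_bound (j k : nat) :
  INR (fact (j + k)) / (INR (fact j) * INR (fact k)) <= 2 ^ (j + k).
Proof.
assert (F : forall n, 0 < INR (fact n)) by (intros; apply INR_fact_lt_0).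
revert k; induction j as [|j IHj]; intros k.
  replace (INR (fact (0 + k)) / (INR (fact 0) * INR (fact k))) with 1.
    apply pow_R1_Rle; lra.
  simpl; field; apply Rgt_not_eq, F.
induction k as [|k IHk].
  rewrite Nat.add_0_r.
  replace (INR (fact (S j)) / (INR (fact (S j)) * INR (fact 0))) with 1.
    apply pow_R1_Rle; lra.
  change (INR (fact 0)) with 1; field; apply Rgt_not_eq, F.
replace (INR (fact (S j + S k)) / (INR (fact (S j)) * INR (fact (S k))))
  with (INR (fact (j + S k)) / (INR (fact j) * INR (fact (S k)))
    + INR (fact (S j + k)) / (INR (fact (S j)) * INR (fact k))).
  specialize (IHj (S k)).
  replace (S j + S k)%nat with (S (j + S k)) by lia.
  replace (S j + k)%nat with (j + S k)%nat in * by lia; simpl pow; lra.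
replace (S j + S k)%nat with (S (j + S k)) by lia.
replace (S j + k)%nat with (j + S k)%nat by lia.
rewrite (fact_simpl (j + S k)), (fact_simpl j), (fact_simpl k), !mult_INR.
replace (S (j + S k)) with (S j + S k)%nat by lia; rewrite (plus_INR (S j)).
field; repeat split; try (apply Rgt_not_eq, F); apply not_0_INR; lia.
Qed.

(** A Cauchy estimate on the Taylor remainder over distances up to [2 * x0]. The 8 is 2 * 2 * 2: one
    2 absorbs the binomial coefficient, one the distance, and the last leaves (1/2)^(k + n), whose
    sum over k is 2 (1/2)^n. *)
Lemma Derive_n_PSeries_bound (a : nat -> R) x0 K n y : 0 <= x0 -> CV_radius a = p_infty ->
  (forall k, Rabs (a k) * (8 * x0) ^ k <= K) -> Rabs y <= x0 ->
  (2 * x0) ^ n / INR (fact n) * Rabs (Derive_n (PSeries a) n y) <= 2 * K * (1 / 2) ^ n.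
Proof.
intros Hx0 HR HK Hy.
assert (F : forall n, 0 < INR (fact n)) by (intros; apply INR_fact_lt_0).
rewrite Derive_n_PSeries by (rewrite HR; exact I); unfold PSeries.
set (c := (2 * x0) ^ n / INR (fact n)).
assert (Hc : 0 <= c).
  apply Rmult_le_pos; [apply pow_le; lra|apply Rlt_le, Rinv_0_lt_compat, F].
assert (Hh : Rabs (1 / 2) < 1) by (rewrite Rabs_pos_eq; lra).
assert (B : forall k, 0 <= Rabs (c * (PS_derive_n n a k * y ^ k))
    <= K * (1 / 2) ^ n * (1 / 2) ^ k).
  intros k; split; [apply Rabs_pos|].
  unfold PS_derive_n; rewrite !Rabs_mult, (Rabs_pos_eq c) by exact Hc.
  rewrite (Rabs_pos_eq (_ / _)).
  2:{ apply Rmult_le_pos; [|apply Rlt_le, Rinv_0_lt_compat]; [apply Rlt_le|]; apply F. }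
  rewrite <- RPow_abs.
  apply Rle_trans with (c * (INR (fact (k + n)) / INR (fact k) * Rabs (a (k + n)%nat) * x0 ^ k)).
    apply Rmult_le_compat_l; [exact Hc|]; apply Rmult_le_compat_l.
      apply Rmult_le_pos; [|apply Rabs_pos].
      apply Rmult_le_pos; [|apply Rlt_le, Rinv_0_lt_compat]; [apply Rlt_le|]; apply F.
    apply pow_incr; split; [apply Rabs_pos|exact Hy].
  replace (c * (INR (fact (k + n)) / INR (fact k) * Rabs (a (k + n)%nat) * x0 ^ k))
    with (INR (fact (k + n)) / (INR (fact k) * INR (fact n)) *
      (Rabs (a (k + n)%nat) * (2 ^ n * x0 ^ (k + n)))).
  2:{ unfold c; rewrite Rpow_mult_distr, pow_add; field.
      split; apply Rgt_not_eq, F. }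
  apply Rle_trans with (2 ^ (k + n) * (Rabs (a (k + n)%nat) * (2 ^ (k + n) * x0 ^ (k + n)))).
    assert (P1 : 0 <= Rabs (a (k + n)%nat)) by apply Rabs_pos.
    assert (P2 : 0 <= x0 ^ (k + n)) by now apply pow_le.
    assert (P3 : 0 <= 2 ^ n) by (apply pow_le; lra).
    apply Rmult_le_compat; [| |apply fact_binomial_bound|].
    - apply Rmult_le_pos; [apply Rlt_le, F|].
      apply Rlt_le, Rinv_0_lt_compat, Rmult_lt_0_compat; apply F.
    - repeat apply Rmult_le_pos; assumption.
    - apply Rmult_le_compat_l; [exact P1|]; apply Rmult_le_compat_r; [exact P2|].
      apply Rle_pow; [lra|lia].
  replace (K * (1 / 2) ^ n * (1 / 2) ^ k) with (K * (1 / 2) ^ (k + n))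
    by (rewrite pow_add; ring).
  replace (2 ^ (k + n) * (Rabs (a (k + n)%nat) * (2 ^ (k + n) * x0 ^ (k + n))))
    with (Rabs (a (k + n)%nat) * (8 * x0) ^ (k + n) * (1 / 2) ^ (k + n)).
    apply Rmult_le_compat_r; [apply pow_le; lra|apply HK].
  replace ((8 * x0) ^ (k + n)) with (8 ^ (k + n) * x0 ^ (k + n)) by (now rewrite Rpow_mult_distr).
  replace (2 ^ (k + n) * (Rabs (a (k + n)%nat) * (2 ^ (k + n) * x0 ^ (k + n))))
    with (Rabs (a (k + n)%nat) * x0 ^ (k + n) * ((2 * 2) ^ (k + n)))
    by (rewrite Rpow_mult_distr; ring).
  replace (Rabs (a (k + n)%nat) * (8 ^ (k + n) * x0 ^ (k + n)) * (1 / 2) ^ (k + n))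
    with (Rabs (a (k + n)%nat) * x0 ^ (k + n) * (8 * (1 / 2)) ^ (k + n))
    by (rewrite Rpow_mult_distr; ring).
  f_equal; f_equal; field.
assert (S : is_series (fun k => K * (1 / 2) ^ n * (1 / 2) ^ k) (K * (1 / 2) ^ n * / (1 - 1 / 2))).
  exact (is_series_scal_l (K * (1 / 2) ^ n) _ _ (is_series_geom _ Hh)).
rewrite <- (Rabs_pos_eq c) by exact Hc; rewrite <- Rabs_mult, <- Series_scal_l.
eapply Rle_trans.
  apply Series_Rabs.
  apply (ex_series_le (V := R_CompleteNormedModule) _ (fun k => K * (1 / 2) ^ n * (1 / 2) ^ k)).
    intros k; change (Rabs (Rabs (c * (PS_derive_n n a k * y ^ k))) <= K * (1 / 2) ^ n * (1 / 2) ^ k).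
    rewrite Rabs_Rabsolu; apply B.
  eexists; exact S.
eapply Rle_trans.
  apply (Series_le _ _ B); eexists; exact S.
rewrite (is_series_unique _ _ S); right; field.
Qed.

(* Taylor's formula at a point of the half-line shows that the sum of the series vanishes
   near 0. *)
Lemma entire_zero (a : nat -> R) s0 : CV_radius a = p_infty ->
  (forall s, s0 < s -> PSeries a s = 0) -> forall n, a n = 0.
Proof.
intros HR Hz.
set (x0 := Rabs s0 + 1).
assert (X0 : 0 < x0) by (unfold x0; generalize (Rabs_pos s0); lra).
assert (X1 : s0 < x0) by (unfold x0; generalize (Rle_abs s0); lra).
(* [Taylor_Lagrange] expands to the right of its base point, while the zeros lie to the right of the
   target; the reflection exchanges the sides, with base point [- x0]. *)
set (F := fun t => PSeries a (- t)).
assert (ED : forall k t, ex_derive_n (PSeries a) k t).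
  intros k t; apply ex_derive_n_PSeries; rewrite HR; exact I.
assert (EF : forall k t, ex_derive_n F k t).
  intros k t; apply ex_derive_n_comp_opp; exists (mkposreal 1 Rlt_0_1); intros; apply ED.
assert (DF : forall k t, Derive_n F k t = (-1) ^ k * Derive_n (PSeries a) k (- t)).
  intros k t; apply Derive_n_comp_opp; exists (mkposreal 1 Rlt_0_1); intros; apply ED.
assert (D0 : forall k, Derive_n (PSeries a) k x0 = 0).
  intros k; rewrite (Derive_n_ext_loc _ (fun _ => 0)).
    destruct k; [reflexivity|apply Derive_n_const].
  generalize (open_gt s0 x0 X1); apply filter_imp; exact Hz.
assert (T : is_lim_seq (fun n => a n * (8 * x0) ^ n) 0).
  apply ex_series_lim_0.
  assert (P : ex_pseries a (8 * x0)) by (apply CV_radius_inside; rewrite HR; exact I).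
  revert P; apply ex_series_ext; intros n; rewrite pow_n_pow; apply Rmult_comm.
destruct (filterlim_bounded (fun n => a n * (8 * x0) ^ n)) as [K HK]; [exists 0; exact T|].
assert (HK' : forall k, Rabs (a k) * (8 * x0) ^ k <= K).
  intros k; eapply Rle_trans; [|apply (HK k)]; right.
  change (Rabs (a k) * (8 * x0) ^ k = Rabs (a k * (8 * x0) ^ k)).
  rewrite Rabs_mult, (Rabs_pos_eq (_ ^ _)); [reflexivity|apply pow_le; lra].
assert (Z : forall y, - x0 < y < x0 -> F y = 0).
  intros y Hy.
  assert (B : forall n, Rabs (F y) <= 2 * K * (1 / 2) ^ S n).
    intros n; destruct (Taylor_Lagrange F n (- x0) y) as [zeta [Hzeta E]]; [lra| |].
      intros t _ k _; apply EF.
    rewrite E, (sum_eq_R0 (fun m => (y - - x0) ^ m / INR (fact m) * Derive_n F m (- x0))).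
    2:{ intros m _; rewrite DF, Ropp_involutive, D0; ring. }
    rewrite Rplus_0_l, DF, !Rabs_mult, <- (RPow_abs (-1)).
    replace (Rabs (-1)) with 1 by (rewrite Rabs_left; lra); rewrite pow1, Rmult_1_l.
    eapply Rle_trans; [|apply (Derive_n_PSeries_bound a x0 K (S n) (- zeta)); auto; try lra].
    2:{ apply Rabs_le; lra. }
    apply Rmult_le_compat_r; [apply Rabs_pos|].
    assert (0 < / INR (fact (S n))) by (apply Rinv_0_lt_compat, INR_fact_lt_0).
    unfold Rdiv; rewrite Rabs_pos_eq by (apply Rmult_le_pos; [apply pow_le|]; lra).
    apply Rmult_le_compat_r; [lra|]; apply pow_incr; lra.
  assert (L : is_lim_seq (fun n => 2 * K * (1 / 2) ^ S n) 0).
    replace (Finite 0) with (Rbar_mult (2 * K) 0) by (simpl; f_equal; ring).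
    apply is_lim_seq_scal_l.
    apply (is_lim_seq_incr_1 (fun n => (1 / 2) ^ n)), is_lim_seq_geom.
    rewrite Rabs_pos_eq; lra.
  assert (Q := is_lim_seq_le _ _ _ _ B (is_lim_seq_const (Rabs (F y))) L); simpl in Q.
  generalize (Rabs_pos (F y)); intros Q'.
  destruct (Req_dec (F y) 0) as [E|E]; [exact E|]; apply Rabs_pos_lt in E; lra.
intros n; change (a n = (fun _ => 0) n); apply PSeries_ext_recip.
- rewrite HR; exact I.
- rewrite CV_radius_const_0; exact I.
- exists (mkposreal x0 X0); intros y Hy.
  rewrite PSeries_const_0; rewrite <- (Ropp_involutive y); apply Z.
  apply Rabs_lt_between in Hy; unfold minus, plus, opp in Hy; simpl in Hy; lra.
Qed.

(** * Beta integrals *)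

Lemma improper_derive (F f : R -> C) A B (l1 l2 : C) : A < B ->
  (forall t, A < t < B -> is_Cderive F t (f t)) -> Ccontinuous_in f A B ->
  (forall eps, 0 < eps -> exists d, 0 < d /\ forall t, A < t < A + d -> Cmod (F t - l1) < eps) ->
  (forall eps, 0 < eps -> exists d, 0 < d /\ forall t, B - d < t < B -> Cmod (F t - l2) < eps) ->
  improper f A B (l2 - l1).
Proof.
intros HAB HF Hf H1 H2 eps He.
destruct (H1 (eps / 2)) as [d1 [Hd1 D1]]; [lra|].
destruct (H2 (eps / 2)) as [d2 [Hd2 D2]]; [lra|].
exists (Rmin (Rmin d1 d2) ((B - A) / 2)); split; [repeat apply Rmin_pos; lra|].
intros a b Ha Hb.
assert (M1 := Rmin_l (Rmin d1 d2) ((B - A) / 2)).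
assert (M2 := Rmin_r (Rmin d1 d2) ((B - A) / 2)).
assert (M3 := Rmin_l d1 d2); assert (M4 := Rmin_r d1 d2).
rewrite (CRInt_unique f a b (F b - F a)%C).
2:{ apply (is_RInt_derive (V := C_R_CompleteNormedModule) F f);
    rewrite Rmin_left, Rmax_right by lra; intros t Ht; [apply HF|apply Hf]; lra. }
replace (F b - F a - (l2 - l1))%C with ((F b - l2) + - (F a - l1))%C by ring.
eapply Rle_lt_trans; [apply Cmod_triangle|]; rewrite Cmod_opp.
generalize (D1 a ltac:(lra)) (D2 b ltac:(lra)); lra.
Qed.

Lemma Cpower_near_0 (c : C) eps : 0 < Re c -> 0 < eps ->
  exists d, 0 < d /\ forall t, 0 < t < d -> Cmod (Cpower (RtoC t) c) < eps.
Proof.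
intros Hc He; exists (Rpower eps (/ Re c)); split; [apply exp_pos|].
intros t Ht; rewrite Cmod_Cpower_pos by lra.
replace eps with (Rpower (Rpower eps (/ Re c)) (Re c)).
  apply Rlt_Rpower_l; lra.
rewrite Rpower_mult, Rinv_l, Rpower_1; lra.
Qed.

Definition Beta_integrand (x y : C) (t : R) : C :=
  (Cpower (RtoC t) (x - 1) * Cpower (1 - RtoC t) (y - 1))%C.

Lemma is_Cderive_Cpower_id (c : C) t : 0 < t ->
  is_Cderive (fun t => Cpower (RtoC t) c) t (c * Cpower (RtoC t) (c - 1))%C.
Proof.
intros Ht; eapply is_Cderive_eq.
  apply (is_Cderive_Cpower_RtoC (fun t => t)); [exact Ht|].
  apply (is_derive_id (K := R_AbsRing)).
change (c * 1 * Cpower t (c - 1) = c * Cpower t (c - 1))%C; ring.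
Qed.

Lemma is_Cderive_Cpower_1_minus (c : C) t : t < 1 ->
  is_Cderive (fun t => Cpower (1 - RtoC t) c) t (- (c * Cpower (1 - RtoC t) (c - 1)))%C.
Proof.
intros Ht.
apply (is_Cderive_ext (fun t => Cpower (RtoC (1 - t)) c)).
  intros s; now rewrite RtoC_minus.
eapply is_Cderive_eq.
  apply (is_Cderive_Cpower_RtoC (fun t => 1 - t)); [lra|].
  auto_derive; [trivial|reflexivity].
rewrite RtoC_minus; replace (RtoC (- (1))) with (- RtoC 1)%C by now rewrite <- RtoC_opp.
ring.
Qed.

Lemma Ccontinuous_in_Beta (x y : C) : Ccontinuous_in (Beta_integrand x y) 0 1.
Proof.
intros t Ht; apply Ccontinuous_mult.
  eapply is_Cderive_continuous; apply is_Cderive_Cpower_id; lra.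
eapply is_Cderive_continuous; apply is_Cderive_Cpower_1_minus; lra.
Qed.

Lemma Cmod_Cpower_1_minus_le (c : C) t : 0 < t < 1 -> 0 < Re c ->
  Cmod (Cpower (1 - RtoC t) c) <= 1.
Proof.
intros Ht Hc; rewrite <- RtoC_minus, Cmod_Cpower_pos by lra; apply Rpower_le_1; lra.
Qed.

Lemma Cmod_Cpower_le (c : C) t : 0 < t < 1 -> 0 < Re c -> Cmod (Cpower (RtoC t) c) <= 1.
Proof. intros Ht Hc; rewrite Cmod_Cpower_pos by lra; apply Rpower_le_1; lra. Qed.

(* Integrating the derivatives of [t^x / x], which gives an integrable function, and of
   [t^x (1 - t)^y]. *)
Lemma Beta_recurrence (x y : C) : 0 < Re x -> 0 < Re y -> exists J J1,
  improper (Beta_integrand x y) 0 1 J /\ improper (Beta_integrand (x + 1) y) 0 1 J1 /\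
  (x * J = (x + y) * J1)%C.
Proof.
intros Hx Hy.
assert (Nx : x <> 0) by (intros E; rewrite E in Hx; simpl in Hx; lra).
assert (Ny : y <> 0) by (intros E; rewrite E in Hy; simpl in Hy; lra).
assert (I0 : improper (fun t => x * Cpower (RtoC t) (x - 1))%C 0 1 (1 - 0)).
  apply (improper_derive (fun t => Cpower (RtoC t) x)); [lra| | | |].
  - intros t Ht; apply is_Cderive_Cpower_id; lra.
  - intros t Ht; apply Ccontinuous_mult; [apply Ccontinuous_const|].
    eapply is_Cderive_continuous; apply is_Cderive_Cpower_id; lra.
  - intros eps He; destruct (Cpower_near_0 x eps Hx He) as [d [Hd D]].
    exists d; split; [exact Hd|]; intros t Ht.
    replace (_ - 0)%C with (Cpower (RtoC t) x) by ring; apply D; lra.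
  - intros eps He; destruct (Cpower_near_1 x (eps / 2)) as [d [Hd D]]; [lra|].
    exists (Rmin d 1); split; [apply Rmin_pos; lra|]; intros t Ht.
    assert (M1 := Rmin_l d 1); assert (M2 := Rmin_r d 1).
    eapply Rle_lt_trans; [apply D; lra|lra].
assert (C0 : Ccontinuous_in (fun t => x * Cpower (RtoC t) (x - 1))%C 0 1).
  intros t Ht; apply Ccontinuous_mult; [apply Ccontinuous_const|].
  eapply is_Cderive_continuous; apply is_Cderive_Cpower_id; lra.
assert (MP : multiplier (fun t => Cpower (RtoC (1 - t)) y) 0 1 (1 + Cmod y / Re y)).
  apply (power_multiplier (fun t => 1 - t) (fun _ => - (1))); auto; intros t Ht.
  - lra.
  - auto_derive; [trivial|reflexivity].
  - apply continuous_const.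
  - lra.
(* [P] is x B(x, y + 1): the integrable derivative of t^x times the multiplier (1 - t)^y. *)
destruct (multiplier_improper _ _ 0 1 _ _ Rlt_0_1 MP C0 I0) as [P HP].
set (f := fun t => (x * Beta_integrand x (y + 1) t)%C).
set (h := fun t => (- (y * Beta_integrand (x + 1) y t))%C).
assert (HP' : improper f 0 1 P).
  revert HP; apply improper_ext; [lra|]; intros t Ht; unfold f, Beta_integrand.
  rewrite RtoC_minus; replace (y + 1 - 1)%C with y by ring; ring.
assert (Cf : Ccontinuous_in f 0 1).
  intros t Ht; apply Ccontinuous_mult; [apply Ccontinuous_const|now apply Ccontinuous_in_Beta].
assert (Ch : Ccontinuous_in h 0 1).
  intros t Ht; apply Ccontinuous_opp, Ccontinuous_mult;
    [apply Ccontinuous_const|now apply Ccontinuous_in_Beta].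
assert (ID : improper (fun t => f t + h t)%C 0 1 (0 - 0)).
  apply (improper_derive (fun t => Cpower (RtoC t) x * Cpower (1 - RtoC t) y)%C); [lra| | | |].
  - intros t Ht; eapply is_Cderive_eq.
      apply is_Cderive_mult; [apply is_Cderive_Cpower_id; lra|].
      apply is_Cderive_Cpower_1_minus; lra.
    unfold f, h, Beta_integrand.
    replace (x + 1 - 1)%C with x by ring; replace (y + 1 - 1)%C with y by ring; ring.
  - intros t Ht; apply Ccontinuous_plus; [now apply Cf|now apply Ch].
  - intros eps He; destruct (Cpower_near_0 x eps Hx He) as [d [Hd D]].
    exists (Rmin d 1); split; [apply Rmin_pos; lra|]; intros t Ht.
    assert (M1 := Rmin_l d 1); assert (M2 := Rmin_r d 1).
    replace (_ - 0)%C with (Cpower (RtoC t) x * Cpower (1 - RtoC t) y)%C by ring.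
    rewrite Cmod_mult; eapply Rle_lt_trans; [|apply (D t); lra].
    rewrite <- Rmult_1_r; apply Rmult_le_compat_l; [apply Cmod_ge_0|].
    apply Cmod_Cpower_1_minus_le; lra.
  - intros eps He; destruct (Cpower_near_0 y eps Hy He) as [d [Hd D]].
    exists (Rmin d 1); split; [apply Rmin_pos; lra|]; intros t Ht.
    assert (M1 := Rmin_l d 1); assert (M2 := Rmin_r d 1).
    replace (_ - 0)%C with (Cpower (1 - RtoC t) y * Cpower (RtoC t) x)%C by ring.
    rewrite <- RtoC_minus.
    rewrite Cmod_mult; eapply Rle_lt_trans; [|apply (D (1 - t)); lra].
    rewrite <- Rmult_1_r; apply Rmult_le_compat_l; [apply Cmod_ge_0|].
    apply Cmod_Cpower_le; lra.
assert (I1 : improper (Beta_integrand (x + 1) y) 0 1 (/ y * P)%C).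
  apply (improper_ext (fun t => / y * (f t + - (1) * (f t + h t)))%C); [lra| |].
    intros t Ht; unfold h; field; exact Ny.
  apply improper_scal; [lra| |].
    intros t Ht; apply Ccontinuous_plus; [now apply Cf|].
    apply Ccontinuous_mult; [apply Ccontinuous_const|].
    apply Ccontinuous_plus; [now apply Cf|now apply Ch].
  replace P with (P + - (1) * (0 - 0))%C by ring.
  apply improper_plus; [lra|exact Cf| |exact HP'|].
    intros t Ht; apply Ccontinuous_mult; [apply Ccontinuous_const|].
    apply Ccontinuous_plus; [now apply Cf|now apply Ch].
  apply improper_scal; [lra| |exact ID].
  intros t Ht; apply Ccontinuous_plus; [now apply Cf|now apply Ch].
(* B(x, y) = B(x, y + 1) + B(x + 1, y), and y B(x + 1, y) = x B(x, y + 1) = P because t^x (1 - t)^y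
   vanishes at both ends. *)
exists (/ x * P + / y * P)%C, (/ y * P)%C; split; [|split; [exact I1|field; split; assumption]].
apply (improper_ext (fun t => / x * f t + Beta_integrand (x + 1) y t)%C); [lra| |].
  intros t Ht; unfold f, Beta_integrand.
  replace (x + 1 - 1)%C with (x - 1 + 1)%C by ring.
  replace (y + 1 - 1)%C with (y - 1 + 1)%C by ring.
  rewrite <- RtoC_minus, !Cpower_plus, !Cpower_1, RtoC_minus by (apply RtoC_neq_0; lra).
  field; exact Nx.
apply improper_plus; [lra| |apply Ccontinuous_in_Beta| |exact I1].
  intros t Ht; apply Ccontinuous_mult; [apply Ccontinuous_const|now apply Cf].
apply improper_scal; [lra|exact Cf|exact HP'].
Qed.

Lemma CInt_unique (f : R -> C) A B l : A < B -> Ccontinuous_in f A B -> improper f A B l ->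
  CInt f (at_right A) (at_left B) = l.
Proof.
intros HAB Hf H; apply (is_RInt_gen_unique (V := C_R_CompleteNormedModule)).
now apply improper_iff.
Qed.

Lemma Beta_moment (x y : C) n t : 0 < t ->
  Beta_integrand (x + RtoC (INR n)) y t = (RtoC (t ^ n) * Beta_integrand x y t)%C.
Proof.
intros Ht; unfold Beta_integrand.
replace (x + RtoC (INR n) - 1)%C with (x - 1 + RtoC (INR n))%C by ring.
rewrite Cpower_plus, Cpower_INR, RtoC_pow by (apply RtoC_neq_0; lra); ring.
Qed.

(* If Beta x y = 0, then by the recurrence all the moments of the integrand vanish. *)
Lemma Beta_neq_0 (x y : C) : 0 < Re x -> 0 < Re y -> Beta x y <> 0.
Proof.
intros Hx Hy E0.
assert (P : forall n, 0 < Re (x + RtoC (INR n))).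
  intros n; simpl; unfold Re in Hx; generalize (pos_INR n); lra.
assert (Z : forall n, improper (Beta_integrand (x + RtoC (INR n)) y) 0 1 0).
  induction n as [|n IH].
    replace (x + RtoC (INR 0))%C with x by (simpl; ring).
    destruct (Beta_recurrence x y Hx Hy) as [J [J1 [HJ _]]].
    rewrite <- E0; unfold Beta.
    change (improper (Beta_integrand x y) 0 1
      (CInt (Beta_integrand x y) (at_right 0) (at_left 1))).
    rewrite (CInt_unique _ 0 1 J); auto; [lra|apply Ccontinuous_in_Beta].
  destruct (Beta_recurrence _ y (P n) Hy) as [J [J1 [HJ [HJ1 E]]]].
  replace (x + RtoC (INR (S n)))%C with (x + RtoC (INR n) + 1)%C
    by (rewrite S_INR, RtoC_plus; ring).
  replace (RtoC 0) with J1; [exact HJ1|].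
  rewrite (improper_unique _ _ _ _ _ HJ IH) in E.
  assert (N : (x + RtoC (INR n) + y)%C <> 0).
    intros N; assert (Q : Re (x + RtoC (INR n) + y) = 0) by (rewrite N; reflexivity).
    specialize (P n); simpl in Q, P; unfold Re in Hy; lra.
  replace J1 with (/ (x + INR n + y) * ((x + INR n + y) * J1))%C by (field; exact N).
  rewrite <- E; ring.
(* With all moments zero, the decay holds for [r = 0] and [K = 0], so the integrand would vanish on
   the whole interval; at 1/2 it is a product of two exponentials. *)
assert (V := decaying_moments (Beta_integrand x y) (fun _ => 0%C) 0 0 ltac:(lra)
  (Ccontinuous_in_Beta x y)).
assert (V2 : Beta_integrand x y (1 / 2) = 0%C).
  apply V; [| |lra].
    intros n; generalize (Z n); apply improper_ext; [lra|].
    intros t Ht; apply Beta_moment; lra.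
  intros n; rewrite Cmod_0; lra.
revert V2; apply Cmult_neq_0.
  rewrite Cpower_pos by lra; apply Cexp_neq_0.
rewrite <- RtoC_minus, Cpower_pos by lra; apply Cexp_neq_0.
Qed.

(** * The M-series along the segment *)

Section MSeries.

Variables (kappa mu : list C) (alpha beta rho : C).

(** The coefficients with respect to the real variable s = 1 / (t (1 - t)), the powers of - rho
    being absorbed; thus the theory of real power series applies to real and imaginary parts. *)
Definition Mcoef (n : nat) : C :=
  (poch_prod kappa n / poch_prod mu n * (Cpow (- rho) n / Gamma (alpha * RtoC (INR n) + beta)))%C.

Definition spread (t : R) : R := / (t * (1 - t)).

(* [t] is the larger root of [t (1 - t) = 1 / s]. *)
Lemma spread_surjective s r : r < 1 -> Rmax 4 (spread r) < s -> exists t,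
  0 < t < 1 /\ r < t /\ spread t = s.
Proof.
intros Hr Hs.
assert (S1 : 4 < s) by (eapply Rle_lt_trans; [apply Rmax_l|exact Hs]).
assert (S2 : spread r < s) by (eapply Rle_lt_trans; [apply Rmax_r|exact Hs]).
set (q := sqrt (1 - 4 / s)).
assert (Q0 : 0 < 1 - 4 / s < 1).
  assert (0 < 4 / s < 1); [|lra].
  split; [apply Rdiv_lt_0_compat; lra|].
  apply (Rmult_lt_reg_r s); [lra|]; field_simplify; lra.
assert (Q1 : q * q = 1 - 4 / s) by (apply sqrt_sqrt; lra).
assert (Q2 : 0 < q) by (apply sqrt_lt_R0; lra).
assert (Q3 : q < 1) by nra.
set (t := (1 + q) / 2).
assert (T : t * (1 - t) = / s).
  replace (t * (1 - t)) with ((1 - q * q) / 4) by (unfold t; field).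
  rewrite Q1; field; lra.
exists t; split; [unfold t; lra|]; split.
  (* If [t <= r], both lie to the right of 1/2, where t (1 - t) decreases, so [spread r] would be at
     least [s]. *)
  apply Rnot_le_lt; intros Hrt.
  assert (r * (1 - r) <= t * (1 - t)) by (unfold t in *; nra).
  assert (0 < r) by (unfold t in *; lra).
  assert (s <= spread r); [|lra].
  unfold spread; rewrite <- (Rinv_inv s); apply Rinv_le_contravar; [nra|]; lra.
unfold spread; rewrite T, Rinv_inv; reflexivity.
Qed.

Lemma Mseries_term_spread t n : 0 < t < 1 ->
  Mseries_term kappa mu alpha beta (- rho / (RtoC t * (1 - RtoC t))) n
  = (Mcoef n * RtoC (spread t ^ n))%C.
Proof.
intros Ht; unfold Mseries_term, Mcoef.
replace (- rho / (RtoC t * (1 - RtoC t)))%C with (- rho * RtoC (spread t))%C.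
  rewrite Cpow_mult_l, RtoC_pow; unfold Cdiv; ring.
unfold spread; rewrite RtoC_inv, RtoC_mult, RtoC_minus by nra; reflexivity.
Qed.

Hypothesis Hconv : forall t, 0 < t < 1 ->
  Mseries_converges kappa mu alpha beta (- rho / (RtoC t * (1 - RtoC t))).

Lemma Mseries_spread t : 0 < t < 1 ->
  Mseries kappa mu alpha beta (- rho / (RtoC t * (1 - RtoC t)))
  = (PSeries (fun n => Re (Mcoef n)) (spread t), PSeries (fun n => Im (Mcoef n)) (spread t)).
Proof.
intros Ht; apply Csum_lim_PSeries.
apply (Csum_lim_ext (Mseries_term kappa mu alpha beta (- rho / (RtoC t * (1 - RtoC t))))).
  intros n; now apply Mseries_term_spread.
now apply CSeries_correct, Hconv.
Qed.

Lemma Mcoef_radius : CV_radius (fun n => Re (Mcoef n)) = p_infty /\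
  CV_radius (fun n => Im (Mcoef n)) = p_infty.
Proof.
(* [spread 0] is 0 by the default value of the inverse, so the bound is 4, the minimum of [spread]
   on (0, 1). *)
assert (L : forall s, Rmax 4 (spread 0) < s ->
    is_lim_seq (fun n => Re (Mcoef n) * s ^ n) 0 /\ is_lim_seq (fun n => Im (Mcoef n) * s ^ n) 0).
  intros s Hs; destruct (spread_surjective s 0 Rlt_0_1 Hs) as [t [Ht [_ <-]]].
  destruct (ex_series_C _ (Hconv t Ht)) as [H1 H2].
  apply ex_series_lim_0 in H1; apply ex_series_lim_0 in H2; split.
    revert H1; apply is_lim_seq_ext; intros n; rewrite Mseries_term_spread by exact Ht.
    simpl; unfold Re; ring.
  revert H2; apply is_lim_seq_ext; intros n; rewrite Mseries_term_spread by exact Ht.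
  simpl; unfold Im; ring.
split; apply (CV_radius_infinite _ (Rmax 4 (spread 0))); intros s Hs; now apply L.
Qed.

Lemma Ccontinuous_in_Mseries :
  Ccontinuous_in (fun t => Mseries kappa mu alpha beta (- rho / (RtoC t * (1 - RtoC t)))) 0 1.
Proof.
intros t Ht; destruct Mcoef_radius as [R1 R2].
assert (L : locally t (fun y => 0 < y < 1)).
  apply filter_and; [apply (open_gt 0)|apply (open_lt 1)]; lra.
apply (continuous_ext_loc (T := R_UniformSpace) (U := NormedModule.UniformSpace _ C_R_NormedModule) _
  (fun t => (PSeries (fun n => Re (Mcoef n)) (spread t),
             PSeries (fun n => Im (Mcoef n)) (spread t)) : C)).
  revert L; apply filter_imp; intros y Hy; symmetry; now apply Mseries_spread.
assert (S : continuous spread t).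
  apply (ex_derive_continuous (V := R_NormedModule)); unfold spread; auto_derive; nra.
apply Ccontinuous_pair.
  apply (continuous_comp spread (PSeries (fun n => Re (Mcoef n)))); [exact S|].
  apply continuity_pt_filterlim, PSeries_continuity; rewrite R1; exact I.
apply (continuous_comp spread (PSeries (fun n => Im (Mcoef n)))); [exact S|].
apply continuity_pt_filterlim, PSeries_continuity; rewrite R2; exact I.
Qed.

Lemma Mseries_zero r : r < 1 ->
  (forall t, 0 < t < 1 -> r < t ->
     Mseries kappa mu alpha beta (- rho / (RtoC t * (1 - RtoC t))) = 0%C) ->
  forall n, Mcoef n = 0%C.
Proof.
intros Hr H; destruct Mcoef_radius as [R1 R2].
assert (Z : forall s, Rmax 4 (spread r) < s ->
    PSeries (fun n => Re (Mcoef n)) s = 0 /\ PSeries (fun n => Im (Mcoef n)) s = 0).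
  intros s Hs; destruct (spread_surjective s r Hr Hs) as [t [Ht [Hrt <-]]].
  assert (E := H t Ht Hrt); rewrite Mseries_spread in E by exact Ht.
  split; [apply (f_equal Re) in E|apply (f_equal Im) in E]; exact E.
intros n; apply C_ext.
  apply (entire_zero _ _ R1 (fun s Hs => proj1 (Z s Hs))).
apply (entire_zero _ _ R2 (fun s Hs => proj2 (Z s Hs))).
Qed.

Lemma poch_prod_neq_0 (k : list C) n : (forall x, In x k -> ~ nonpos_int x) -> poch_prod k n <> 0.
Proof.
induction k as [|x k IH]; intros H; simpl.
  apply RtoC_neq_0; lra.
apply Cmult_neq_0; [apply poch_neq_0, H; now left|].
apply IH; intros y Hy; apply H; now right.
Qed.

(** For small [n] the number alpha n + beta may be a pole of Gamma, where the coefficient is 0. As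
    Re alpha > 0, a large [n] brings it into the right half-plane, and then no factor vanishes. *)
Lemma Mcoef_nonzero : (forall k, In k kappa -> ~ nonpos_int k) ->
  (forall m, In m mu -> ~ nonpos_int m) -> 0 < Re alpha -> rho <> 0 -> exists n, Mcoef n <> 0.
Proof.
intros Hk Hm Ha Hr.
destruct (INR_unbounded (- Re beta / Re alpha)) as [n Hn].
exists n; assert (N : ~ nonpos_int (alpha * RtoC (INR n) + beta)).
  intros [k E]; apply (f_equal Re) in E.
  assert (E' : Re alpha * INR n + Re beta = - INR k) by (simpl in E; unfold Re in *; lra).
  assert (- Re beta < INR n * Re alpha).
    apply (Rmult_lt_compat_r (Re alpha)) in Hn; [|exact Ha].
    replace (- Re beta / Re alpha * Re alpha) with (- Re beta) in Hn by (field; lra); exact Hn.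
  generalize (pos_INR k); lra.
assert (V : forall w : C, w <> 0 -> (/ w)%C <> 0).
  intros w Hw E; apply (RtoC_neq_0 1 R1_neq_R0); rewrite <- (Cinv_r w Hw), E; ring.
unfold Mcoef, Cdiv; repeat apply Cmult_neq_0.
- now apply poch_prod_neq_0.
- now apply V, poch_prod_neq_0.
- apply Cpow_nz; intros E; apply Hr; replace rho with (- - rho)%C by ring; rewrite E; ring.
- now apply V, Gamma_neq_0.
Qed.

End MSeries.

(** * Divergence of the hypergeometric series outside the unit disk *)

Lemma binom_neq_0 (l : C) n : ~ nonpos_int l -> binom l n <> 0.
Proof.
intros Hl E; apply (poch_neq_0 l n Hl).
assert (F : RtoC (INR (fact n)) <> 0) by apply RtoC_neq_0, INR_fact_neq_0.
replace (poch l n) with (binom l n * RtoC (INR (fact n)))%C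
  by (unfold binom; field; exact F).
rewrite E; ring.
Qed.

(** Bounded terms give |m n| <= K / |binom l n z^n|, and the ratio test applies to these
    reciprocals, which exist because [l] is not a nonpositive integer. *)
Lemma moments_decay (l z : C) (m : nat -> C) K : ~ nonpos_int l -> 1 < Cmod z ->
  (forall n, Cmod (binom l n * Cpow z n * m n) <= K) ->
  exists r K', 0 <= r < 1 /\ forall n, Cmod (m n) <= K' * r ^ n.
Proof.
intros Hl Hz HK.
set (x := Cmod z) in *; set (L := Cmod l); assert (HL : 0 <= L) by apply Cmod_ge_0.
(* Any number between 1 and |z| would do: for large n, |l + n| / (n + 1) >= 1 / p, so |binom l n
   z^n| grows at least by the factor |z| / p = 1 / q. *)
set (p := (x + 1) / 2); set (q := p / x).
assert (Hp : 1 < p < x) by (unfold p; lra).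
assert (Hq : 0 < q < 1).
  unfold q; split; [apply Rdiv_lt_0_compat; lra|].
  apply (Rmult_lt_reg_r x); [lra|]; field_simplify; lra.
assert (U0 : forall n, 0 < Cmod (binom l n * Cpow z n)).
  intros n; apply Cmod_gt_0, Cmult_neq_0; [now apply binom_neq_0|apply Cpow_nz].
  intros E; unfold x in Hz; rewrite E, Cmod_0 in Hz; lra.
destruct (INR_unbounded ((1 + p * L) / (p - 1))) as [N HN].
destruct (geometric_growth (fun n => / Cmod (binom l n * Cpow z n)) q N)
  as [K' [K0 HK']]; [lra| | |].
- intros n; apply Rlt_le, Rinv_0_lt_compat, U0.
- intros n Hn.
  assert (HnN := le_INR _ _ Hn); assert (Hn0 := pos_INR n).
  assert (HpN : 1 + p * L <= (p - 1) * INR n).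
    replace (1 + p * L) with ((p - 1) * ((1 + p * L) / (p - 1))) by (field; lra).
    apply Rmult_le_compat_l; lra.
  assert (T : INR n - L <= Cmod (l + RtoC (INR n))).
    assert (T' := Cmod_triangle (l + RtoC (INR n)) (- l)).
    replace (l + INR n + - l)%C with (RtoC (INR n)) in T' by ring.
    rewrite Cmod_opp, Cmod_R, Rabs_pos_eq in T' by lra; unfold L; lra.
  assert (E := binom_Cmod_S l n).
  assert (G : Cmod (binom l n * z ^ n) <= q * Cmod (binom l (S n) * z ^ S n)).
    rewrite !Cmod_mult, !Cmod_pow; fold x; simpl pow.
    set (b := Cmod (binom l n)) in *; set (b' := Cmod (binom l (S n))) in *.
    assert (Hb : 0 <= b) by apply Cmod_ge_0.
    replace (q * (b' * (x * x ^ n))) with (p * b' * x ^ n) by (unfold q; field; lra).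
    apply Rmult_le_compat_r; [apply pow_le; lra|].
    apply (Rmult_le_reg_r (INR n + 1)); [lra|].
    replace (p * b' * (INR n + 1)) with (b * (p * Cmod (l + INR n))) 
      by (transitivity (p * (b' * (INR n + 1))); [rewrite E|]; ring).
    apply Rmult_le_compat_l; nra.
  apply (Rmult_le_reg_r (Cmod (binom l (S n) * z ^ S n))); [apply U0|].
  rewrite Rinv_l by apply Rgt_not_eq, U0.
  apply (Rmult_le_reg_r (Cmod (binom l n * z ^ n))); [apply U0|].
  replace (q * / Cmod (binom l n * z ^ n) * Cmod (binom l (S n) * z ^ S n)
     * Cmod (binom l n * z ^ n)) with (q * Cmod (binom l (S n) * z ^ S n))
    by (field; apply Rgt_not_eq, U0).
  lra.
exists q, (K * K'); split; [lra|]; intros n.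
specialize (HK n); rewrite Cmod_mult in HK; specialize (HK' n); specialize (U0 n).
set (u := Cmod (binom l n * z ^ n)) in *.
replace (Cmod (m n)) with (u * Cmod (m n) * / u) by (field; lra).
rewrite Rmult_assoc; apply Rle_trans with (K * / u).
  rewrite <- Rmult_assoc; apply Rmult_le_compat_r; [|exact HK].
  apply Rlt_le, Rinv_0_lt_compat, U0.
rewrite Rmult_assoc; apply Rmult_le_compat_l; [|exact HK'].
eapply Rle_trans; [|exact HK]; apply Rmult_le_pos; [lra|apply Cmod_ge_0].
Qed.

(** * Changes of variables *)

(** [D] is a domain on which [phi] is regular, given by order-convexity so as to cover both the
    half-line and (0, pi / 2). The substitution rule is applied on segments in [D], and the ends are
    handled by the limits of [phi]. *)
Lemma is_CInt_subst (f : R -> C) (A B : R) (l : C) (phi dphi : R -> R) (D : R -> Prop)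
    (Fa Fb : (R -> Prop) -> Prop) {FFa : Filter Fa} {FFb : Filter Fb} :
  Ccontinuous_in f A B -> improper f A B l ->
  (forall x y z, D x -> D z -> x <= y <= z -> D y) -> Fa D -> Fb D ->
  (forall x, D x -> A < phi x < B /\ is_derive phi x (dphi x) /\ continuous dphi x) ->
  filterlim phi Fa (at_right A) -> filterlim phi Fb (at_left B) ->
  is_CInt (fun x => RtoC (dphi x) * f (phi x))%C Fa Fb l.
Proof.
intros Hf Hl HD HDa HDb Hphi La Lb P HP.
apply improper_filterlim in Hl.
destruct (Hl P HP) as [Q S HQ HS HQS].
apply (Filter_prod _ _ _ (fun x => D x /\ Q (phi x)) (fun x => D x /\ S (phi x))).
- apply filter_and; [exact HDa|exact (La Q HQ)].
- apply filter_and; [exact HDb|exact (Lb S HS)].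
- intros x y [Dx Qx] [Dy Sy]; exists (CRInt f (phi x) (phi y)).
  split; [|exact (HQS _ _ Qx Sy)].
  assert (In : forall t, Rmin x y <= t <= Rmax x y -> D t).
    intros t Ht; destruct (Rle_dec x y).
      rewrite Rmin_left, Rmax_right in Ht by lra; exact (HD x t y Dx Dy Ht).
    rewrite Rmin_right, Rmax_left in Ht by lra; exact (HD y t x Dy Dx Ht).
  apply (is_RInt_ext (V := C_R_NormedModule) (fun t => scal (dphi t) (f (phi t) : C_R_NormedModule))).
    intros t _; apply C_ext; unfold scal; simpl; unfold scal; simpl; unfold mult; simpl;
      unfold Re, Im; ring.
  apply (is_RInt_comp (V := C_R_CompleteNormedModule) f phi dphi).
    intros t Ht; apply Hf, Hphi, In, Ht.
  intros t Ht; apply Hphi, In, Ht.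
Qed.

Lemma filterlim_at_right (phi : R -> R) a b : continuous phi a -> phi a = b ->
  at_right a (fun x => b < phi x) -> filterlim phi (at_right a) (at_right b).
Proof.
intros Hc <- H P [eps HP].
destruct (Hc _ (locally_ball (phi a) eps)) as [d Hd].
assert (L : at_right a (fun x => ball (phi a) eps (phi x))).
  exists d; intros y Hy _; now apply Hd.
unfold filtermap; generalize (filter_and _ _ H L).
apply filter_imp; intros x [H1 H2]; now apply HP.
Qed.

Lemma filterlim_at_left (phi : R -> R) a b : continuous phi a -> phi a = b ->
  at_left a (fun x => phi x < b) -> filterlim phi (at_left a) (at_left b).
Proof.
intros Hc <- H P [eps HP].
destruct (Hc _ (locally_ball (phi a) eps)) as [d Hd].
assert (L : at_left a (fun x => ball (phi a) eps (phi x))).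
  exists d; intros y Hy _; now apply Hd.
unfold filtermap; generalize (filter_and _ _ H L).
apply filter_imp; intros x [H1 H2]; now apply HP.
Qed.

Lemma at_right_interval a b : a < b -> at_right a (fun x => a < x < b).
Proof.
intros H; exists (mkposreal (b - a) ltac:(lra)); intros x Hx Hax.
apply Rabs_lt_between in Hx; unfold minus, plus, opp in Hx; simpl in Hx; lra.
Qed.

Lemma at_left_interval a b : a < b -> at_left b (fun x => a < x < b).
Proof.
intros H; exists (mkposreal (b - a) ltac:(lra)); intros x Hx Hax.
apply Rabs_lt_between in Hx; unfold minus, plus, opp in Hx; simpl in Hx; lra.
Qed.

Lemma is_CInt_subst_half_line (f : R -> C) (l : C) : Ccontinuous_in f 0 1 -> improper f 0 1 l ->
  is_CInt (fun u => RtoC (/ ((1 + u) * (1 + u))) * f (u / (1 + u))%R)%C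
    (at_right 0) (Rbar_locally p_infty) l.
Proof.
intros Hf Hl.
apply (is_CInt_subst f 0 1 l (fun u => u / (1 + u)) (fun u => / ((1 + u) * (1 + u)))
  (fun u => 0 < u)); auto; try typeclasses eauto.
- intros; lra.
- generalize (at_right_interval 0 1 Rlt_0_1); apply filter_imp; intros; lra.
- now exists 0.
- intros u Hu; split; [|split].
  + split; [apply Rdiv_lt_0_compat; lra|].
    apply (Rmult_lt_reg_r (1 + u)); [lra|]; field_simplify; lra.
  + auto_derive; [lra|field; lra].
  + apply (ex_derive_continuous (V := R_NormedModule)); auto_derive; nra.
- apply filterlim_at_right; [|field|].
    apply (ex_derive_continuous (V := R_NormedModule)); auto_derive; lra.
  generalize (at_right_interval 0 1 Rlt_0_1); apply filter_imp; intros x Hx.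
  apply Rdiv_lt_0_compat; lra.
- intros P [eps HP]; exists (/ eps); intros u Hu.
  assert (He := cond_pos eps).
  assert (Hi : 0 < / eps) by now apply Rinv_0_lt_compat.
  apply HP.
    apply Rabs_def1; unfold minus, plus, opp; simpl.
      replace (u / (1 + u) + - (1)) with (- / (1 + u)) by (field; lra).
      assert (0 < / (1 + u)) by (apply Rinv_0_lt_compat; lra); lra.
    replace (u / (1 + u) + - (1)) with (- / (1 + u)) by (field; lra).
    apply Ropp_lt_contravar; rewrite <- (Rinv_inv eps); apply Rinv_lt_contravar; [nra|lra].
  apply (Rmult_lt_reg_r (1 + u)); [lra|]; field_simplify; lra.
Qed.

Lemma is_CInt_subst_sin2 (f : R -> C) (l : C) : Ccontinuous_in f 0 1 -> improper f 0 1 l ->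
  is_CInt (fun x => RtoC (2 * sin x * cos x) * f (sin x * sin x)%R)%C
    (at_right 0) (at_left (PI / 2)) l.
Proof.
intros Hf Hl; assert (HPI := PI2_RGT_0).
assert (SC : forall x, 0 < x < PI / 2 -> 0 < sin x /\ 0 < cos x).
  intros x Hx; split; [apply sin_gt_0|apply cos_gt_0]; lra.
assert (Cs : forall x, continuous (fun x => sin x * sin x) x).
  intros x; apply (ex_derive_continuous (V := R_NormedModule)); auto_derive; trivial.
assert (R01 : forall x, 0 < x < PI / 2 -> 0 < sin x * sin x < 1).
  intros x Hx; destruct (SC x Hx) as [S1 S2]; generalize (sin2_cos2 x); unfold Rsqr; nra.
apply (is_CInt_subst f 0 1 l (fun x => sin x * sin x) (fun x => 2 * sin x * cos x)
  (fun x => 0 < x < PI / 2)); auto; try typeclasses eauto.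
- intros; lra.
- now apply at_right_interval.
- now apply at_left_interval.
- intros x Hx; split; [now apply R01|split].
  + auto_derive; [trivial|ring].
  + apply (ex_derive_continuous (V := R_NormedModule)); auto_derive; trivial.
- apply filterlim_at_right; [apply Cs|rewrite sin_0; ring|].
  generalize (at_right_interval 0 (PI / 2) HPI); apply filter_imp; intros x Hx; now apply R01.
- apply filterlim_at_left; [apply Cs|rewrite sin_PI2; ring|].
  generalize (at_left_interval 0 (PI / 2) HPI); apply filter_imp; intros x Hx; now apply R01.
Qed.

Lemma Cpower_RtoC_mult (x y : R) (c : C) : 0 < x -> 0 < y ->
  Cpower (RtoC (x * y)) c = (Cpower (RtoC x) c * Cpower (RtoC y) c)%C.
Proof. intros Hx Hy; rewrite RtoC_mult; now apply Cpower_scal. Qed.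

Lemma Cpower_RtoC_inv (x : R) (c : C) : 0 < x ->
  Cpower (RtoC (/ x)) c = Cpower (RtoC x) (- c).
Proof.
intros Hx; rewrite !Cpower_pos by (try apply Rinv_0_lt_compat; exact Hx).
rewrite ln_Rinv, RtoC_opp by exact Hx; f_equal; ring.
Qed.

Lemma is_CInt_ext (f g : R -> C) (D : R -> Prop) (Fa Fb : (R -> Prop) -> Prop) l
    {FFa : Filter Fa} {FFb : Filter Fb} :
  (forall x y z, D x -> D z -> x <= y <= z -> D y) -> Fa D -> Fb D ->
  (forall x, D x -> f x = g x) -> is_CInt f Fa Fb l -> is_CInt g Fa Fb l.
Proof.
intros HD HDa HDb E; apply (is_RInt_gen_ext (V := C_R_NormedModule) f g).
apply (Filter_prod _ _ _ D D HDa HDb); intros x y Dx Dy t Ht; simpl in Ht; apply E.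
destruct (Rle_dec x y).
  rewrite Rmin_left, Rmax_right in Ht by lra; apply (HD x t y); auto; lra.
rewrite Rmin_right, Rmax_left in Ht by lra; apply (HD y t x); auto; lra.
Qed.

(** * The Euler integral *)

(** The conclusion keeps the value [J] and the continuity of [f], because the changes of variables
    start from these. *)
Lemma MGauss_Euler (kappa mu : list C) (alpha beta l1 l2 l3 rho z : C) :
  (forall k, In k kappa -> ~ nonpos_int k) -> (forall m, In m mu -> ~ nonpos_int m) ->
  0 < Re alpha -> Re l2 < Re l3 -> 0 < Re l2 -> 0 < Re rho ->
  MGauss_converges kappa mu alpha beta l1 l2 l3 z rho ->
  let f := fun t : R => (Cpower (RtoC t) (l2 - 1) * Cpower (1 - RtoC t) (l3 - l2 - 1)
    * Cpower (1 - z * RtoC t) (- l1)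
    * Mseries kappa mu alpha beta (- rho / (RtoC t * (1 - RtoC t))))%C in
  (z = 1 -> ex_CInt f (at_right 0) (at_left 1)) ->
  exists J, Ccontinuous_in f 0 1 /\ improper f 0 1 J /\
    MGauss kappa mu alpha beta l1 l2 l3 z rho = (/ Beta l2 (l3 - l2) * J)%C.
Proof.
intros Hk Hmu Ha H32 H2 Hr [HB HS] f Hz1.
set (g := Mbeta_integrand kappa mu alpha beta l2 (l3 - l2) rho).
set (m := fun n => Mbeta kappa mu alpha beta (l2 + RtoC (INR n)) (l3 - l2) rho).
set (B := Beta l2 (l3 - l2)).
assert (H32' : 0 < Re (l3 - l2)) by (simpl; unfold Re in *; lra).
assert (B0 : B <> 0) by now apply Beta_neq_0.
destruct (HB O) as [HM _].
assert (CB : forall n, Ccontinuous_in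
    (Mbeta_integrand kappa mu alpha beta (l2 + RtoC (INR n)) (l3 - l2) rho) 0 1).
  intros n; apply (Ccontinuous_in_mult (Beta_integrand (l2 + RtoC (INR n)) (l3 - l2))).
    apply Ccontinuous_in_Beta.
  now apply Ccontinuous_in_Mseries.
assert (Eg : forall n t, 0 < t -> Mbeta_integrand kappa mu alpha beta (l2 + RtoC (INR n)) (l3 - l2) rho t
    = (RtoC (t ^ n) * g t)%C).
  intros n t Ht; assert (E := Beta_moment l2 (l3 - l2) n t Ht); unfold Beta_integrand in E.
  unfold g, Mbeta_integrand; rewrite E; ring.
assert (Hg : Ccontinuous_in g 0 1).
  assert (Q := CB O); unfold g; replace l2 with (l2 + RtoC (INR 0))%C at 1 by (simpl; ring).
  exact Q.
assert (Hm : forall n, improper (fun t => RtoC (t ^ n) * g t)%C 0 1 (m n)).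
  intros n; destruct (HB n) as [_ [J HJ]].
  assert (HJ' := proj1 (improper_iff _ 0 1 J Rlt_0_1 (CB n)) HJ).
  unfold m, Mbeta; rewrite (CInt_unique _ 0 1 J Rlt_0_1 (CB n) HJ').
  revert HJ'; apply improper_ext; [lra|]; intros t Ht; apply Eg; lra.
assert (Ef : forall t, f t = (Cpower (1 - z * RtoC t) (- l1) * g t)%C).
  intros t; unfold f, g, Mbeta_integrand; ring.
assert (Et : forall n, MGauss_term kappa mu alpha beta l1 l2 l3 z rho n
    = (/ B * (binom l1 n * Cpow z n * m n))%C).
  intros n; unfold MGauss_term, binom, Cdiv; fold B (m n); ring.
(* In every case it remains to find [J] as the value of the integral and, at the same time, as the
   sum of the series of moments. *)
assert (Concl : forall J, Ccontinuous_in (fun t => Cpower (1 - z * RtoC t) (- l1)) 0 1 ->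
    improper (fun t => Cpower (1 - z * RtoC t) (- l1) * g t)%C 0 1 J ->
    Csum_lim (fun n => binom l1 n * Cpow z n * m n)%C J ->
    exists J, Ccontinuous_in f 0 1 /\ improper f 0 1 J /\
      MGauss kappa mu alpha beta l1 l2 l3 z rho = (/ B * J)%C).
  intros J Hc HJ HL; exists J; split; [|split].
  - intros t Ht; apply (continuous_ext (T := R_UniformSpace)
      (U := NormedModule.UniformSpace _ C_R_NormedModule)
      (fun t => Cpower (1 - z * RtoC t) (- l1) * g t)%C).
      intros s; symmetry; apply Ef.
    exact (Ccontinuous_in_mult _ _ _ _ Hc Hg t Ht).
  - revert HJ; apply improper_ext; [lra|]; intros t _; symmetry; apply Ef.
  - apply CSeries_unique.
    apply (Csum_lim_ext (fun n => / B * (binom l1 n * Cpow z n * m n))%C).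
      intros n; symmetry; apply Et.
    now apply Csum_lim_scal.
set (S := (B * MGauss kappa mu alpha beta l1 l2 l3 z rho)%C).
assert (HL : Csum_lim (fun n => binom l1 n * Cpow z n * m n)%C S).
  apply (Csum_lim_ext (fun n => B * MGauss_term kappa mu alpha beta l1 l2 l3 z rho n)%C).
    intros n; rewrite Et; field; exact B0.
  apply Csum_lim_scal; now apply CSeries_correct.
assert (Line : forall t, Re (1 - z * RtoC t) = 1 - Re z * t)
  by (intros t; simpl; unfold Re; ring).
(* The terminating case is separated because only there can |z| exceed 1, so that 1 - z t may meet
   the cut; the power is then a polynomial, which settles continuity. *)
destruct (classic (nonpos_int l1)) as [[n Hn]|Hl].
  destruct (integral_terminating g m l1 Hg Hm z n Hn) as [J [HJ HLJ]].
  apply (Concl J); auto.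
  intros t Ht; apply (continuous_ext (T := R_UniformSpace)
    (U := NormedModule.UniformSpace _ C_R_NormedModule) (fun t => Cpow (1 - z * RtoC t) n)).
    intros s; rewrite Hn; replace (- - RtoC (INR n))%C with (RtoC (INR n)) by ring.
    symmetry; apply Cpower_INR.
  assert (Q : Ccontinuous (fun t => 1 - z * RtoC t)%C t)
    by exact (is_Cderive_continuous _ _ _ (is_Cderive_line z t)).
  clear - Q; induction n as [|n IH]; simpl; [apply Ccontinuous_const|].
  now apply Ccontinuous_mult.
destruct (Rlt_le_dec 1 (Cmod z)) as [Hz|Hz].
  (* The moments of g would decay geometrically, so that the M-series would vanish for t
     near 1, hence identically. *)
  exfalso.
  destruct (Csum_lim_terms _ _ HL) as [K HK].
  destruct (moments_decay l1 z m K Hl Hz HK) as [r [K' [Hr' HK']]].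
  assert (Z := decaying_moments g m r K' Hr' Hg Hm HK').
  destruct (Mcoef_nonzero kappa mu alpha beta rho Hk Hmu Ha) as [n Hn].
    intros E; rewrite E in Hr; simpl in Hr; lra.
  apply Hn; apply (Mseries_zero kappa mu alpha beta rho HM r); [lra|].
  intros t Ht Hrt; assert (Zt := Z t ltac:(lra)); unfold g, Mbeta_integrand in Zt.
  set (M := Mseries _ _ _ _ _) in *.
  destruct (Ceq_dec M 0) as [E|E]; [exact E|exfalso; revert Zt].
  repeat apply Cmult_neq_0; [| |exact E].
    rewrite Cpower_pos by lra; apply Cexp_neq_0.
  rewrite <- RtoC_minus, Cpower_pos by lra; apply Cexp_neq_0.
(* In the closed unit disk, Re z >= 1 leaves the single point z = 1. *)
destruct (Rlt_le_dec (Re z) 1) as [Hz'|Hz'].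
  apply (Concl S).
  - apply Ccontinuous_in_Cpower_line; intros t Ht; rewrite Line.
    assert (0 <= (1 - Re z) * t) by (apply Rmult_le_pos; lra); lra.
  - now apply (integral_circle g m l1 Hg Hm).
  - exact HL.
assert (Ez : z = RtoC 1).
  assert (Q := Cmod_sqr z); assert (Q0 := Cmod_ge_0 z).
  assert (P := Re_le_Cmod z); apply Rabs_le_between in P.
  assert (Re z = 1) by lra; assert (Cmod z = 1) by lra.
  apply C_ext; [exact H|]; simpl; nra.
(* Here the assumed convergence of the integral enters; [integral_one] identifies its value with the
   sum of the series. *)
subst z; destruct (Hz1 eq_refl) as [I HI].
assert (Cf : Ccontinuous_in (fun t => Cpower (1 - 1 * RtoC t) (- l1)) 0 1).
  apply Ccontinuous_in_Cpower_line; intros t Ht; rewrite Line; simpl; lra.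
assert (Cff : Ccontinuous_in f 0 1).
  intros t Ht; apply (continuous_ext (T := R_UniformSpace)
    (U := NormedModule.UniformSpace _ C_R_NormedModule)
    (fun t => Cpower (1 - 1 * RtoC t) (- l1) * g t)%C).
    intros s; symmetry; apply Ef.
  exact (Ccontinuous_in_mult _ _ _ _ Cf Hg t Ht).
apply improper_iff in HI; [|lra|exact Cff].
assert (HI' : improper (fun t => Cpower (1 - 1 * RtoC t) (- l1) * g t)%C 0 1 I).
  revert HI; apply improper_ext; [lra|]; intros t _; apply Ef.
apply (Concl I Cf HI').
replace I with S; [exact HL|].
apply (integral_one g m l1 Hg Hm S I); [|exact HL].
revert HI'; apply improper_ext; [lra|]; intros t _.
now replace (1 - 1 * RtoC t)%C with (RtoC (1 - t)) by (rewrite RtoC_minus; ring).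
Qed.

Local Open Scope C_scope.

Theorem theorem4p7 :
  forall (kappa mu : list C) (alpha beta l1 l2 l3 rho z : C),
  (forall k, In k kappa -> ~ nonpos_int k) ->
  (forall m, In m mu -> ~ nonpos_int m) ->
  (0 < Re alpha)%R ->
  (Re l2 < Re l3)%R -> (0 < Re l2)%R ->
  (0 < Re rho)%R ->
  (* the function on the left-hand side is defined at these arguments *)
  MGauss_converges kappa mu alpha beta l1 l2 l3 z rho ->
  let f1 := fun t : R =>
    Cpower (RtoC t) (l2 - 1) * Cpower (1 - RtoC t) (l3 - l2 - 1)
    * Cpower (1 - z * RtoC t) (- l1)
    * Mseries kappa mu alpha beta (- rho / (RtoC t * (1 - RtoC t))) in
  let f2 := fun u : R =>
    Cpower (RtoC u) (l2 - 1) * Cpower (1 + RtoC u) (l1 - l3)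
    * Cpower (1 + RtoC u * (1 - z)) (- l1)
    * Mseries kappa mu alpha beta
        (- (2 * rho) - rho * (RtoC u + 1 / RtoC u)) in
  let f3 := fun theta : R =>
    Cpower (RtoC (sin theta)) (2 * l2 - 1)
    * Cpower (RtoC (cos theta)) (2 * l3 - 2 * l2 - 1)
    * Cpower (1 - z * Cpow (RtoC (sin theta)) 2) (- l1)
    * Mseries kappa mu alpha beta
        (- rho / (Cpow (RtoC (sin theta)) 2 * Cpow (RtoC (cos theta)) 2)) in
  (* at z = 1 the convergence of the integrals does not follow from that of
     the series *)
  (z = 1 ->
   ex_CInt f1 (at_right 0) (at_left 1)) ->
  (ex_CInt f1 (at_right 0) (at_left 1)
   /\ MGauss kappa mu alpha beta l1 l2 l3 z rho
      = 1 / Beta l2 (l3 - l2)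
        * CInt f1 (at_right 0) (at_left 1))
  /\
  (ex_CInt f2 (at_right 0) (Rbar_locally p_infty)
   /\ MGauss kappa mu alpha beta l1 l2 l3 z rho
      = 1 / Beta l2 (l3 - l2)
        * CInt f2 (at_right 0) (Rbar_locally p_infty))
  /\
  (ex_CInt f3 (at_right 0) (at_left (PI / 2))
   /\ MGauss kappa mu alpha beta l1 l2 l3 z rho
      = 2 / Beta l2 (l3 - l2)
        * CInt f3 (at_right 0) (at_left (PI / 2))).
Proof.
intros kappa mu alpha beta l1 l2 l3 rho z Hk Hmu Ha H32 H2 Hr HC f1 f2 f3 Hz1.
destruct (MGauss_Euler kappa mu alpha beta l1 l2 l3 rho z Hk Hmu Ha H32 H2 Hr HC Hz1)
  as [J [Cf [HJ E]]].
fold f1 in Cf, HJ.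
assert (I1 : is_CInt f1 (at_right 0) (at_left 1) J)
  by exact (proj2 (improper_iff f1 0 1 J Rlt_0_1 Cf) HJ).
assert (I2 : is_CInt f2 (at_right 0) (Rbar_locally p_infty) J).
  apply (is_CInt_ext _ f2 (fun u => 0 < u)%R _ _ J) with
    (5 := is_CInt_subst_half_line f1 J Cf HJ); try typeclasses eauto.
  - intros; lra.
  - generalize (at_right_interval 0 1 Rlt_0_1); apply filter_imp; intros; lra.
  - now exists 0%R.
  - intros u Hu; unfold f1, f2.
    assert (Hp : (0 < 1 + u)%R) by lra.
    assert (Np : RtoC (1 + u) <> 0) by (apply RtoC_neq_0; lra).
    assert (Nu : RtoC u <> 0) by (apply RtoC_neq_0; lra).
    assert (Np' : 1 + RtoC u <> 0) by (rewrite <- RtoC_plus; exact Np).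
    set (e := Cpower (RtoC (1 + u))).
    replace (Cpower (RtoC (u / (1 + u))) (l2 - 1))
      with (Cpower (RtoC u) (l2 - 1) * e (- (l2 - 1))).
    2:{ unfold Rdiv; rewrite Cpower_RtoC_mult, Cpower_RtoC_inv by
          (try apply Rinv_0_lt_compat; lra); reflexivity. }
    replace (1 - RtoC (u / (1 + u))) with (RtoC (/ (1 + u))).
    2:{ rewrite <- RtoC_minus; f_equal; field; lra. }
    rewrite Cpower_RtoC_inv by exact Hp; fold (e (- (l3 - l2 - 1))).
    replace (1 - z * RtoC (u / (1 + u))) with (RtoC (/ (1 + u)) * (1 + RtoC u * (1 - z))).
    2:{ unfold Rdiv; rewrite RtoC_mult, RtoC_inv, RtoC_plus by lra; field; exact Np'. }
    rewrite Cpower_scal, Cpower_RtoC_inv by (try apply Rinv_0_lt_compat; lra).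
    fold (e (- - l1)).
    replace (RtoC (/ ((1 + u) * (1 + u)))) with (e (- (1)) * e (- (1))).
    2:{ unfold e; rewrite <- Cpower_RtoC_inv, Cpower_1, <- RtoC_mult by exact Hp.
        f_equal; field; lra. }
    replace (- rho / (RtoC (u / (1 + u)) * RtoC (/ (1 + u))))
      with (- (2 * rho) - rho * (RtoC u + 1 / RtoC u)).
    2:{ unfold Rdiv; rewrite RtoC_mult, RtoC_inv, RtoC_plus by lra; field.
        split; assumption. }
    rewrite <- RtoC_plus; fold (e (l1 - l3)).
    (* The exponents of 1 + u: -2 from the Jacobian, then those coming from t, 1 - t and 1 - z t. *)
    replace (l1 - l3) with (- (1) + - (1) + - (l2 - 1) + - (l3 - l2 - 1) + - - l1) by ring.
    unfold e; rewrite !(Cpower_plus (RtoC (1 + u))) by exact Np; ring.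
(* The Jacobian of t = sin^2 theta is 2 sin theta cos theta; its 2 is not part of [f3], whence the
   value J / 2 and the numerator 2 in the formula. *)
assert (I3 : is_CInt f3 (at_right 0) (at_left (PI / 2)) (RtoC (/ 2) * J)).
  assert (HPI := PI2_RGT_0).
  assert (Q := is_RInt_gen_scal (V := C_R_NormedModule) _ (/ 2)%R _
    (is_CInt_subst_sin2 f1 J Cf HJ)).
  replace (RtoC (/ 2) * J) with (scal (/ 2)%R (J : C_R_NormedModule)).
  2:{ apply C_ext; unfold scal; simpl; unfold scal; simpl; unfold mult; simpl;
      unfold Re, Im; ring. }
  apply (is_CInt_ext _ f3 (fun x => 0 < x < PI / 2)%R _ _ _) with (5 := Q);
    try typeclasses eauto.
  - intros; lra.
  - now apply at_right_interval.
  - now apply at_left_interval.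
  - intros x Hx; unfold f1, f3.
    assert (Hs : (0 < sin x)%R) by (apply sin_gt_0; lra).
    assert (Hc : (0 < cos x)%R) by (apply cos_gt_0; lra).
    set (s := sin x) in *; set (k := cos x) in *.
    assert (Ek : (1 - s * s = k * k)%R)
      by (generalize (sin2_cos2 x); unfold Rsqr; fold s k; lra).
    rewrite <- RtoC_minus, Ek, !Cpower_RtoC_mult by assumption.
    match goal with |- scal _ ?w = _ => transitivity (RtoC (/ 2) * w) end.
      apply C_ext; unfold scal; simpl; unfold scal; simpl; unfold mult; simpl;
        unfold Re, Im; ring.
    assert (Ns : RtoC s <> 0) by (apply RtoC_neq_0; lra).
    assert (Nk : RtoC k <> 0) by (apply RtoC_neq_0; lra).
    (* The final 1 in each exponent is the factor sin theta or cos theta supplied by the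
       Jacobian. *)
    replace (2 * l2 - 1) with (l2 - 1 + (l2 - 1) + 1) by ring.
    replace (2 * l3 - 2 * l2 - 1) with (l3 - l2 - 1 + (l3 - l2 - 1) + 1) by ring.
    rewrite !(Cpower_plus (RtoC s)), !(Cpower_plus (RtoC k)), !Cpower_1 by assumption.
    replace (Cpow (RtoC s) 2) with (RtoC (s * s)) by (rewrite RtoC_mult; simpl; ring).
    replace (Cpow (RtoC k) 2) with (RtoC (k * k)) by (rewrite RtoC_mult; simpl; ring).
    replace (RtoC (2 * s * k)) with (2 * RtoC s * RtoC k) by (now rewrite !RtoC_mult).
    rewrite (RtoC_inv 2) by lra; field.
split; [|split]; split.
- now exists J.
- rewrite E; unfold CInt.
  rewrite (is_RInt_gen_unique (V := C_R_CompleteNormedModule) f1 J I1); unfold Cdiv; ring.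
- now exists J.
- rewrite E; unfold CInt.
  rewrite (is_RInt_gen_unique (V := C_R_CompleteNormedModule) f2 J I2); unfold Cdiv; ring.
- now exists (RtoC (/ 2) * J).
- rewrite E; unfold CInt.
  rewrite (is_RInt_gen_unique (V := C_R_CompleteNormedModule) f3 _ I3).
  rewrite RtoC_inv by lra; unfold Cdiv.
  replace (2 * / Beta l2 (l3 - l2) * (/ 2 * J)) with ((2 * / 2) * (/ Beta l2 (l3 - l2) * J)) by ring.
  rewrite Cinv_r by (apply RtoC_neq_0; lra); ring.
Qed.
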